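(* Let $1\leqslant\xi<\omega_1$. If $X$ is any block subspace of $\mathfrak{X}_{0,1}^{\omega^\xi}$, then $AD(X)=\omega^\xi+1$.
   Context: Schreier families: $\mathcal{S}_0=\{\varnothing\}\cup\{\{n\}\}$, $\mathcal{S}_1=\{E:|E|\leqslant\min E\}$, $\mathcal{S}_{\zeta+1}=\{\bigcup_{i=1}^nE_i:E_1<\dots<E_n,E_i\in\mathcal{S}_\zeta,n\leqslant\min E_1\}$ (where $E<F$ means $\max E<\min F$), and for a countable limit ordinal $\zeta$ a sequence $\zeta_n\uparrow\zeta$ is fixed with $\mathcal{S}_{\zeta_n}\subset\mathcal{S}_{\zeta_{n+1}}$, $\mathcal{S}_\zeta=\{E:\exists n,\ n\leqslant\min E,\ E\in\mathcal{S}_{\zeta_n}\}$. The space $\mathfrak{X}_{0,1}^{\omega^\xi}$: for $f\in c_{00}(\mathbb{N})$, $\mathrm{supp} f=\{i:f(i)\neq0\}$, and $f<g$ means $\mathrm{supp}f<\mathrm{supp}g$. For $G\subset c_{00}$, a vector of the form $\alpha=\frac1\ell\sum_{q=1}^d f_q$ with $f_1<\dots<f_d$ in $G$, $d\leqslant\ell$, $\ell\geqslant2$, is an $\alpha$-average of size $s(\alpha)=\ell$. A sequence $\alpha_1<\dots<\alpha_d$ of $\alpha$-averages is $\mathcal{S}_{\omega^\xi}$-admissible if $\{\min\mathrm{supp}\,\alpha_q:q\leqslant d\}\in\mathcal{S}_{\omega^\xi}$, and very fast growing if $s(\alpha_1)<s(\alpha_2)<\cdots$ and $s(\alpha_q)>\max\mathrm{supp}\,\alpha_{q-1}$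 for $q>1$. Let $W_0=\{\pm e_n:n\in\mathbb{N}\}$; given $W_m$, let $W^\alpha_{m+1}=\{\frac1\ell\sum_{q=1}^df_q: f_1<\dots<f_d\in W_m,\ \ell\geqslant2,\ \ell\geqslant d\}$, $W^S_{m+1}=\{\sum_{q=1}^d\alpha_q: (\alpha_q)_{q=1}^d\subset W_m$ an $\mathcal{S}_{\omega^\xi}$-admissible very fast growing sequence of $\alpha$-averages$\}$, $W_{m+1}=W_{m+1}^\alpha\cup W^S_{m+1}\cup W_m$, $W=\bigcup_m W_m$. For $x\in c_{00}(\mathbb{N})$, $\|x\|=\sup\{\sum_i f(i)x(i): f\in W\}$, and $\mathfrak{X}_{0,1}^{\omega^\xi}$ is the completion of $(c_{00}(\mathbb{N}),\|\cdot\|)$, with basis $(e_n)$. A block subspace is the closed span of a block sequence of $(e_n)$, taken with that block basis. Distortion index: for a Banach space $X$ with basis and a family $\mathcal{F}$ of finite subsets of $\mathbb{N}$, $t\geqslant1$, $X$ is $t$-$\mathcal{F}$ distortable if there is an equivalent norm $|\cdot|$ such that for every normalized block sequence $(x_i)$ of the basis there exist $E\in\mathcal{F}$ and $x,y\in\mathrm{span}\{x_i:i\in E\}$ with $\|x\|=\|y\|=1$, $|x|/|y|>t$; $X$ is $\mathcal{F}$ arbitrarily distortable if it is $t$-$\mathcal{F}$ distortable for all $t\geqslant1$; $AD(X)=\min\{\zeta<\omega_1: X$ is $\mathcal{S}_\zeta$ arbitrarily distortable$\}$, or $\omega_1$ if none. *)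

(* Defs.v *)
From mathcomp Require Import all_boot all_order all_algebra.
From mathcomp Require Import all_classical all_reals.
Set Implicit Arguments. Unset Strict Implicit. Unset Printing Implicit Defensive.
Import Order.TTheory GRing.Theory Num.Theory.
Local Open Scope ring_scope.

(* Countable ordinals as Brouwer trees.  Every tree denotes a countable      *)
(* ordinal (OZ = 0, OS a = a+1, OL f = sup_n f n) and every countable        *)
(* ordinal is denoted by some tree.  Ordinal comparison is the standard      *)
(* (semantic) order on Brouwer trees; two trees denote the same ordinal iff  *)
(* oeq holds.                                                                *)
Inductive Ord : Type := OZ | OS of Ord | OL of (nat -> Ord).

Inductive ole : Ord -> Ord -> Prop :=
| ole_Z b : ole OZ b
| ole_S a b : olt a b -> ole (OS a) b
| ole_L f b : (forall n, ole (f n) b) -> ole (OL f) b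
with olt : Ord -> Ord -> Prop :=
| olt_S a b : ole a b -> olt a (OS b)
| olt_L a f n : olt a (f n) -> olt a (OL f).

Definition oeq (a b : Ord) : Prop := ole a b /\ ole b a.

Definition is_limit (a : Ord) : Prop :=
  ~ oeq a OZ /\ forall b, ~ oeq a (OS b).

Fixpoint ofin (n : nat) : Ord := if n is n'.+1 then OS (ofin n') else OZ.
Definition oomega : Ord := OL ofin.
Definition oone : Ord := OS OZ.

Fixpoint oadd (a b : Ord) : Ord :=
  match b with
  | OZ => a
  | OS b' => OS (oadd a b')
  | OL f => OL (fun n => oadd a (f n))
  end.

Fixpoint omul (a b : Ord) : Ord :=
  match b with
  | OZ => OZ
  | OS b' => oadd (omul a b') a
  | OL f => OL (fun n => omul a (f n))
  end.

Fixpoint oexpw (b : Ord) : Ord :=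
  match b with
  | OZ => oone
  | OS b' => omul (oexpw b') oomega
  | OL f => OL (fun n => oexpw (f n))
  end.

(* Schreier families.  A finite subset E of N = {1,2,...} is represented by  *)
(* the strictly increasing sequence of its elements; a family is a predicate *)
(* on such sequences.                                                        *)
Definition fam := seq nat -> Prop.

Definition setlt (E F : seq nat) : bool := all (fun a => all (fun b => a < b)%N F) E.

Definition le_min (n : nat) (E : seq nat) : bool := all (fun m => n <= m)%N E.

Definition S0 : fam := fun E => E = [::] \/ exists n, (0 < n)%N /\ E = [:: n].

Definition succ_fam (S : fam) : fam := fun E =>
  exists Es : seq (seq nat),
    [/\ E = flatten Es,
        all (fun A => A != [::]) Es,
        (forall A, A \in Es -> S A),
        pairwise setlt Es &
        le_min (size Es) E].

(* A Schreier system: an assignment zeta |-> S_zeta for all countable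
   ordinals (given on trees, but depending only on the ordinal denoted)
   obeying the recursive definition, where for each limit ordinal zeta some
   sequence zeta_1 < zeta_2 < ... with supremum zeta and
   S_{zeta_n} included in S_{zeta_{n+1}} is used.  Here z k = zeta_{k+1}. *)
Record schreier_system (S : Ord -> fam) : Prop := {
  schreier_ext : forall a b, oeq a b -> forall E, S a E <-> S b E;
  schreier_zero : forall E, S OZ E <-> S0 E;
  schreier_succ : forall a E, S (OS a) E <-> succ_fam (S a) E;
  schreier_lim : forall a, is_limit a ->
    exists z : nat -> Ord,
      [/\ forall k, olt (z k) (z k.+1),
          forall k, olt (z k) a,
          forall b, olt b a -> exists k, ole b (z k),
          forall k E, S (z k) E -> S (z k.+1) E &
          forall E, S a E <-> exists k, le_min k.+1 E /\ S (z k) E]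
}.

(* The space X_{0,1}^{omega^xi}.  Vectors are real functions on nat; the    *)
(* basis is (e_n)_{n >= 1} (coordinate 0 is unused: W-functionals and all   *)
(* vectors considered vanish there), so that indices coincide with N.       *)
Section Space.
Variable R : realType.

Definition vec := nat -> R.
Definition vzero : vec := fun _ => 0.

Definition e (n : nat) : vec := fun i => (i == n)%:R.

Definition blk (f g : vec) : Prop :=
  forall i j, f i != 0 -> g j != 0 -> (i < j)%N.

Definition vsum (fs : seq vec) : vec := fun i => \sum_(f <- fs) f i.

Definition is_min_supp (f : vec) (m : nat) : Prop :=
  f m != 0 /\ forall i, f i != 0 -> (m <= i)%N.
Definition is_max_supp (f : vec) (m : nat) : Prop :=
  f m != 0 /\ forall i, f i != 0 -> (i <= m)%N.

Definition is_avg (G : vec -> Prop) (l : nat) (a : vec) : Prop :=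
  exists fs : seq vec,
    [/\ (2 <= l)%N /\ (0 < size fs)%N /\ (size fs <= l)%N,
        forall q, (q < size fs)%N -> G (nth vzero fs q),
        forall p q, (p < q)%N -> (q < size fs)%N ->
                    blk (nth vzero fs p) (nth vzero fs q) &
        a = fun i => (l%:R)^-1 * vsum fs i].

Definition W0 (f : vec) : Prop :=
  exists n, (0 < n)%N /\ (f = e n \/ f = fun i => - e n i).

Definition Walpha (G : vec -> Prop) (f : vec) : Prop := exists l, is_avg G l f.

Definition WS (F : fam) (G : vec -> Prop) (f : vec) : Prop :=
  exists (als : seq vec) (ls : seq nat) (ms : seq nat),
    [/\ (0 < size als)%N /\ size ls = size als /\ size ms = size als,
        forall q, (q < size als)%N ->
           G (nth vzero als q) /\ is_avg G (nth 0%N ls q) (nth vzero als q),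
        forall p q, (p < q)%N -> (q < size als)%N ->
           blk (nth vzero als p) (nth vzero als q),
        (forall q, (q < size als)%N -> is_min_supp (nth vzero als q) (nth 0%N ms q))
          /\ F ms /\
        (forall q, (q.+1 < size als)%N ->
           (nth 0%N ls q < nth 0%N ls q.+1)%N /\
           forall M, is_max_supp (nth vzero als q) M -> (M < nth 0%N ls q.+1)%N) &
        f = vsum als].

Fixpoint Wm (F : fam) (m : nat) : vec -> Prop :=
  match m with
  | 0%N => W0
  | m'.+1 => fun f => Walpha (Wm F m') f \/ WS F (Wm F m') f \/ Wm F m' f
  end.

Definition inW (F : fam) (f : vec) : Prop := exists m, Wm F m f.

Definition supp_below (x : vec) (N : nat) : Prop := forall i, (N <= i)%N -> x i = 0.

Definition Wnorm (F : fam) (x : vec) : R :=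
  sup [set r : R | exists (f : vec) (N : nat),
         [/\ inW F f, supp_below x N & r = \sum_(i < N) f i * x i]].

Definition block_basis (u : nat -> vec) : Prop :=
  [/\ forall k, exists N, supp_below (u k) N,
      forall k, u k 0%N = 0,
      forall k, exists i, u k i != 0 &
      forall k k', (k < k')%N -> blk (u k) (u k')].

Definition in_span (u : nat -> vec) (x : vec) : Prop :=
  exists (n : nat) (a : nat -> R), x = fun i => \sum_(k < n) a k * u k i.

(* |.| is an equivalent norm on X = closed span of (u_k) (given by its
   restriction to the dense subspace span(u_k), which determines it) *)
Definition equiv_norm (F : fam) (u : nat -> vec) (nu : vec -> R) : Prop :=
  [/\ forall x y, in_span u x -> in_span u y -> nu (x \+ y) <= nu x + nu y,
      forall (c : R) x, in_span u x -> nu (fun i => c * x i) = `|c| * nu x &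
      exists c C : R, [/\ 0 < c, 0 < C &
         forall x, in_span u x -> c * Wnorm F x <= nu x /\ nu x <= C * Wnorm F x]].

(* (x_i)_{i in N} (index 0 unused) is a normalized block sequence of the
   basis (u_k) of X *)
Definition norm_block_seq (F : fam) (u : nat -> vec) (x : nat -> vec) : Prop :=
  exists (Fs : nat -> seq nat) (a : nat -> R),
    [/\ forall i, (0 < i)%N -> x i = (fun j => \sum_(k <- Fs i) a k * u k j),
        forall i, (0 < i)%N -> Wnorm F (x i) = 1 &
        forall i i', (0 < i)%N -> (i < i')%N -> setlt (Fs i) (Fs i')].

Definition in_span_on (x : nat -> vec) (E : seq nat) (y : vec) : Prop :=
  exists c : nat -> R, y = fun j => \sum_(i <- E) c i * x i j.

Definition t_distortable (F : fam) (u : nat -> vec) (G : fam) (t : R) : Prop :=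
  exists nu : vec -> R,
    equiv_norm F u nu /\
    forall x, norm_block_seq F u x ->
      exists E y z, [/\ G E, in_span_on x E y /\ in_span_on x E z,
                        Wnorm F y = 1, Wnorm F z = 1 & nu y / nu z > t].

Definition arb_distortable (F : fam) (u : nat -> vec) (G : fam) : Prop :=
  forall t : R, 1 <= t -> t_distortable F u G t.

Definition AD_is (S : Ord -> fam) (F : fam) (u : nat -> vec) (a : Ord) : Prop :=
  arb_distortable F u (S a) /\
  forall b, olt b a -> ~ arb_distortable F u (S b).

End Space.

(* Main.v *)
(* Why the index is omega^xi + 1.  Write G for S_(omega^xi).
   Upper bound.  Every normalized block sequence has further blocks that form
   an l_1 sequence, with a universal constant, on the sets of each S_zeta with
   zeta < omega^xi.  Either its vectors are asymptotically null for Schreier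
   sums of large averages; then long sums of them are bounded, are normed by
   averages of large size, and those averages can be added along sets of G.  Or
   Schreier functionals keep acting on a subsequence, and James' argument makes
   the constant universal.  Special convex combinations z_1, ..., z_n of such
   l_1 blocks are c_0-like: sums of z_k stay bounded, each z_k is hardly seen by
   averages of size n, but the average of their norming functionals sees
   z_1 + ... + z_n.  Each z_k lives on a set of G, so the whole pair lives on a
   set of S_(omega^xi + 1).
   Lower bound.  James' argument for l_1, applied to an arbitrary equivalent
   norm at a level zeta < omega^xi where its best l_1 constant has almost
   stabilized, gives blocks on whose G-spans that norm is equivalent to a
   multiple of the l_1 norm, with universal constants; it applies because
   omega^xi is additively indecomposable. *)
Require Import Defs.
From mathcomp Require Import all_boot all_order all_algebra.
From mathcomp Require Import all_classical all_reals.
From mathcomp Require Import zify lra.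
Set Implicit Arguments. Unset Strict Implicit. Unset Printing Implicit Defensive.
Import Order.TTheory GRing.Theory Num.Theory.
Local Open Scope ring_scope.

(* [Order.TTheory] shadows this [le_min]. *)
Local Notation le_min := Defs.le_min.

(** * Countable ordinals *)

(** Families S_zeta with different indices compare only on tails, and the sequences fixed at limits
    are arbitrary. So every l_1 estimate holds on those sets of a level that start after a threshold
    depending on the level, and sequences are built by choosing each object beyond all earlier
    thresholds. Diagonalizing turns such tail estimates into one on all of S_(omega^xi), because
    every set there has some level k and minimum above k. The c_0-like behaviour rests on very fast
    growth: once an average reaches past the first vector that the functional meets, all later
    averages have size larger than that position, and such averages are negligible on the remaining
    vectors by construction. One exceptional average is left; an induction over W with a bound
    leaving room for it deals with that. This fixes the constants. Sums of c_0-like vectors have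
    norm at most 5 while an average sees at least 1/2 of them, so the l_1 constant is 1/10; James'
    argument pins an equivalent norm up to a factor 2, so it varies by a factor of at most 2 * 10 on
    normalized vectors. *)

Lemma olt_OSE a b : olt a (OS b) <-> ole a b.
Proof. by split=> [h|/olt_S//]; inversion h. Qed.

Lemma ole_OSE a b : ole (OS a) b <-> olt a b.
Proof. by split=> [h|/ole_S//]; inversion h. Qed.

Lemma olt_OLE a f : olt a (OL f) <-> exists n, olt a (f n).
Proof. by split=> [h|[n /olt_L//]]; inversion h as [|? ? n]; subst; exists n. Qed.

Lemma ole_OLE f b : ole (OL f) b <-> forall n, ole (f n) b.
Proof. by split=> [h|/ole_L//]; inversion h. Qed.

Lemma olt_OZ a : ~ olt a OZ.
Proof. by move=> h; inversion h. Qed.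

Lemma ole_sup a f n : ole a (f n) -> ole a (OL f).
Proof.
elim: a => [|a _|g IH] h; first exact: ole_Z.
  by move/ole_OSE: h => h; apply/ole_OSE/olt_OLE; exists n.
by apply/ole_OLE => k; apply: IH; move/ole_OLE: h.
Qed.

Lemma ole_refl a : ole a a.
Proof.
elim: a => [|a IH|f IH]; first exact: ole_Z.
  exact/ole_S/olt_S.
by apply: ole_L => n; apply: ole_sup (IH n).
Qed.

Scheme ole_mut := Minimality for ole Sort Prop
  with olt_mut := Minimality for olt Sort Prop.

(** Isolates the induction on the upper bound, so that the mutual induction behind [ole_trans] can
    call it in the successor case. *)
Lemma ole_lt_trans_step a b : (forall c, ole b c -> ole a c) ->
  forall c, olt b c -> olt a c.
Proof.
move=> H; elim=> [/olt_OZ//|c _ /olt_OSE h|f IH /olt_OLE[n h]].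
  exact/olt_OSE/H.
exact/olt_L/(IH n).
Qed.

Lemma ole_trans b a c : ole a b -> ole b c -> ole a c.
Proof.
move=> h; move: a b h c.
apply: (@ole_mut (fun a b => forall c, ole b c -> ole a c)
  (fun a b => forall c, ole b c -> olt a c)) => [b c _|a b _ IH c h|f b _ IH c h
  |a b _ IH c h|a f n _ IH c h].
- exact: ole_Z.
- by apply: ole_S; apply: IH.
- by apply: ole_L => n; apply: IH.
- by move/ole_OSE: h; exact: ole_lt_trans_step IH _.
- by move/ole_OLE: h => /(_ n); exact: IH.
Qed.

Lemma ole_lt_trans b a c : ole a b -> olt b c -> olt a c.
Proof. by move=> h; apply: ole_lt_trans_step => d; exact: ole_trans. Qed.

Lemma olt_le_trans b a c : olt a b -> ole b c -> olt a c.
Proof. by move=> /ole_OSE h1 h2; apply/ole_OSE; exact: ole_trans h1 h2. Qed.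

Lemma ole_OS a : ole a (OS a).
Proof.
elim: a => [|a IH|f IH]; first exact: ole_Z.
  exact/ole_S/olt_S.
apply: ole_L => n; apply: ole_trans (IH n) _.
exact/ole_S/olt_S/ole_sup/ole_refl.
Qed.

Lemma olt_ole a b : olt a b -> ole a b.
Proof. by move=> /ole_OSE; apply: ole_trans; exact: ole_OS. Qed.

Lemma olt_trans b a c : olt a b -> olt b c -> olt a c.
Proof. by move=> h /olt_ole; apply: olt_le_trans. Qed.

Lemma olt_OS a : olt a (OS a).
Proof. exact/olt_S/ole_refl. Qed.

Lemma ole_total a b : ole a b \/ olt b a.
Proof.
elim: a b => [|a IH|f IH] b; first by left; exact: ole_Z.
  elim: b => [|b _|f IHf].
  - by right; apply/olt_OSE; exact: ole_Z.
  - case: (IH b) => hb; first by left; apply/ole_OSE/olt_OSE.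
    by right; apply/olt_OSE/ole_OSE.
  - have [[n h]|h] := pselect (exists n, olt a (f n)).
      by left; apply/ole_OSE/olt_L/h.
    right; apply/olt_OSE/ole_L => n.
    by case: (IHf n) => [/ole_OSE h1|/olt_OSE //]; case: h; exists n.
have [h|/existsNP[n h]] := pselect (forall n, ole (f n) b).
  by left; apply: ole_L.
by right; case: (IH n b) => // h1; apply: olt_L h1.
Qed.

Lemma olt_wf a : Acc olt a.
Proof.
suff H c : forall b, olt b c -> Acc olt b by exact: (H _ _ (olt_OS a)).
elim: c => [|c IH|f IH] b h.
- by case: (olt_OZ h).
- by constructor=> d dlt; apply: IH; apply: olt_le_trans dlt _; apply/olt_OSE.
- by move/olt_OLE: h => [n]; exact: IH.
Qed.

Lemma olt_irr a : ~ olt a a.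
Proof. by elim: (olt_wf a) => b _ IH hb; exact: (IH _ hb hb). Qed.

(** A tree [OL f] may well denote zero or a successor, while [is_limit] speaks of the ordinal
    denoted. Arguments along a Schreier system therefore combine this trichotomy with induction on
    [olt] and ignore the shape of the tree. *)
Lemma ord_cases a : [\/ oeq a OZ, exists b, oeq a (OS b) | is_limit a].
Proof.
have [h|h0] := pselect (oeq a OZ); first by constructor 1.
have [h|h1] := pselect (exists b, oeq a (OS b)); first by constructor 2.
by constructor 3; split=> // b h; apply: h1; exists b.
Qed.

Lemma oadd_ge a b : ole a (oadd a b).
Proof.
elim: b => [|b IH|f IH] /=; first exact: ole_refl.
  exact: ole_trans IH (olt_ole (olt_OS _)).
exact: ole_sup (IH 0%N).
Qed.

(** The two claims feed each other: the weak one at [c] follows from the strict one at [c] by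
    induction on the smaller argument, and the strict one at a successor follows from the weak one
    below it. *)
Lemma oadd_mono_r_aux a b : forall c,
  (ole b c -> ole (oadd a b) (oadd a c)) /\ (olt b c -> olt (oadd a b) (oadd a c)).
Proof.
suff H c : forall b, (ole b c -> ole (oadd a b) (oadd a c)) /\
   (olt b c -> olt (oadd a b) (oadd a c)) by move=> c; exact: H.
have L d : (forall b, olt b d -> olt (oadd a b) (oadd a d)) ->
    forall b, ole b d -> ole (oadd a b) (oadd a d).
  move=> IH; elim=> [|b' _|f IHf] h /=; first exact: oadd_ge.
    by apply/ole_OSE/IH/ole_OSE.
  by apply/ole_OLE => n; apply: IHf; move/ole_OLE: h.
elim: c => [|c IH|f IH].
- have h0 b' : olt b' OZ -> olt (oadd a b') (oadd a OZ) by move=> /olt_OZ.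
  by move=> b'; split; [exact: L | exact: h0].
- have h0 b' : olt b' (OS c) -> olt (oadd a b') (oadd a (OS c)).
    by move=> /olt_OSE h; apply/olt_OSE/(IH b').1.
  by move=> b'; split; [exact: L | exact: h0].
- have h0 b' : olt b' (OL f) -> olt (oadd a b') (oadd a (OL f)).
    by move=> /olt_OLE[n h]; apply/olt_L/(IH n b').2.
  by move=> b'; split; [exact: L | exact: h0].
Qed.

Lemma oadd_le_r a b c : ole b c -> ole (oadd a b) (oadd a c).
Proof. exact: (oadd_mono_r_aux a b c).1. Qed.

Lemma oadd_lt_r a b c : olt b c -> olt (oadd a b) (oadd a c).
Proof. exact: (oadd_mono_r_aux a b c).2. Qed.

Lemma oadd_le_l a b c : ole a b -> ole (oadd a c) (oadd b c).
Proof.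
move=> h; elim: c => [|c IH|f IH] //=; first exact/ole_OSE/olt_OSE.
by apply: ole_L => n; apply: ole_sup (IH n).
Qed.

Lemma oadd_lt_l a b c d : olt a b -> olt c d -> olt (oadd a c) (oadd b d).
Proof.
move=> h1 h2; apply: ole_lt_trans (oadd_lt_r _ h2).
exact/oadd_le_l/olt_ole.
Qed.

Lemma oaddA_le a b c : ole (oadd a (oadd b c)) (oadd (oadd a b) c).
Proof.
elim: c => [|c IH|f IH] /=; first exact: ole_refl.
  exact/ole_OSE/olt_OSE.
by apply: ole_L => n; apply: ole_sup (IH n).
Qed.

Lemma omul_ofinD a n m :
  ole (oadd (omul a (ofin n)) (omul a (ofin m))) (omul a (ofin (n + m))).
Proof.
elim: m => [|m IH] /=; first by rewrite addn0; exact: ole_refl.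
rewrite addnS /=.
exact: ole_trans (oaddA_le _ _ _) (oadd_le_l _ IH).
Qed.

(** At a successor exponent both summands lie below finite multiples of the smaller power, and
    finite multiples add up to finite multiples. *)
Lemma oexpw_indecomposable xi a b :
  olt a (oexpw xi) -> olt b (oexpw xi) -> olt (oadd a b) (oexpw xi).
Proof.
elim: xi a b => [|c _|f IH] a b /=.
- move=> /olt_OSE ha /olt_OSE hb; apply/olt_OSE.
  exact: ole_trans (oadd_le_l _ ha) (oadd_le_r _ hb).
- move=> /olt_OLE[n ha] /olt_OLE[m hb].
  apply: (@olt_L _ _ (n + m)); apply: olt_le_trans (omul_ofinD _ _ _).
  exact: oadd_lt_l.
- move=> /olt_OLE[n ha] /olt_OLE[m hb].
  (* The exponents [f n] need not increase, so both summands are placed below the larger of the two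
     powers found. *)
  case: (ole_total (oexpw (f n)) (oexpw (f m))) => h.
    by apply: (@olt_L _ _ m); apply: IH => //; apply: olt_le_trans h.
  by apply: (@olt_L _ _ n); apply: IH => //; apply: olt_trans h.
Qed.

Lemma oexpw_gt0 xi : olt OZ (oexpw xi).
Proof.
elim: xi => [|c IH|f IH] /=; first exact: olt_OS; last exact: olt_L (IH 0%N).
by apply: (@olt_L _ _ 1); apply: olt_le_trans (oadd_lt_r _ IH) (ole_refl _).
Qed.

Lemma oexpw_gt1 xi : ole oone xi -> olt oone (oexpw xi).
Proof.
move=> /ole_OSE; elim: xi => [|c _|f IH] /= h; first by case: (olt_OZ h).
  apply: (@olt_L _ _ 2) => /=.
  have h1 : olt OZ (oadd OZ (oexpw c)).
    by apply: olt_le_trans (oadd_lt_r _ (oexpw_gt0 c)) (ole_refl _).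
  apply: (@ole_lt_trans (oadd (oadd OZ (oexpw c)) OZ)).
    exact/ole_OSE.
  exact/oadd_lt_r/oexpw_gt0.
by move/olt_OLE: h => [n h]; apply: (@olt_L _ _ n); exact: IH.
Qed.

(** Indecomposability with second summand 1. This is where [xi] at least 1 matters: omega^0 = 1 is
    not a limit. *)
Lemma oexpw_succ xi a : ole oone xi -> olt a (oexpw xi) -> olt (OS a) (oexpw xi).
Proof. by move=> h ha; exact: (oexpw_indecomposable ha (oexpw_gt1 h)). Qed.

Lemma oexpw_limit xi : ole oone xi -> is_limit (oexpw xi).
Proof.
move=> h; split=> [[h1 _]|b [h1 h2]].
  by apply: (@olt_irr OZ); apply: olt_le_trans (oexpw_gt0 xi) h1.
have hb : olt b (oexpw xi) by exact/ole_OSE.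
by apply: (@olt_irr (OS b)); apply: olt_le_trans (oexpw_succ h hb) h1.
Qed.

(** * Schreier families *)

Lemma setltP (E F : seq nat) :
  reflect (forall a b, a \in E -> b \in F -> (a < b)%N) (setlt E F).
Proof.
apply: (iffP seq.allP) => h; first by move=> a b aE bF; have /seq.allP := h a aE; apply.
by move=> a aE; apply/seq.allP => b; exact: h.
Qed.

Lemma le_minP (n : nat) (E : seq nat) :
  reflect (forall m, m \in E -> (n <= m)%N) (le_min n E).
Proof. exact: (@seq.allP nat (leq n) E). Qed.

Lemma le_min_trans m n E : (m <= n)%N -> le_min n E -> le_min m E.
Proof.
by move=> mn /le_minP h; apply/le_minP => i /h; apply: leq_trans.
Qed.

Lemma sorted_le_last (s : seq nat) i : sorted ltn s -> i \in s -> (i <= last 0%N s)%N.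
Proof.
case/lastP: s => // s n; rewrite last_rcons (sorted_pairwise ltn_trans) -cats1.
rewrite pairwise_cat mem_cat mem_seq1 => /andP[/allrelP h _].
by move=> /orP[/h/(_ (mem_head _ _))/ltnW|/eqP ->].
Qed.

Lemma sorted_ge_head (s : seq nat) i : sorted ltn s -> i \in s -> (head 0%N s <= i)%N.
Proof.
case: s => //= n s /(order_path_min ltn_trans)/seq.allP h.
by rewrite in_cons => /orP[/eqP ->|/h/ltnW].
Qed.

Lemma mem_head_last (s : seq nat) : s != [::] -> head 0%N s \in s /\ last 0%N s \in s.
Proof. by case: s => // n s _; split; [exact: mem_head | exact: mem_last]. Qed.

Lemma setlt_sorted_flatten (Es : seq (seq nat)) :
  (forall A, A \in Es -> sorted ltn A) -> pairwise setlt Es ->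
  sorted ltn (flatten Es).
Proof.
elim: Es => [|A Es IH] //= hs /andP[hA hp].
rewrite (sorted_pairwise ltn_trans) pairwise_cat; apply/and3P; split.
- apply/allrelP => a b aA /flattenP[B BEs bB].
  by have /setltP := seq.allP hA B BEs; apply.
- by rewrite -(sorted_pairwise ltn_trans); apply: hs; rewrite inE eqxx.
- rewrite -(sorted_pairwise ltn_trans); apply: IH => // B BEs.
  by apply: hs; rewrite inE BEs orbT.
Qed.

(** [reg_spread] merges heredity and spreading: [mu] embeds [F] increasingly into [E] without moving
    a point to the right. Subsets are the case where [mu] is the identity. *)
Record regular (K : fam) : Prop := Regular {
  reg_spread : forall E F (mu : nat -> nat), K E -> sorted ltn F ->
    (forall i, i \in F -> mu i \in E /\ (mu i <= i)%N) ->
    (forall i j, i \in F -> j \in F -> (i < j)%N -> (mu i < mu j)%N) -> K F;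
  reg_sorted : forall E, K E -> sorted ltn E;
  reg_gt0 : forall E i, K E -> i \in E -> (0 < i)%N;
  reg_single : forall n, (0 < n)%N -> K [:: n] }.

Section RegularTheory.
Variable K : fam.
Hypothesis Kreg : regular K.

Lemma reg_nil : K [::].
Proof.
by apply: (@reg_spread K Kreg [:: 1%N] [::] id) => //; exact: reg_single.
Qed.

Lemma reg_sub E F : K E -> sorted ltn F -> {subset F <= E} -> K F.
Proof.
by move=> KE sF FE; apply: (reg_spread Kreg (mu := id) KE sF) => // i iF;
  split=> //; exact: FE.
Qed.

(** The form in which spreading gets applied: one list of labels (indices or averages) with two
    increasing maps, [mu] into the known set and [pi] onto the new one. *)
Lemma reg_spread_map (I : eqType) E (T : seq I) (mu pi : I -> nat) : K E ->
    (forall t, t \in T -> mu t \in E /\ (mu t <= pi t)%N) ->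
    pairwise (relpre mu ltn) T -> pairwise (relpre pi ltn) T -> K (map pi T).
Proof.
case: T => [|t0 T0]; first by move=> *; exact: reg_nil.
set T := t0 :: T0 => KE h1 hmu hpi.
have sT : sorted ltn (map pi T) by rewrite (sorted_pairwise ltn_trans) pairwise_map.
pose r k := nth t0 T (index k (map pi T)).
have rP k : k \in map pi T -> r k \in T /\ pi (r k) = k.
  move=> kT; have iK : (index k (map pi T) < size T)%N.
    by rewrite -(size_map pi) index_mem.
  by split; [exact: mem_nth | rewrite /r -(nth_map t0 0%N) ?nth_index].
apply: (reg_spread Kreg (mu := mu \o r) KE) => // [k /rP[rT rk]|k l kT lT kl].
  by have [? ?] := h1 _ rT; split=> //=; rewrite -[leqRHS]rk.
move/(pairwiseP t0): hmu; apply; rewrite ?inE -?(size_map pi) ?index_mem //.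
rewrite ltnNge; apply/negP => lk.
have := sorted_leq_index leq_trans leqnn (sub_sorted (fun x y => @ltnW x y) sT)
  l k lT kT lk.
by rewrite leqNgt kl.
Qed.

Lemma reg_map E (pi : nat -> nat) : K E -> (forall i, (i <= pi i)%N) ->
  (forall i j, (i < j)%N -> (pi i < pi j)%N) -> K (map pi E).
Proof.
move=> KE h1 h2; have := reg_sorted Kreg KE.
rewrite (sorted_pairwise ltn_trans) => pE.
apply: (@reg_spread_map _ E E id pi KE) => //.
by apply: sub_pairwise pE => i j; exact: h2.
Qed.

End RegularTheory.

Lemma regular_S0 : regular S0.
Proof.
split.
- move=> E F mu [->|[n [n0 ->]]] sF h1 h2.
    by case: F sF h1 h2 => [|i F] _ h1 _; [left | have [] := h1 i (mem_head _ _)].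
  case: F sF h1 h2 => [|i [|j F]] sF h1 h2; [by left| |].
    right; exists i; split=> //.
    by have [] := h1 i (mem_head _ _); rewrite inE => /eqP ->; exact: leq_trans.
  have ij : (i < j)%N by move: sF => /= /andP[].
  have jF : j \in [:: i, j & F] by rewrite !inE eqxx orbT.
  have := h2 i j (mem_head _ _) jF ij.
  have [] := h1 i (mem_head _ _); rewrite inE => /eqP -> _.
  by have [] := h1 j jF; rewrite inE => /eqP -> _; rewrite ltnn.
- by move=> E [->|[n [_ ->]]].
- by move=> E i [->|[n [n0 ->]]] //; rewrite inE => /eqP ->.
- by move=> n n0; right; exists n.
Qed.

Lemma regular_ext (K L : fam) : (forall E, K E <-> L E) -> regular K -> regular L.
Proof.
move=> KL [h1 h2 h3 h4]; split.
- by move=> E F mu /KL KE sF g1 g2; apply/KL; exact: h1 g1 g2.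
- by move=> E /KL; exact: h2.
- by move=> E i /KL; exact: h3.
- by move=> n n0; apply/KL; exact: h4.
Qed.

Lemma succ_fam_sub (K : fam) E : regular K -> K E -> succ_fam K E.
Proof.
move=> Kreg KE; case: (eqVneq E [::]) => [->|E0]; first by exists [::].
exists [:: E]; split=> //=; rewrite ?cats0 ?E0 //.
  by move=> A; rewrite inE => /eqP ->.
by apply/le_minP => i; exact: (reg_gt0 Kreg KE).
Qed.

Lemma succ_fam_succ (K : fam) E (Es : seq (seq nat)) : regular K ->
  (forall A, A \in Es -> K A) -> pairwise setlt Es ->
  le_min (size Es) (flatten Es) -> E = flatten Es -> succ_fam K E.
Proof.
move=> Kreg hK hp hm ->; exists [seq A <- Es | A != [::]]; split.
- by elim: Es {hK hp hm} => //= A Es ->; case: A.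
- exact: filter_all.
- by move=> A; rewrite mem_filter => /andP[_]; exact: hK.
- by apply: subseq_pairwise hp; exact: filter_subseq.
- by apply: le_min_trans hm; exact: size_subseq (filter_subseq _ _).
Qed.

Lemma regular_succ (K : fam) : regular K -> regular (succ_fam K).
Proof.
move=> Kreg; split.
- move=> E F mu [Es [-> _ hK hp hm]] sF h1 h2.
  (* The pieces of [F] are the preimages under [mu] of the pieces of [E]. Some may be empty, which
     [succ_fam_succ] tolerates. *)
  pose Fs := [seq [seq i <- F | mu i \in A] | A <- Es].
  have sFs A : A \in Fs -> sorted ltn A.
    by move=> /mapP[B _ ->]; apply: (sorted_filter ltn_trans).
  have pFs : pairwise setlt Fs.
    rewrite pairwise_map; apply: sub_pairwise hp => A B /setltP AB /=.
    apply/setltP => i j; rewrite !mem_filter => /andP[iA iF] /andP[jB jF].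
    rewrite ltnNge leq_eqVlt; apply/negP => /orP[/eqP e|ji].
      by have := AB _ _ iA jB; rewrite e ltnn.
    by have := AB _ _ iA jB; rewrite ltnNge (ltnW (h2 _ _ jF iF ji)).
  have FE : F = flatten Fs.
    apply: (irr_sorted_eq ltn_trans ltnn) => //; first exact: setlt_sorted_flatten.
    move=> i; apply/idP/flattenP => [iF|[_ /mapP[A AE ->]]]; last first.
      by rewrite mem_filter => /andP[].
    have [/flattenP[A AE iA] _] := h1 i iF.
    by exists [seq i <- F | mu i \in A]; [exact: map_f | rewrite mem_filter iA].
  apply: (succ_fam_succ (Es := Fs)) => //.
    move=> _ /mapP[A AE ->]; apply: (reg_spread Kreg (mu := mu) (hK A AE)).
    - exact: (sorted_filter ltn_trans).
    - by move=> i; rewrite mem_filter => /andP[iA /h1[]].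
    - by move=> i j; rewrite !mem_filter => /andP[_ iF] /andP[_ jF]; exact: h2.
  rewrite -FE size_map; apply/le_minP => i /h1[h3]; apply: leq_trans.
  by move/le_minP: hm; apply.
- move=> E [Es [-> _ hK hp _]]; apply: setlt_sorted_flatten => // A /hK.
  exact: (reg_sorted Kreg).
- by move=> E i [Es [-> _ hK _ _]] /flattenP[A /hK hA]; exact: (reg_gt0 Kreg hA).
- by move=> n n0; apply: succ_fam_sub => //; exact: reg_single.
Qed.

Section SchreierSystem.
Variable S : Ord -> fam.
Hypothesis HS : schreier_system S.

Lemma schreier_regular a : regular (S a).
Proof.
elim: (olt_wf a) => {}a _ IH; case: (ord_cases a) => [h|[b h]|h].
- apply: regular_ext regular_S0 => E.
  by rewrite (schreier_ext HS h) (schreier_zero HS).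
- apply: (@regular_ext (succ_fam (S b))); last first.
    by apply/regular_succ/IH; case: h => _ /ole_OSE.
  by move=> E; rewrite (schreier_ext HS h) (schreier_succ HS).
- have [z [_ zlt _ _ zE]] := schreier_lim HS h; split.
  + move=> E F mu /zE[k [km SE]] sF h1 h2; apply/zE; exists k; split.
      by apply/le_minP => i /h1[h3]; apply: leq_trans; move/le_minP: km; apply.
    exact: (reg_spread (IH _ (zlt k)) SE) h1 h2.
  + by move=> E /zE[k [_ /(reg_sorted (IH _ (zlt k)))]].
  + by move=> E i /zE[k [_ /(reg_gt0 (IH _ (zlt k)))]]; apply.
  + move=> n n0; apply/zE; exists 0%N; split; first by rewrite /le_min /= n0.
    exact: reg_single (IH _ (zlt 0%N)) _ n0.
Qed.

Lemma schreier_le a b : ole a b ->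
  exists N, forall E, S a E -> le_min N E -> S b E.
Proof.
elim: (olt_wf b) a => {}b _ IH a ab.
have [h|h] := ole_total b a.
  by exists 0%N => E SE _; apply/(schreier_ext HS _ E).1: SE.
case: (ord_cases b) => [[b0 _]|[c hc]|hl].
- by case: (olt_OZ (olt_le_trans h b0)).
- have cb : olt c b by case: hc => _ /ole_OSE.
  have ac : ole a c by apply/olt_OSE; apply: olt_le_trans h hc.1.
  have [N hN] := IH c cb a ac.
  exists N => E SE hE; apply/(schreier_ext HS hc)/(schreier_succ HS).
  exact: succ_fam_sub (schreier_regular c) (hN E SE hE).
- have [z [_ zlt zcof _ zE]] := schreier_lim HS hl.
  have [k ak] := zcof a h.
  have [N hN] := IH _ (zlt k) a ak.
  exists (maxn k.+1 N) => E SE hE; apply/zE; exists k; split.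
    by apply: le_min_trans hE; exact: leq_maxl.
  by apply: hN => //; apply: le_min_trans hE; exact: leq_maxr.
Qed.

(** The classical inclusion of S_b[S_a] in S_(a+b). It is made valid for arbitrary sequences at
    limits by asking that the piece attached to [k] start after [phi k]; [phi] has to be known
    before [E] is chosen. *)
Lemma schreier_flatten a b : exists phi : nat -> nat, forall E (A : nat -> seq nat),
  S b E -> (forall k, k \in E -> S a (A k) /\ le_min (phi k) (A k)) ->
  pairwise setlt (map A E) -> S (oadd a b) (flatten (map A E)).
Proof.
elim: (olt_wf b) => {}b _ IH; case: (ord_cases b) => [h|[c h]|h].
- have [h1 h2] : oeq (oadd a b) a.
    by case: h => h1 h2; split; [apply: (oadd_le_r a h1)|exact: oadd_ge].
  exists id => E A /(schreier_ext HS h)/(schreier_zero HS).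
  case=> [->|[n [_ ->]]] hA _ /=; first exact: (reg_nil (schreier_regular _)).
  rewrite cats0; apply/(schreier_ext HS (conj h1 h2)).
  by have [] := hA n (mem_head _ _).
- have cb : olt c b by case: h => _ /ole_OSE.
  have hs : oeq (oadd a b) (OS (oadd a c)).
    by case: h => h1 h2; split; [apply: (oadd_le_r a h1)|apply: (oadd_le_r a h2)].
  have [phi hphi] := IH c cb.
  (* The term [k] keeps each piece to the right of its index, so that the bound on the number of
     groups survives flattening. *)
  exists (fun k => maxn k (phi k)) => E A /(schreier_ext HS h)/(schreier_succ HS).
  case=> Es [-> _ hK hp hm] hA hpA.
  apply/(schreier_ext HS hs)/(schreier_succ HS).
  have eqf : flatten (map A (flatten Es)) = flatten [seq flatten (map A B) | B <- Es].
    by elim: Es {hK hp hm hA hpA} => //= B Es IHE; rewrite map_cat flatten_cat IHE.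
  have mA k i : k \in flatten Es -> i \in A k -> (k <= i)%N.
    move=> /hA[_ /le_minP h1] /h1; apply: leq_trans; exact: leq_maxl.
  apply: (@succ_fam_succ _ _ [seq flatten (map A B) | B <- Es]) => //.
  + exact: schreier_regular.
  + move=> _ /mapP[B BE ->]; apply: hphi; first exact: hK.
      move=> k kB; have kE : k \in flatten Es by apply/flattenP; exists B.
      have [h1 h2] := hA k kE; split=> //; apply: le_min_trans h2; exact: leq_maxr.
    apply: subseq_pairwise hpA; apply: map_subseq.
    elim: Es BE {hK hp hm hA mA eqf} => //= C Es IHE; rewrite inE => /orP[/eqP ->|/IHE].
      exact: prefix_subseq.
    by move=> /subseq_trans; apply; exact: suffix_subseq.
  + rewrite pairwise_map; move: hpA; rewrite map_flatten.
    elim: Es {hK hp hm hA mA eqf} => //= B Es IHE.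
    rewrite pairwise_cat => /and3P[/allrelP h1 _ h2]; rewrite IHE // andbT.
    apply/seq.allP => C CE; apply/setltP => i j.
    move=> /flattenP[_ /mapP[k kB ->] ik] /flattenP[_ /mapP[l lC ->] jl].
    have hl : A l \in flatten [seq [seq A y | y <- D] | D <- Es].
      by apply/flattenP; exists (map A C); [exact: (map_f (map A)) | exact: map_f].
    by have /setltP := h1 _ _ (map_f A kB) hl; apply.
  + rewrite size_map -eqf; apply/le_minP => i /flattenP[_ /mapP[k kE ->] ik].
    by apply: leq_trans (mA _ _ kE ik); move/le_minP: hm; apply.
- have [z [_ zlt zcof _ zE]] := schreier_lim HS h.
  have [phi hphi] : {phi : nat -> nat -> nat & forall n E (A : nat -> seq nat),
      S (z n) E -> (forall k, k \in E -> S a (A k) /\ le_min (phi n k) (A k)) ->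
      pairwise setlt (map A E) -> S (oadd a (z n)) (flatten (map A E))}.
    exact: (choice (fun n => IH _ (zlt n))).
  have [N hN] : {N : nat -> nat & forall n E, S (oadd a (z n)) E ->
      le_min (N n) E -> S (oadd a b) E}.
    apply: (choice (P := fun n N => forall E, S (oadd a (z n)) E ->
      le_min N E -> S (oadd a b) E)) => n.
    exact/schreier_le/oadd_le_r/olt_ole.
  (* The level [n] of [E] is known only to lie below every [k] in [E], so the requirements of all
     [n < k] are imposed at once. *)
  exists (fun k => \max_(n < k) maxn (phi n k) (N n)) => E A /zE[n [nE SE]] hA hpA.
  have nk k : k \in E -> (maxn (phi n k) (N n) <= \max_(n < k) maxn (phi n k) (N n))%N.
    move=> kE; have nk : (n < k)%N by move/le_minP: nE; apply.
    exact: (leq_bigmax (Ordinal nk)).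
  apply: (hN n); first apply: (hphi n) => //.
    move=> k kE; have [h1 h2] := hA k kE; split=> //; apply: le_min_trans h2.
    by apply: leq_trans (nk _ kE); exact: leq_maxl.
  apply/le_minP => i /flattenP[_ /mapP[k kE ->]].
  have [_ /le_minP h2] := hA k kE => /h2; apply: leq_trans.
  by apply: leq_trans (nk _ kE); exact: leq_maxr.
Qed.

End SchreierSystem.

(** * Special convex combinations *)

Definition unbounded (M : nat -> Prop) := forall N, exists2 m, (N <= m)%N & M m.

Definition special (R : realType) (K : fam) (E : seq nat) (a : nat -> R) (eps : R) :=
  [/\ forall i, 0 <= a i, forall i, i \notin E -> a i = 0,
      \sum_(i <- E) a i = 1 & forall F, K F -> \sum_(i <- F) a i <= eps].

Section SpecialConvex.
Variable R : realType.
Implicit Types (a : nat -> R) (E F : seq nat).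

Lemma ler_sum_sub a E F : (forall i, 0 <= a i) -> uniq F ->
  (forall i, i \in F -> a i != 0 -> i \in E) -> \sum_(i <- F) a i <= \sum_(i <- E) a i.
Proof.
move=> a0; elim: F E => [|i F IH] E /=.
  by move=> _ _; rewrite big_nil sumr_ge0.
move=> /andP[iF uF] h; rewrite big_cons.
have [ai0|ai0] := eqVneq (a i) 0.
  by rewrite ai0 add0r; apply: IH => // j jF; apply: h; rewrite inE jF orbT.
have iE : i \in E by apply: h; rewrite ?mem_head.
rewrite (perm_big _ (perm_to_rem iE)) big_cons lerD2l; apply: IH => // j jF aj0.
have jE : j \in E by apply: h => //; rewrite inE jF orbT.
have ji : j != i by apply: contraNneq iF => <-.
have : j \in i :: rem i E by rewrite -(perm_mem (perm_to_rem iE)).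
by rewrite inE (negPf ji).
Qed.

Lemma sum_supp0 a E F : (forall i, i \notin E -> a i = 0) ->
  (forall i, i \in F -> i \notin E) -> \sum_(i <- F) a i = 0.
Proof. by move=> h1 h2; rewrite big_seq big1 // => i /h2/h1. Qed.

(** Averages [k] successive combinations, each with mass at most eps/2 on the sets of [K] that
    contain a point at or before the end of its predecessors. Thus a set of [K] can have large mass
    only on the first combination that it meets, and the total is at most 1/k + eps/2. *)
Lemma special_step (K L : fam) (M : nat -> Prop) :
  regular K -> regular L ->
  (forall m (d : R) N, 0 < d -> exists E a,
      [/\ E != [::], forall i, i \in E -> M i, le_min N E, L E &
       special (fun F => K F /\ exists2 i, i \in F & (i <= m)%N) E a d]) ->
  forall (eps : R) N, 0 < eps -> exists E a,
      [/\ E != [::], forall i, i \in E -> M i, le_min N E, succ_fam L E &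
       special K E a eps].
Proof.
move=> Kreg Lreg step eps N eps0.
have [k kN keps] : exists2 k, (0 < k)%N & k%:R^-1 <= eps / 2 :> R.
  exists (Num.truncn (2 / eps)).+1 => //.
  rewrite -[leRHS]invrK lef_pV2 ?posrE ?invr_gt0 ?divr_gt0 ?ltr0n //.
  by rewrite invf_div; apply/ltW; exact: truncnS_gt.
suff H j : exists Es a, [/\ size Es = j, 
    forall E, E \in Es -> [/\ E != [::], L E, le_min (maxn N k) E & forall i, i \in E -> M i],
    pairwise setlt Es &
    [/\ forall i, 0 <= a i, forall i, i \notin flatten Es -> a i = 0,
      \sum_(i <- flatten Es) a i = j%:R &
      forall F, K F -> \sum_(i <- F) a i <= 1 + j%:R * (eps / 2)]].
  have [Es [a [sEs hEs hp [a0 aE as1 aF]]]] := H k.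
  have fE i : i \in flatten Es -> M i /\ (maxn N k <= i)%N.
    move=> /flattenP[E EE iE]; have [_ _ /le_minP hN hM] := hEs _ EE.
    by split; [exact: hM | exact: hN].
  exists (flatten Es), (fun i => k%:R^-1 * a i); split.
  - case: Es sEs hEs {hp aE as1 aF fE} => [|E Es]; first by move=> k0; rewrite -k0 in kN.
    by move=> _ /(_ E (mem_head _ _))[]; case: E.
  - by move=> i /fE[].
  - by apply/le_minP => i /fE[_]; apply: leq_trans; exact: leq_maxl.
  - apply: (succ_fam_succ (Es := Es)) => //; first by move=> A /hEs[].
    by apply/le_minP => i /fE[_]; apply: leq_trans; rewrite sEs; exact: leq_maxr.
  - split.
    + by move=> i; rewrite mulr_ge0 ?invr_ge0.
    + by move=> i /aE ->; rewrite mulr0.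
    + by rewrite -mulr_sumr as1 mulVf // pnatr_eq0 -lt0n.
    + move=> F /aF h; rewrite -mulr_sumr.
      apply: (@le_trans _ _ (k%:R^-1 * (1 + k%:R * (eps / 2)))).
        by rewrite ler_wpM2l ?invr_ge0.
      rewrite mulrDr mulr1 mulKf ?pnatr_eq0 -?lt0n //.
      by move: keps; lra.
elim: j => [|j [Es [a [sEs hEs hp [a0 aE as1 aF]]]]].
  exists [::], (fun _ => 0); split=> //; split=> // [|F _].
    by rewrite big_nil.
  by rewrite big1 // mul0r addr0.
pose m := \max_(i <- flatten Es) i.
have mE i : i \in flatten Es -> (i <= m)%N by move=> iE; exact: (leq_bigmax_seq i).
have [E [b [E0 EM EN LE [b0 bE bs1 bF]]]] :=
  step m (eps / 2) (maxn m.+1 (maxn N k)) (divr_gt0 eps0 (ltr0Sn _ _)).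
have Em i : i \in E -> (m < i)%N.
  by move/le_minP: EN => h /h; apply: leq_trans; exact: leq_maxl.
have EsE i : i \in flatten Es -> i \notin E.
  by move=> /mE im; apply/negP => /Em; rewrite ltnNge im.
exists (rcons Es E), (fun i => a i + b i); split.
- by rewrite size_rcons sEs.
- move=> A; rewrite mem_rcons inE => /orP[/eqP ->|/hEs//]; split=> //.
  by apply: le_min_trans EN; exact: leq_maxr.
- rewrite -cats1 pairwise_cat hp /= !andbT; apply/allrelP => A B AE.
  rewrite inE => /eqP ->; apply/setltP => i l iA /Em; apply: leq_ltn_trans.
  by apply: mE; apply/flattenP; exists A.
- rewrite flatten_rcons; split.
  + by move=> i; rewrite addr_ge0.
  + by move=> i; rewrite mem_cat negb_or => /andP[/aE -> /bE ->]; rewrite addr0.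
  + rewrite big_split /= !big_cat /= as1 bs1.
    rewrite (sum_supp0 bE) // (sum_supp0 aE) ?addr0 ?add0r -?natr1 //.
    by move=> i iE; apply/negP => /EsE; rewrite iE.
  + move=> F KF; rewrite big_split /= -natr1 mulrDl mul1r addrA.
    have [/hasP[i iF iE]|/hasPn hF] := boolP (has (mem (flatten Es)) F).
      rewrite lerD ?aF //; apply: bF; split=> //.
      by exists i => //; exact: mE.
    rewrite (sum_supp0 aE) // add0r.
    have : \sum_(i <- F) b i <= \sum_(i <- E) b i.
      apply: ler_sum_sub => //; first exact: sorted_uniq ltn_trans ltnn _ (reg_sorted Kreg KF).
      by move=> i _; apply: contraR => /bE ->.
    by rewrite bs1; have : 0 <= j%:R * (eps / 2) :> R; [rewrite mulr_ge0 ?divr_ge0 // ltW|lra].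
Qed.

Variable S : Ord -> fam.
Hypothesis HS : schreier_system S.

Lemma schreier_special zeta (M : nat -> Prop) (eps : R) N :
  unbounded M -> 0 < eps -> exists E a,
    [/\ E != [::], forall i, i \in E -> M i, le_min N E, S (OS zeta) E &
        special (S zeta) E a eps].
Proof.
move=> Minf; elim: (olt_wf zeta) eps N => {}zeta _ IH eps N eps0.
have reg := schreier_regular HS.
(* Only sets of [S zeta] with an element at most [m] have to be small now, and these are simpler: at
   a successor they are unions of at most [m] sets of the preceding family, at a limit they belong
   to [S (z m)]. *)
suff H : forall m (d : R) N, 0 < d -> exists E a,
      [/\ E != [::], forall i, i \in E -> M i, le_min N E, S zeta E &
       special (fun F => S zeta F /\ exists2 i, i \in F & (i <= m)%N) E a d].
  have [E [a [h1 h2 h3 h4 h5]]] := special_step (reg zeta) (reg zeta) H N eps0.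
  by exists E, a; split=> //; apply/(schreier_succ HS).
move=> m d N' d0.
have [h|[c h]|h] := ord_cases zeta.
- have [n] := Minf (maxn m.+1 N'); rewrite geq_max => /andP[mn Nn] Mn.
  exists [:: n], (fun i => (i == n)%:R); split=> //.
  + by move=> i; rewrite inE => /eqP ->.
  + by rewrite /le_min /= Nn.
  + apply/(schreier_ext HS h)/(schreier_zero HS); right; exists n; split=> //.
    exact: leq_ltn_trans mn.
  + split.
    * by move=> i; exact: ler0n.
    * by move=> i; rewrite inE => /negPf ->.
    * by rewrite big_cons big_nil eqxx addr0.
    * move=> F [/(schreier_ext HS h)/(schreier_zero HS)].
      move=> [->|[l [_ ->]]] [i]; rewrite ?in_nil // inE => /eqP -> lm.
      rewrite big_cons big_nil addr0.
      by rewrite (_ : l == n = false) ?ltW //; apply/eqP => ln; move: mn; rewrite -ln ltnNge lm.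
- have cz : olt c zeta by case: h => _ /ole_OSE.
  have d0' : 0 < d / m.+1%:R by rewrite divr_gt0.
  have [E [a [h1 h2 h3 h4 [a0 aE as1 aF]]]] := IH c cz _ N' d0'.
  exists E, a; split=> //; first exact/(schreier_ext HS h).
  split=> // F [/(schreier_ext HS h)/(schreier_succ HS)[Es [-> _ hK _ /le_minP hm]] [i iF im]].
  have sm : (size Es <= m.+1)%N by apply: leq_trans (hm i iF) _; apply: leq_trans im _.
  rewrite big_flatten /=.
  apply: (@le_trans _ _ (\sum_(A <- Es) d / m.+1%:R)).
    by rewrite big_seq [leRHS]big_seq; apply: ler_sum => A /hK; exact: aF.
  rewrite big_const_seq count_predT iter_addr_0 -[leLHS]mulr_natr -mulrA ger_pMr //.
  by rewrite mulrC ler_pdivrMr ?ltr0n // mul1r ler_nat.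
- have [z [zinc zlt zcof zS zE]] := schreier_lim HS h.
  have zS' i j E : (i <= j)%N -> S (z i) E -> S (z j) E.
    by move=> /subnK <-; elim: (j - i)%N => // l IHl /IHl /zS.
  have [l hl] : exists N, forall E, S (OS (z m)) E -> le_min N E -> S zeta E.
    by apply: schreier_le => //; apply/ole_OSE.
  have [E [a [h1 h2 h3 h4 [a0 aE as1 aF]]]] := IH _ (zlt m) _ (maxn l N') d0.
  exists E, a; split=> //.
  + by apply: le_min_trans h3; exact: leq_maxr.
  + by apply: hl => //; apply: le_min_trans h3; exact: leq_maxl.
  + split=> // F [/zE[n [/le_minP nF SF]] [i iF im]]; apply: aF.
    by apply: zS' SF; apply: ltnW; apply: leq_trans (nF i iF) im.
Qed.

End SpecialConvex.

(* [H k] stands for [S_(z_k)] where the [z_k] increase to [omega^xi] and [G] for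
   [S_(omega^xi)]; of the ordinals only these closure properties are used. *)
Record family_scale (R : realType) (G : fam) (H : nat -> fam) : Prop := FamilyScale {
  scale_G : regular G;
  scale_H : forall k, regular (H k);
  scale_le : forall j k E, (j <= k)%N -> H j E -> H k E;
  scale_GE : forall E, G E <-> exists k, le_min k.+1 E /\ H k E;
  scale_flatten : forall a, exists phi : nat -> nat, (forall j, (j <= phi j)%N) /\
    forall k, exists b N, forall E (A : nat -> seq nat), H k E -> le_min N E ->
      (forall j, j \in E -> H a (A j) /\ le_min (phi j) (A j)) ->
      pairwise setlt (map A E) -> H b (flatten (map A E));
  scale_special : forall k, exists b, forall (M : nat -> Prop) (eps : R) N,
    unbounded M -> 0 < eps -> exists E a,
    [/\ E != [::], forall i, i \in E -> M i, le_min N E, H b E &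
        special (H k) E a eps];
  scale_schreier : exists b N, forall E, sorted ltn E -> le_min (maxn N (size E)) E -> H b E }.

Lemma schreier_scale (R : realType) (S : Ord -> fam) (xi : Ord) :
  schreier_system S -> ole oone xi -> exists H, family_scale R (S (oexpw xi)) H.
Proof.
move=> HS hxi; have hl := oexpw_limit hxi.
have reg := schreier_regular HS.
have [z [zinc zlt zcof zS zE]] := schreier_lim HS hl.
have zS' i j E : (i <= j)%N -> S (z i) E -> S (z j) E.
  by move=> /subnK <-; elim: (j - i)%N => // l IHl /IHl /zS.
have lift c : olt c (oexpw xi) -> exists b N, forall E, S c E -> le_min N E -> S (z b) E.
  by move=> /zcof[b /(schreier_le HS)[N hN]]; exists b, N.
exists (fun k => S (z k)); split=> //.
- move=> a; have [phi hphi] := choice (fun k => schreier_flatten HS (z a) (z k)).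
  (* One function dominating the [phi k] of every level [k] from index [k] on; this is why [E] has
     to start after [k]. *)
  pose psi j := maxn j (\max_(k < j.+1) phi k j).
  exists psi; split; first by move=> j; exact: leq_maxl.
  move=> k; have [b [N hN]] := lift _ (oexpw_indecomposable (zlt a) (zlt k)).
  exists b, (maxn k N) => E A SE /le_minP hE hA hp; apply: hN.
    apply: hphi => // j jE; have [h1 h2] := hA j jE; split=> //.
    apply: le_min_trans h2; apply: leq_trans (leq_maxr _ _).
    have kj : (k < j.+1)%N by apply: leq_trans (hE j jE); exact: leq_maxl.
    exact: (leq_bigmax (Ordinal kj)).
  apply/le_minP => i /flattenP[_ /mapP[j jE ->]].
  have [_ /le_minP h2] := hA j jE => /h2; apply: leq_trans.
  apply: leq_trans (leq_maxl _ _); apply: leq_trans (hE j jE); exact: leq_maxr.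
- move=> k; have [b [N hN]] := lift _ (oexpw_succ hxi (zlt k)).
  exists b => M eps N' Minf eps0.
  have [E [a [h1 h2 h3 h4 h5]]] := schreier_special HS (z k) (maxn N N') Minf eps0.
  exists E, a; split=> //; first by apply: le_min_trans h3; exact: leq_maxr.
  by apply: hN => //; apply: le_min_trans h3; exact: leq_maxl.
(* As 1 < omega^xi, S_1 lies on a tail in some level; a set no longer than its minimum is decomposed
   into singletons. *)
- have [b [N hN]] := lift _ (oexpw_gt1 hxi).
  exists b, N.+1 => E sE hE; have EN i : i \in E -> (N.+1 <= i)%N /\ (size E <= i)%N.
    move=> iE; split; move/le_minP: hE => /(_ i iE); apply: leq_trans;
    [exact: leq_maxl | exact: leq_maxr].
  apply: hN; last by apply/le_minP => i /EN[/ltnW].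
  apply/(schreier_succ HS); apply: (succ_fam_succ (Es := [seq [:: i] | i <- E]) (reg _)) => //.
  + by move=> _ /mapP[i /EN[i0 _] ->]; apply: (reg_single (reg _)); exact: leq_trans i0.
  + rewrite pairwise_map; move: sE; rewrite (sorted_pairwise ltn_trans).
    by apply: sub_pairwise => i j ij; rewrite /setlt /= ij.
  + rewrite size_map; apply/le_minP => i.
    by move=> /flattenP[_ /mapP[j jE ->]]; rewrite inE => /eqP ->; case: (EN j jE).
  + by elim: (E) => //= i E' <-.
Qed.

(** * The norming set *)

Section Pairing.
Variable R : realType.
Implicit Types (f g x y : vec R) (fs : seq (vec R)).

Definition pr N f x : R := \sum_(i < N) f i * x i.

Definition comb (v : nat -> vec R) (A : seq nat) (a : nat -> R) : vec R :=
  fun i => \sum_(k <- A) a k * v k i.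

Lemma pr_comb N f v A a : pr N f (comb v A a) = \sum_(k <- A) a k * pr N f (v k).
Proof.
rewrite /pr /comb; under eq_bigr => i _ do rewrite mulr_sumr.
rewrite exchange_big /=; apply: eq_bigr => k _; rewrite mulr_sumr.
by apply: eq_bigr => i _; rewrite mulrCA.
Qed.

Lemma pr_vsum N fs x : pr N (vsum fs) x = \sum_(f <- fs) pr N f x.
Proof.
rewrite /pr /vsum; under eq_bigr => i _ do rewrite mulr_suml.
exact: exchange_big.
Qed.

Lemma prZl N c f x : pr N (fun i => c * f i) x = c * pr N f x.
Proof. by rewrite /pr mulr_sumr; apply: eq_bigr => i _; rewrite mulrA. Qed.

Lemma prZr N c f x : pr N f (fun i => c * x i) = c * pr N f x.
Proof. by rewrite /pr mulr_sumr; apply: eq_bigr => i _; rewrite mulrCA. Qed.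

Lemma prNl N f x : pr N (fun i => - f i) x = - pr N f x.
Proof. by rewrite /pr -sumrN; apply: eq_bigr => i _; rewrite mulNr. Qed.

Lemma prDr N f x y : pr N f (x \+ y) = pr N f x + pr N f y.
Proof. by rewrite /pr -big_split; apply: eq_bigr => i _; rewrite mulrDr. Qed.

Lemma pr_widen N M f x : supp_below x N -> (N <= M)%N -> pr M f x = pr N f x.
Proof.
move=> xN NM; rewrite /pr -!(big_mkord xpredT (fun i => f i * x i)).
rewrite (big_cat_nat (leq0n N) NM) /= [X in _ + X]big1_seq ?addr0 // => i.
by rewrite mem_index_iota => /andP[_ /andP[Ni _]]; rewrite xN // mulr0.
Qed.

Definition hit f x := `[< exists i, f i != 0 /\ x i != 0 >].

Lemma pr_nohit N f x : ~~ hit f x -> pr N f x = 0.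
Proof.
move=> /asboolPn h; apply: big1 => i _; apply/eqP; rewrite mulf_eq0 -[_ || _]negbK.
by rewrite negb_or; apply/negP => /andP[h1 h2]; apply: h; exists i.
Qed.

Lemma supp_below_widen x N M : supp_below x N -> (N <= M)%N -> supp_below x M.
Proof. by move=> h NM i Mi; apply: h; exact: leq_trans Mi. Qed.

Lemma supp_below_comb v A a N : (forall k, k \in A -> supp_below (v k) N) ->
  supp_below (comb v A a) N.
Proof. by move=> h i Ni; rewrite /comb big_seq big1 // => k /h/(_ i Ni) ->; rewrite mulr0. Qed.

(** The formula of [Wnorm] with the norming set as a parameter: it serves both the given norm and
    the renormings that distort it. *)
Definition norm_of (K : vec R -> Prop) x : R :=
  sup [set r : R | exists (f : vec R) (N : nat),
         [/\ K f, supp_below x N & r = \sum_(i < N) f i * x i]].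

Section Norm.
Variable K : vec R -> Prop.
Hypothesis Kne : exists f, K f.
Variable C : R.
Hypothesis Kbd : forall f i, K f -> `|f i| <= C.
Hypothesis KN : forall f, K f -> K (fun i => - f i).

Lemma norm_ub1 N f x : supp_below x N -> K f -> pr N f x <= norm_of K x.
Proof.
move=> xN Kf; apply: ub_le_sup; last by exists f, N.
exists (\sum_(i < N) C * `|x i|) => _ [g [M [Kg xM ->]]].
have -> : \sum_(i < M) g i * x i = \sum_(i < N) g i * x i.
  rewrite -!/(pr _ _ _); case: (leqP N M) => [NM|/ltnW MN].
    exact: pr_widen.
  by rewrite (pr_widen _ xM MN).
apply: ler_sum => i _; apply: le_trans (ler_norm _) _.
by rewrite normrM ler_wpM2r // Kbd.
Qed.

Lemma norm_ub N f x : supp_below x N -> K f -> `|pr N f x| <= norm_of K x.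
Proof.
move=> xN Kf; rewrite ler_norml norm_ub1 // andbT lerNl -prNl.
by apply: norm_ub1 => //; exact: KN.
Qed.

Lemma norm_le N x B : supp_below x N -> (forall f, K f -> pr N f x <= B) ->
  norm_of K x <= B.
Proof.
move=> xN h; apply: ge_sup; first by case: Kne => f Kf; exists (pr N f x), f, N.
move=> _ [g [M [Kg xM ->]]]; rewrite -/(pr _ _ _).
case: (leqP N M) => [NM|/ltnW MN].
  by rewrite (pr_widen _ xN NM); exact: h.
by rewrite -(pr_widen _ xM MN); exact: h.
Qed.

Lemma norm_ge0 N x : supp_below x N -> 0 <= norm_of K x.
Proof. by move=> xN; case: Kne => f Kf; apply: le_trans (norm_ub xN Kf). Qed.

Lemma norm_near N x r : supp_below x N -> r < norm_of K x ->
  exists f, K f /\ r < pr N f x.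
Proof.
move=> xN; apply: contraPP => /forallNP h; apply/negP; rewrite -leNgt.
by apply: (norm_le xN) => f Kf; rewrite leNgt; apply/negP => lt; apply: (h f).
Qed.

Lemma normD N x y : supp_below x N -> supp_below y N ->
  norm_of K (x \+ y) <= norm_of K x + norm_of K y.
Proof.
move=> xN yN; apply: (@norm_le N) => [i Ni|f Kf]; first by rewrite /= xN // yN // addr0.
by rewrite prDr lerD ?norm_ub1.
Qed.

Lemma normZ N c x : supp_below x N -> norm_of K (fun i => c * x i) = `|c| * norm_of K x.
Proof.
have H d y : supp_below y N -> norm_of K (fun i => d * y i) <= `|d| * norm_of K y.
  move=> yN; apply: (@norm_le N) => [i Ni|f Kf]; first by rewrite yN // mulr0.
  by rewrite prZr; apply: le_trans (ler_norm _) _; rewrite normrM ler_wpM2l // norm_ub.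
move=> xN; apply/le_anti; rewrite H //=.
have [->|c0] := eqVneq c 0.
  rewrite normr0 mul0r; apply: (@norm_ge0 N) => i Ni; exact: mul0r.
have {1}-> : x = fun i => c^-1 * (c * x i).
  by apply/funext => i; rewrite mulKf.
have := H c^-1 (fun i => c * x i); rewrite normfV => h.
rewrite mulrC -ler_pdivlMr ?normr_gt0 // mulrC; apply: h => i Ni.
by rewrite xN // mulr0.
Qed.

Lemma norm_comb N v A a : (forall k, k \in A -> supp_below (v k) N) ->
  norm_of K (comb v A a) <= \sum_(k <- A) `|a k| * norm_of K (v k).
Proof.
move=> h; apply: (norm_le (supp_below_comb a h)) => f Kf; rewrite pr_comb.
rewrite big_seq [leRHS]big_seq; apply: ler_sum => k kA; apply: le_trans (ler_norm _) _.
by rewrite normrM ler_wpM2l // norm_ub //; exact: h.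
Qed.

End Norm.
End Pairing.

Section NormingSet.
Variable R : realType.
Implicit Types (f g x y a : vec R) (fs : seq (nat -> R)).

Definition blkb (f g : vec R) := `[< blk f g >].

Lemma blkbP (f g : nat -> R) : reflect (blk f g) (blkb f g).
Proof. exact: asboolP. Qed.

Lemma mem_nthP (G : vec R -> Prop) fs :
  (forall f, f \in fs -> G f) <-> (forall q, (q < size fs)%N -> G (nth (vzero R) fs q)).
Proof.
split=> h q; first by move=> /(mem_nth (vzero R))/h.
by move=> /(nthP (vzero R))[i /h hi <-].
Qed.

Lemma pairwise_blkP fs : pairwise blkb fs <->
  (forall p q, (p < q)%N -> (q < size fs)%N -> blk (nth (vzero R) fs p) (nth (vzero R) fs q)).
Proof.
split=> [/(pairwiseP (vzero R)) h p q pq qs|h].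
  by apply/blkbP/h => //; rewrite inE //; exact: ltn_trans qs.
by apply/(pairwiseP (vzero R)) => p q _; rewrite inE => qs pq; exact/blkbP/h.
Qed.

Lemma is_avgP (G : vec R -> Prop) l a : is_avg G l a <->
  exists fs, [/\ (2 <= l)%N, (0 < size fs <= l)%N, forall f, f \in fs -> G f,
    pairwise blkb fs & a = fun i => l%:R^-1 * vsum fs i].
Proof.
split=> [[fs [[h1 [h2 h3]] /mem_nthP h4 /pairwise_blkP h5 ->]]|].
  by exists fs; split=> //; rewrite h2.
move=> [fs [h1 /andP[h2 h3] /mem_nthP h4 /pairwise_blkP h5 ->]].
by exists fs.
Qed.

Lemma is_avg_sub (G G' : vec R -> Prop) l a : (forall f, G f -> G' f) ->
  is_avg G l a -> is_avg G' l a.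
Proof.
move=> h /is_avgP[fs [h1 h2 h3 h4 h5]]; apply/is_avgP; exists fs; split=> //.
by move=> f /h3/h.
Qed.

(* The triple of an average, its size, and the minimum of its support. *)
Definition item := ((nat -> R) * nat * nat)%type.
Definition ivec (t : item) : nat -> R := t.1.1.
Definition isize (t : item) := t.1.2.
Definition imin (t : item) := t.2.
Implicit Types (t : item) (T : seq item).

Definition good (G : vec R -> Prop) t :=
  is_avg G (isize t) (ivec t) /\ is_min_supp (ivec t) (imin t).

(** Very fast growth demanded for all pairs, whereas [WS] states it for neighbours: a pairwise
    condition passes to sublists at once. *)
Definition before t t' := `[< [/\ blk (ivec t) (ivec t'), (isize t < isize t')%N &
  forall i, ivec t i != 0 -> (i < isize t')%N] >].

Lemma beforeP t t' : reflect [/\ blk (ivec t) (ivec t'), (isize t < isize t')%N &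
  forall i, ivec t i != 0 -> (i < isize t')%N] (before t t').
Proof. exact: asboolP. Qed.

Definition isum T : vec R := vsum (map ivec T).

Lemma before_imin T (G : vec R -> Prop) : (forall t, t \in T -> good G t) ->
  pairwise before T -> pairwise (relpre imin ltn) T.
Proof.
move=> h; elim: T h => [|t T IH] //= h /andP[h1 /IH ->]; last first.
  by move=> s sT; apply: h; rewrite inE sT orbT.
rewrite andbT; apply/seq.allP => s sT; have /beforeP[h2 _ _] := seq.allP h1 s sT.
have [_ [ht _]] := h t (mem_head _ _).
have [_ [hs _]] : good G s by apply: h; rewrite inE sT orbT.
exact: h2.
Qed.

Section Levels.
Variable F : fam.

Lemma Wm_le m m' f : (m <= m')%N -> Wm F m f -> Wm F m' f.
Proof. by move=> /subnK <-; elim: (m' - m)%N => //= k IH /IH; right; right. Qed.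

Lemma Wm_seq fs : (forall f, f \in fs -> inW F f) ->
  exists m, forall f, f \in fs -> Wm F m f.
Proof.
elim: fs => [|g fs IH] h; first by exists 0%N.
have [m hm] : exists m, forall f, f \in fs -> Wm F m f.
  by apply: IH => f ff; apply: h; rewrite inE ff orbT.
have [k hk] := h g (mem_head _ _).
exists (maxn k m) => f; rewrite inE => /orP[/eqP ->|/hm].
  by apply: Wm_le hk; exact: leq_maxl.
by apply: Wm_le; exact: leq_maxr.
Qed.

Lemma avg_inW l a : is_avg (inW F) l a -> inW F a.
Proof.
move=> /is_avgP[fs [h1 h2 /Wm_seq[m h3] h4 h5]]; exists m.+1; left; exists l.
by apply/is_avgP; exists fs.
Qed.

(** [WS] asks that an average belong to the same level as its members; one level higher both
    requirements hold. *)
Lemma avg_level l a : is_avg (inW F) l a -> exists m, Wm F m a /\ is_avg (Wm F m) l a.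
Proof.
move=> /is_avgP[fs [h1 h2 /Wm_seq[m h3] h4 h5]].
have h : is_avg (Wm F m) l a by apply/is_avgP; exists fs.
exists m.+1; split; first by left; exists l.
by apply: is_avg_sub h => f; exact: Wm_le.
Qed.

Lemma isum_inW T : T != [::] -> (forall t, t \in T -> good (inW F) t) ->
  pairwise before T -> F (map imin T) -> inW F (isum T).
Proof.
move=> T0 hT hp hF.
have [m hm] : exists m, forall t, t \in T -> Wm F m (ivec t) /\ is_avg (Wm F m) (isize t) (ivec t).
  elim: T hT {T0 hp hF} => [|t T IH] h; first by exists 0%N.
  have [m hm] : exists m, forall t, t \in T -> Wm F m (ivec t) /\ is_avg (Wm F m) (isize t) (ivec t).
    by apply: IH => s sT; apply: h; rewrite inE sT orbT.
  have [k [k1 k2]] := avg_level (h t (mem_head _ _)).1.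
  exists (maxn k m) => s; rewrite inE => /orP[/eqP ->|/hm[m1 m2]]; split.
  - by apply: Wm_le k1; exact: leq_maxl.
  - by apply: is_avg_sub k2 => f; apply: Wm_le; exact: leq_maxl.
  - by apply: Wm_le m1; exact: leq_maxr.
  - by apply: is_avg_sub m2 => f; apply: Wm_le; exact: leq_maxr.
have T1 : (0 < size T)%N by rewrite lt0n size_eq0.
pose t0 : item := (vzero R, 0%N, 0%N).
have nv q : (q < size T)%N -> nth (vzero R) (map ivec T) q = ivec (nth t0 T q).
  by move=> qT; rewrite (nth_map t0).
have ns q : (q < size T)%N -> nth 0%N (map isize T) q = isize (nth t0 T q).
  by move=> qT; rewrite (nth_map t0).
have nm q : (q < size T)%N -> nth 0%N (map imin T) q = imin (nth t0 T q).
  by move=> qT; rewrite (nth_map t0).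
have hb p q : (p < q)%N -> (q < size T)%N -> before (nth t0 T p) (nth t0 T q).
  move=> pq qT; move/(pairwiseP t0): hp; apply; rewrite ?inE //.
  exact: ltn_trans qT.
exists m.+1; right; left; exists (map ivec T), (map isize T), (map imin T).
split; rewrite ?size_map //.
- by move=> q qT; rewrite nv // ns //; apply: hm; exact: mem_nth.
- by move=> p q pq qT; rewrite !nv ?(ltn_trans pq) //; have /beforeP[] := hb _ _ pq qT.
- split; [|split=> //].
    by move=> q qT; rewrite nv // nm //; case: (hT _ (mem_nth t0 qT)).
  move=> q qT; rewrite !ns ?nv ?(ltnW qT) //.
  have /beforeP[_ h1 h2] := hb _ _ (ltnSn q) qT; split=> // M [hM _].
  exact: h2.
Qed.

Lemma vsum_supp_below fs N : (forall f, f \in fs -> supp_below f N) ->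
  supp_below (vsum fs) N.
Proof. by move=> h i Ni; rewrite /vsum big_seq big1 // => f /h/(_ i Ni). Qed.

Lemma seq_supp_below fs : (forall f, f \in fs -> exists N, supp_below f N) ->
  exists N, forall f, f \in fs -> supp_below f N.
Proof.
elim: fs => [|g fs IH] h; first by exists 0%N.
have [m hm] : exists N, forall f, f \in fs -> supp_below f N.
  by apply: IH => f ff; apply: h; rewrite inE ff orbT.
have [k hk] := h g (mem_head _ _).
exists (maxn k m) => f; rewrite inE => /orP[/eqP ->|/hm].
  by apply: supp_below_widen hk _; exact: leq_maxl.
by move=> h'; apply: supp_below_widen h' _; exact: leq_maxr.
Qed.

Lemma Wm_fsupp m f : Wm F m f -> exists N, supp_below f N.
Proof.
elim: m f => [|m IH] f /=.
  move=> [n [n0 [->|->]]]; exists n.+1 => i ni; by rewrite /e (gtn_eqF ni) /= ?oppr0.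
move=> [[l /is_avgP[fs [_ _ h _ ->]]]|[|]]; last exact: IH.
  have [N hN] := seq_supp_below (fun f ff => IH f (h f ff)).
  by exists N => i Ni; rewrite (vsum_supp_below hN) // mulr0.
move=> [als [ls [ms [_ h _ _ ->]]]].
have h' : forall f, f \in als -> Wm F m f by apply/mem_nthP => q /h[].
have [N hN] := seq_supp_below (fun f ff => IH f (h' f ff)).
by exists N; exact: vsum_supp_below.
Qed.

Lemma WS_isum m f : WS F (Wm F m) f -> exists T,
  [/\ T != [::], forall t, t \in T -> good (Wm F m) t, pairwise before T,
      F (map imin T) & f = isum T].
Proof.
move=> [als [ls [ms [[s0 [sl sm]] hG hb [hm [hF hv]] ->]]]].
pose mk q : item := (nth (vzero R) als q, nth 0%N ls q, nth 0%N ms q).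
have ea : map ivec (mkseq mk (size als)) = als.
  by rewrite -[RHS](mkseq_nth (vzero R)) /mkseq -map_comp.
have em : map imin (mkseq mk (size als)) = ms.
  by rewrite -[RHS](mkseq_nth 0%N) sm /mkseq -map_comp.
exists (mkseq mk (size als)); split.
- by rewrite -size_eq0 size_mkseq -lt0n.
- move=> t /mapP[q]; rewrite mem_iota add0n => /andP[_ qs] ->.
  by split; [case: (hG q qs) | exact: hm].
- have lsmono p q : (p < q)%N -> (q < size als)%N -> (nth 0%N ls p < nth 0%N ls q)%N.
    elim: q => // q IH; rewrite ltnS leq_eqVlt => /orP[/eqP ->|pq] qs.
      by case: (hv q qs).
    by apply: ltn_trans (IH pq (ltnW qs)) _; case: (hv q qs).
  rewrite pairwise_map; apply/(pairwiseP 0%N) => p q; rewrite !inE size_iota => ps qs pq.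
  rewrite !nth_iota // !add0n; split; [exact: hb|exact: lsmono|].
  case: q pq qs => // q; rewrite ltnS => pq qs i /= ip.
  (* The growth condition in [WS] speaks of every maximum of the support and would be void without
     one. Finiteness of supports provides it. *)
  have [M [hM1 hM2]] : exists M, is_max_supp (nth (vzero R) als q) M.
    have qs' : (q < size als)%N by exact: ltnW.
    have [N hN] := Wm_fsupp (hG q qs').1.
    have [hm1 _] := hm q qs'.
    have ex : exists i, nth (vzero R) als q i != 0 by eexists; exact: hm1.
    case: (ex_maxnP (m := N) ex) => [j|M hM1 hM2]; last by exists M.
    by apply: contraNT; rewrite -ltnNge => /ltnW/hN ->.
  have [_ h] := hv q qs; have := h M (conj hM1 hM2); apply: leq_ltn_trans.
  move: pq; rewrite leq_eqVlt => /orP[/eqP pq|pq]; first by apply: hM2; rewrite -pq.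
  by apply: ltnW; apply: (hb p q pq (ltnW qs)).
- by rewrite em.
- by rewrite /isum ea.
Qed.

(** Replaces induction on the level: the members of an average carry membership in W together with
    [P], so levels disappear from the later inductions. *)
Lemma inW_ind (P : vec R -> Prop) :
  (forall n, (0 < n)%N -> P (e R n) /\ P (fun i => - e R n i)) ->
  (forall l a, is_avg (fun f => inW F f /\ P f) l a -> P a) ->
  (forall T, T != [::] -> (forall t, t \in T -> good (fun f => inW F f /\ P f) t) ->
     pairwise before T -> F (map imin T) -> P (isum T)) ->
  forall f, inW F f -> P f.
Proof.
move=> h0 ha hs f [m]; elim: m f => [|m IH] f /=.
  by move=> [n [n0 [->|->]]]; case: (h0 n n0).
have IH' g : Wm F m g -> inW F g /\ P g by move=> h; split; [exists m|exact: IH].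
move=> [[l h]|[/WS_isum[T [T0 hT hp hF ->]]|/IH//]].
  by apply: ha; apply: is_avg_sub h.
apply: hs => // t /hT[h1 h2]; split=> //.
by apply: is_avg_sub h1.
Qed.

Lemma good_sub (G G' : vec R -> Prop) t : (forall f, G f -> G' f) -> good G t -> good G' t.
Proof. by move=> h [h1 h2]; split=> //; exact: is_avg_sub h1. Qed.

Definition nitem t : item := ((fun i => - ivec t i), isize t, imin t).

Lemma vsumN fs : (fun i => - vsum fs i) = vsum [seq (fun i => - f i) | f : nat -> R <- fs].
Proof. by apply/funext => i; rewrite /vsum big_map sumrN. Qed.

Lemma isumN T : isum (map nitem T) = fun i => - isum T i.
Proof. by rewrite /isum vsumN -!map_comp. Qed.

Lemma is_avgN (G G' : vec R -> Prop) l a : (forall f, G f -> G' (fun i => - f i)) ->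
  is_avg G l a -> is_avg G' l (fun i => - a i).
Proof.
move=> hG /is_avgP[fs [h1 h2 h3 h4 ->]]; apply/is_avgP.
exists [seq (fun i => - f i) | f : nat -> R <- fs]; split=> //.
- by rewrite size_map.
- by move=> _ /mapP[g /h3/hG hg ->].
- rewrite pairwise_map; apply: sub_pairwise h4 => g h /blkbP gh; apply/blkbP => i j.
  by rewrite !oppr_eq0; exact: gh.
- by apply/funext => i; rewrite -mulrN -vsumN.
Qed.

Lemma good_nitem (G G' : vec R -> Prop) t : (forall f, G f -> G' (fun i => - f i)) ->
  good G t -> good G' (nitem t).
Proof.
move=> hG [h1 [h2 h3]]; split; first exact: is_avgN h1.
by split; rewrite /= ?oppr_eq0 // => i; rewrite oppr_eq0; exact: h3.
Qed.

Lemma before_nitem t s : before (nitem t) (nitem s) = before t s.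
Proof.
have h (r : item) i : ivec (nitem r) i != 0 <-> ivec r i != 0.
  by rewrite /ivec /= oppr_eq0.
apply/beforeP/beforeP => -[h1 h2 h3]; split=> //.
- by move=> i j /h hi /h hj; exact: h1.
- by move=> i /h; exact: h3.
- by move=> i j /h hi /h hj; exact: h1.
- by move=> i /h; exact: h3.
Qed.

Lemma inWN f : inW F f -> inW F (fun i => - f i).
Proof.
move: f; apply: inW_ind.
- move=> n n0; split; exists 0%N; exists n; split=> //; first by right.
  by left; apply/funext => i; rewrite opprK.
- by move=> l a h; apply: (@avg_inW l); apply: is_avgN h => f [].
- move=> T T0 hT hp hF; rewrite -isumN; apply: isum_inW.
  + by case: (T) T0.
  + by move=> _ /mapP[t /hT ht ->]; apply: good_nitem ht => f [].
  + by rewrite pairwise_map; apply: sub_pairwise hp => t s; rewrite /= before_nitem.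
  + by rewrite -map_comp.
Qed.

Lemma sum_at_most_one (I : eqType) (r : seq I) (E : I -> R) (C : R) : uniq r -> 0 <= C ->
  (forall k, k \in r -> E k <= C) ->
  (forall k l, k \in r -> l \in r -> E k != 0 -> E l != 0 -> k = l) ->
  \sum_(k <- r) E k <= C.
Proof.
elim: r => [|k r IH] /=; first by rewrite big_nil.
move=> /andP[kr ur] C0 h1 h2; rewrite big_cons.
have [E0|E0] := eqVneq (E k) 0.
  rewrite E0 add0r; apply: IH => // [l lr|l l' lr lr'].
    by apply: h1; rewrite inE lr orbT.
  by apply: h2; rewrite inE ?lr ?lr' orbT.
rewrite big_seq big1 ?addr0 ?h1 ?mem_head // => l lr.
apply/eqP; apply: contraNT kr => El.
by rewrite (h2 k l (mem_head _ _) _ E0 El) // inE lr orbT.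
Qed.

Lemma blk_sum_le fs i (C : R) : 0 <= C -> pairwise blkb fs ->
  (forall f, f \in fs -> `|f i| <= C) -> `|vsum fs i| <= C.
Proof.
move=> C0 hp h; apply: le_trans (ler_norm_sum _ _ _) _.
rewrite (big_nth (vzero R)) -[X in index_iota 0 X]/(size fs).
apply: sum_at_most_one => //; first exact: iota_uniq.
  by move=> k; rewrite mem_index_iota => /andP[_ kf]; apply: h; exact: mem_nth.
move=> k l; rewrite !mem_index_iota => /andP[_ kf] /andP[_ lf].
rewrite !normr_eq0 => hk hl; move/pairwise_blkP: hp => hp.
case: (ltngtP k l) => // kl; [have := hp _ _ kl lf | have := hp _ _ kl kf];
  by move=> /(_ i i); rewrite ?hk ?hl => /(_ isT isT); rewrite ltnn.
Qed.

Lemma isum_blk T : pairwise before T -> pairwise blkb (map ivec T).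
Proof.
by rewrite pairwise_map; apply: sub_pairwise => t s /beforeP[h _ _]; exact/blkbP.
Qed.

Lemma inW_le1 f i : inW F f -> `|f i| <= 1.
Proof.
have ha l a : is_avg (fun f => inW F f /\ forall i, `|f i| <= 1) l a -> forall i, `|a i| <= 1.
  move=> /is_avgP[fs [l2 /andP[_ sl] h _ ->]] k.
  have l0 : (0 < l)%N by exact: ltnW.
  rewrite normrM normfV normr_nat ler_pdivrMl ?ltr0n // mulr1.
  apply: le_trans (ler_norm_sum _ _ _) _.
  apply: (@le_trans _ _ (\sum_(f <- fs) 1)).
    by rewrite big_seq [leRHS]big_seq; apply: ler_sum => g /h[].
  by rewrite big_const_seq count_predT iter_addr_0 ler_nat.
move=> h; move: f h i; apply: inW_ind.
- by move=> n _; split=> k; rewrite /e ?normrN; case: (k == n); rewrite ?normr0 ?normr1.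
- exact: ha.
- move=> T _ hT hp _ i; apply: blk_sum_le => //; first exact: isum_blk.
  by move=> _ /mapP[t /hT[/ha h _] ->].
Qed.

(** * Restriction of functionals to sets of coordinates *)

Definition restr (A : pred nat) (f : vec R) : nat -> R := fun i => if A i then f i else 0.

Lemma restr_neq0 A f i : restr A f i != 0 -> f i != 0.
Proof. by rewrite /restr; case: ifP => // _; rewrite eqxx. Qed.

Definition msupp (f : vec R) : nat :=
  if pselect (exists i, f i != 0) is left ex then ex_minn ex else 0%N.

Lemma msuppP f : (exists i, f i != 0) -> is_min_supp f (msupp f).
Proof.
by rewrite /msupp; case: pselect => // ex _; case: ex_minnP => m h1 h2; split.
Qed.

Lemma nonzeroP f : f != (fun _ => 0) -> exists i, f i != 0.
Proof.
move=> h; apply: contrapT => /forallNP h1; move/eqP: h; apply; apply/funext => i.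
by apply/eqP; rewrite -[_ == _]negbK; apply/negP/h1.
Qed.

(** Null restrictions are dropped because W contains no zero functional: empty averages and empty
    sums are excluded. The size of an average is kept when members disappear. *)
Definition restr_seq A fs := [seq g <- map (restr A) fs | g != (fun _ => 0)].

Lemma restr_vsum A fs : restr A (vsum fs) = vsum (restr_seq A fs).
Proof.
apply/funext => i; rewrite /vsum /restr_seq big_filter big_mkcond big_map /= /restr.
case: ifP => Ai; last first.
  by rewrite big1 // => f _; case: ifP.
apply: eq_bigr => f _; case: ifPn => // /negbNE/eqP/(congr1 (fun g => g i)) /=.
by rewrite Ai.
Qed.

Lemma restr_blk A fs : pairwise blkb fs -> pairwise blkb (restr_seq A fs).
Proof.
move=> h; apply: (subseq_pairwise (filter_subseq _ _)); rewrite pairwise_map.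
apply: sub_pairwise h => f g /blkbP fg; apply/blkbP.
by move=> i j /restr_neq0 hi /restr_neq0; exact: fg.
Qed.

Definition restr_item A t : item := (restr A (ivec t), isize t, msupp (restr A (ivec t))).
Definition restr_items A T :=
  [seq restr_item A t | t <- T & restr A (ivec t) != (fun _ => 0)].

Lemma restr_isum A T : restr A (isum T) = isum (restr_items A T).
Proof.
rewrite /isum restr_vsum; congr vsum.
by rewrite /restr_seq -map_comp filter_map /restr_items -map_comp.
Qed.

Lemma restr_before A T : pairwise before T -> pairwise before (restr_items A T).
Proof.
move=> h; rewrite pairwise_map; apply: (subseq_pairwise (filter_subseq _ _)).
apply: sub_pairwise h => t s /beforeP[h1 h2 h3]; apply/beforeP; split=> //.
  by move=> i j /restr_neq0 hi /restr_neq0; exact: h1.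
by move=> i /restr_neq0; exact: h3.
Qed.

Lemma restr_avg G A l a : is_avg (fun f => inW F f /\ (restr A f != (fun _ => 0) -> G (restr A f))) l a ->
  restr A a != (fun _ => 0) -> is_avg G l (restr A a).
Proof.
move=> /is_avgP[fs [h1 /andP[_ h2] h3 h4 ->]].
have -> : restr A (fun i => l%:R^-1 * vsum fs i) = fun i => l%:R^-1 * vsum (restr_seq A fs) i.
  by rewrite -restr_vsum; apply/funext => i; rewrite /restr; case: ifP; rewrite ?mulr0.
move=> nz; apply/is_avgP; exists (restr_seq A fs); split=> //.
- apply/andP; split.
    rewrite lt0n size_eq0; apply: contraNneq nz => ->; apply/eqP/funext => i.
    by rewrite /vsum big_nil mulr0.
  by rewrite size_filter; apply: leq_trans (count_size _ _) _; rewrite size_map.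
- by move=> f; rewrite mem_filter => /andP[f0 /mapP[g /h3[_ hg] fg]]; move: f0; rewrite fg.
- exact: restr_blk.
Qed.

Hypothesis Freg : regular F.

(** Restriction loses some minima of supports and moves the others to the right, which is a spread
    of a subset. *)
Lemma restr_imin (K : fam) G A T : regular K -> (forall t, t \in T -> good G t) ->
  pairwise before T -> K (map imin T) -> K (map imin (restr_items A T)).
Proof.
move=> Kreg hT hp hK; rewrite -map_comp.
pose T' := [seq t <- T | restr A (ivec t) != (fun _ => 0)].
have sT : subseq T' T by exact: filter_subseq.
have nz t : t \in T' -> t \in T /\ is_min_supp (restr A (ivec t)) (msupp (restr A (ivec t))).
  by rewrite mem_filter => /andP[/nonzeroP/msuppP h ->].
apply: (reg_spread_map Kreg (mu := imin) hK).
- move=> t /nz[tT [h1 _]]; split; first exact: map_f.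
  have [_ [_ h]] := hT t tT; apply: h; exact: restr_neq0 h1.
- exact: (subseq_pairwise sT (before_imin hT hp)).
- apply: (sub_in_pairwise (P := mem T')) (subseq_pairwise sT hp); last exact/seq.allP.
  move=> t s /nz[_ [t1 _]] /nz[_ [s1 _]] /beforeP[h _ _] /=.
  by apply: h; [exact: restr_neq0 t1|exact: restr_neq0 s1].
Qed.

Lemma inW_restr A f : inW F f -> restr A f != (fun _ => 0) -> inW F (restr A f).
Proof.
move: f; apply: inW_ind.
- move=> n n0.
  have h c : restr A (fun i => c * e R n i) != (fun _ => 0) ->
      restr A (fun i => c * e R n i) = fun i => c * e R n i.
    move=> h; apply/funext => i; rewrite /restr; case: ifPn => // Ai.
    rewrite /e; case: (eqVneq i n) => [ni|_]; last by rewrite mulr0.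
    move/eqP: h; case; apply/funext => k; rewrite /restr /e; case: ifP => // Ak.
    case: eqP => [kn|_]; last by rewrite mulr0.
    by move: Ai; rewrite ni -kn Ak.
  have e1 : e R n = (fun i => 1 * e R n i) by apply/funext => i; rewrite mul1r.
  have e2 : (fun i => - e R n i) = (fun i => -1 * e R n i) by apply/funext => i; rewrite mulN1r.
  split; [rewrite e1|rewrite e2] => /h ->; exists 0%N; exists n; split=> //.
    by left.
  by right.
- by move=> l a h /(restr_avg h); exact: avg_inW.
- move=> T T0 hT hp hF; rewrite restr_isum => nz; apply: isum_inW.
  + by apply: contraNneq nz => ->; apply/eqP/funext => i; rewrite /isum /vsum big_nil.
  + move=> s /mapP[t]; rewrite mem_filter => /andP[t0 /hT[h1 h2]] ->.
    by split; [exact: restr_avg h1 t0 | exact/msuppP/nonzeroP].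
  + exact: restr_before.
  + exact: restr_imin hT hp hF.
Qed.

End Levels.
End NormingSet.

Arguments blkb {R} f g.
Arguments before {R} t t'.
Arguments ivec {R} t.
Arguments isize {R} t.
Arguments imin {R} t.
Arguments nitem {R} t.

(** * Upper estimates *)

Section Estimates.
Variable R : realType.
Implicit Types (f g x y : vec R) (fs : seq (nat -> R)) (v : nat -> vec R) (a : nat -> R).

Lemma hit_blk f g x y : blk f g -> blk x y -> hit g x -> hit f y -> False.
Proof.
move=> fg xy /asboolP[i [gi xi]] /asboolP[j [fj yj]].
by have := ltn_trans (fg _ _ fj gi) (xy _ _ xi yj); rewrite ltnn.
Qed.

(* A later functional can meet at most one vector that an earlier one meets
   too, so the incidences exceed the vectors by fewer than [size fs]. *)
Lemma double_count fs v A a (m : R) : pairwise blkb fs -> uniq A ->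
  (forall k l, k \in A -> l \in A -> (k < l)%N -> blk (v k) (v l)) ->
  0 <= m -> (forall k, k \in A -> 0 <= a k <= m) ->
  \sum_(f <- fs) \sum_(k <- A | hit f (v k)) a k
    <= \sum_(k <- A) a k + (size fs).-1%:R * m.
Proof.
move=> /pairwise_blkP hp uA hb m0 ha.
pose h q k := hit (nth (vzero R) fs q) (v k).
pose old q k := has (fun p => h p k) (iota 0 q).
have key p q k l : (p < q)%N -> (q < size fs)%N -> k \in A -> l \in A ->
    h q k -> h p l -> (l <= k)%N.
  move=> pq qs kA lA hq hpl; rewrite leqNgt; apply/negP => kl.
  exact: hit_blk (hp p q pq qs) (hb _ _ kA lA kl) hq hpl.
rewrite (big_nth (vzero R)).
have -> : \sum_(0 <= q < size fs) \sum_(k <- A | hit (nth (vzero R) fs q) (v k)) a k =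
  \sum_(k <- A) \sum_(0 <= q < size fs) (if h q k && ~~ old q k then a k else 0) +
  \sum_(0 <= q < size fs) \sum_(k <- A) (if h q k && old q k then a k else 0).
  rewrite exchange_big -big_split /=; apply: eq_bigr => q _.
  rewrite -big_split big_mkcond /=; apply: eq_bigr => k _; rewrite -/(h q k).
  by case: (h q k); case: (old q k); rewrite /= ?addr0 ?add0r.
apply: lerD.
  rewrite big_seq [leRHS]big_seq; apply: ler_sum => k kA.
  have /andP[a0 _] := ha k kA.
  apply: sum_at_most_one => //; first exact: iota_uniq.
    by move=> q _; case: ifP.
  move=> p q _ _; case: ifPn => [/andP[hp' op]|]; last by rewrite eqxx.
  case: ifPn => [/andP[hq oq]|]; last by rewrite eqxx.
  move=> _ _; case: (ltngtP p q) => // pq.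
    by move/hasPn: oq => /(_ p); rewrite mem_iota /= pq hp' => /(_ isT).
  by move/hasPn: op => /(_ q); rewrite mem_iota /= pq hq => /(_ isT).
case E : (size fs) => [|n]; first by rewrite big_nil mul0r.
rewrite big_nat_recl // [X in X + _]big1 ?add0r; last first.
  by move=> k _; rewrite andbF.
apply: (@le_trans _ _ (\sum_(0 <= q < n) m)); last first.
  by rewrite big_const_nat iter_addr_0 subn0 mulr_natl.
rewrite big_nat [leRHS]big_nat; apply: ler_sum => q /andP[_ qn].
have qs : (q.+1 < size fs)%N by rewrite E.
apply: sum_at_most_one => // [k kA|k l kA lA].
  by have /andP[a0 am] := ha k kA; case: ifP.
have aux k' l' : k' \in A -> l' \in A -> h q.+1 k' -> old q.+1 l' -> (l' <= k')%N.
  move=> kA' lA' hq /hasP[p]; rewrite mem_iota add0n => /andP[_ pq].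
  exact: (key p q.+1 k' l' pq qs kA' lA' hq).
case: ifPn => [/andP[hk ok]|]; last by rewrite eqxx.
case: ifPn => [/andP[hl ol]|]; last by rewrite eqxx.
by move=> _ _; apply/eqP; rewrite eqn_leq !aux.
Qed.

Lemma sum_pr_le N fs v A a (m : R) : pairwise blkb fs -> uniq A ->
  (forall k l, k \in A -> l \in A -> (k < l)%N -> blk (v k) (v l)) ->
  0 <= m -> (forall k, k \in A -> 0 <= a k <= m) ->
  (forall f k, f \in fs -> k \in A -> `|pr N f (v k)| <= 1) ->
  \sum_(f <- fs) `|pr N f (comb v A a)| <= \sum_(k <- A) a k + (size fs).-1%:R * m.
Proof.
move=> hp uA hb m0 ha h; apply: le_trans (double_count hp uA hb m0 ha).
rewrite big_seq [leRHS]big_seq; apply: ler_sum => f ff.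
rewrite pr_comb [leRHS]big_mkcond; apply: le_trans (ler_norm_sum _ _ _) _.
rewrite [leLHS]big_seq [leRHS]big_seq; apply: ler_sum => k kA.
have /andP[a0 am] := ha k kA.
case: ifPn => [_|/pr_nohit->]; last by rewrite mulr0 normr0.
by rewrite normrM ger0_norm // -[leRHS]mulr1 ler_wpM2l // h.
Qed.

(** If the members met disjoint sets of vectors, the first term alone would do. By [double_count]
    the excess of incidences is below the number of members, and dividing by [l] leaves at most one
    [m]. *)
Lemma avg_pr_le N (K : vec R -> Prop) l f v A a (m : R) : is_avg K l f -> uniq A ->
  (forall k l, k \in A -> l \in A -> (k < l)%N -> blk (v k) (v l)) ->
  0 <= m -> (forall k, k \in A -> 0 <= a k <= m) ->
  (forall f k, K f -> k \in A -> `|pr N f (v k)| <= 1) ->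
  `|pr N f (comb v A a)| <= l%:R^-1 * \sum_(k <- A) a k + m.
Proof.
move=> /is_avgP[fs [l2 /andP[s0 sl] hK hp ->]] uA hb m0 ha h.
have l0 : (0 < l)%N by exact: ltnW.
rewrite prZl normrM normfV normr_nat pr_vsum.
have := sum_pr_le hp uA hb m0 ha (fun f k ff => h f k (hK f ff)).
move=> /(le_trans (ler_norm_sum _ _ _)) h1.
apply: le_trans (ler_wpM2l _ h1) _; first by rewrite invr_ge0.
rewrite mulrDr lerD2l mulrA ler_piMl // ler_pdivrMl ?ltr0n // mulr1 ler_nat.
by apply: leq_trans sl; exact: leq_pred.
Qed.

Variables (G : fam) (H : nat -> fam).
Hypothesis GH : family_scale R G H.

Lemma inW_e1 : inW G (e R 1).
Proof. by exists 0%N; exists 1%N; split=> //; left. Qed.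

Let Wne : exists f, inW G f := ex_intro _ _ inW_e1.
Let Wbd (f : vec R) i : inW G f -> `|f i| <= 1 := @inW_le1 R G f i.
Let WN (f : vec R) : inW G f -> inW G (fun i => - f i) := @inWN R G f.

Lemma Wnorm_ub N f x : supp_below x N -> inW G f -> `|pr N f x| <= Wnorm G x.
Proof. exact: (norm_ub Wbd WN). Qed.

Lemma Wnorm_le N x B : supp_below x N -> (forall f, inW G f -> pr N f x <= B) ->
  Wnorm G x <= B.
Proof. exact: (norm_le Wne). Qed.

Lemma Wnorm_near N x r : supp_below x N -> r < Wnorm G x ->
  exists f, inW G f /\ r < pr N f x.
Proof. exact: (norm_near Wne). Qed.

Lemma WnormZ N c x : supp_below x N ->
  Wnorm G (fun i => c * x i) = `|c| * Wnorm G x.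
Proof. exact: (normZ Wne Wbd WN). Qed.

Lemma Wnorm_comb N v A a : (forall k, k \in A -> supp_below (v k) N) ->
  Wnorm G (comb v A a) <= \sum_(k <- A) `|a k| * Wnorm G (v k).
Proof. exact: (norm_comb Wne Wbd WN). Qed.

Lemma Wnorm_ge0 N x : supp_below x N -> 0 <= Wnorm G x.
Proof. exact: (norm_ge0 Wne Wbd WN). Qed.

Definition schreier_items (T : seq (item R)) := [/\ forall t, t \in T -> good (inW G) t,
  pairwise before T & G (map imin T)].

Lemma isum_ub N T x : schreier_items T -> supp_below x N ->
  `|pr N (isum T) x| <= Wnorm G x.
Proof.
move=> [hT hp hG] xN; case: (eqVneq T [::]) => [->|T0].
  rewrite /isum /vsum /pr big1 ?normr0 ?(Wnorm_ge0 xN) // => i _.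
  by rewrite big_nil mul0r.
by apply: Wnorm_ub => //; exact: isum_inW.
Qed.

Lemma has_split (T : Type) (p : pred T) (s : seq T) : has p s ->
  exists s1 t s2, [/\ s = s1 ++ t :: s2, p t & all (predC p) s1].
Proof.
elim: s => //= t s IH; case: (boolP (p t)) => [pt _|pt /= /IH[s1 [u [s2 [-> pu h]]]]].
  by exists [::], t, s.
by exists (t :: s1), u, s2; rewrite /= pt.
Qed.

Lemma schreier_items_sub T T' : subseq T' T -> schreier_items T -> schreier_items T'.
Proof.
move=> sT [hT hp hG]; split.
- by move=> t /(mem_subseq sT)/hT.
- exact: subseq_pairwise sT hp.
- have Greg := scale_G GH; apply: (reg_sub Greg hG).
    rewrite (sorted_pairwise ltn_trans) pairwise_map.
    exact: subseq_pairwise sT (before_imin hT hp).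
  by apply: mem_subseq; exact: map_subseq.
Qed.

Lemma imin_sub (K : fam) T T' : regular K -> schreier_items T -> subseq T' T ->
  K (map imin T) -> K (map imin T').
Proof.
move=> Kreg [hT hp _] sT hK; apply: (reg_sub Kreg hK).
  rewrite (sorted_pairwise ltn_trans) pairwise_map.
  exact: subseq_pairwise sT (before_imin hT hp).
by apply: mem_subseq; exact: map_subseq.
Qed.

(** * Sums of c_0-like block vectors have norm at most 5 *)

Section UpperEstimate.
Variables (n : nat) (v : nat -> vec R) (s M : nat -> nat) (N : nat) (eps : R).
Hypothesis n0 : (0 < n)%N.
Hypothesis supp_v : forall k i, (k < n)%N -> v k i != 0 -> (s k <= i < M k)%N.
Hypothesis sM : forall k, (k < n)%N -> (s k <= M k <= s k.+1)%N.
Hypothesis vN : forall k, (k < n)%N -> supp_below (v k) N.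
Hypothesis ns : (n <= s 0)%N.
Hypothesis v1 : forall k, (k < n)%N -> Wnorm G (v k) <= 1.
Hypothesis eps0 : 0 <= eps.
Hypothesis neps : 2 * n%:R * eps <= 1.
Hypothesis small : forall k0 k T, (k0 < k < n)%N -> schreier_items T ->
  H (M k0) (map imin T) -> (forall t, t \in T -> (s k0.+1 <= isize t)%N) ->
  `|pr N (isum T) (v k)| <= eps.

Let vs A := comb v A (fun _ => 1).

Let s_le k l : (k <= l)%N -> (l <= n)%N -> (s k <= s l)%N.
Proof.
elim: l => [|l IH]; first by rewrite leqn0 => /eqP ->.
rewrite leq_eqVlt => /orP[/eqP -> //|kl] ln; apply: leq_trans (IH kl (ltnW ln)) _.
by have /andP[h1 h2] := sM ln; exact: leq_trans h2.
Qed.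

Let v_blk k l : (k < l)%N -> (l < n)%N -> blk (v k) (v l).
Proof.
move=> kl ln i j; have kn := ltn_trans kl ln.
move=> /(supp_v kn)/andP[_ iM] /(supp_v ln)/andP[sj _].
apply: leq_trans iM _; apply: leq_trans sj; have /andP[_ h] := sM kn.
exact: leq_trans h (s_le kl (ltnW ln)).
Qed.

Let pr_vs f A : pr N f (vs A) = \sum_(k <- A) pr N f (v k).
Proof. by rewrite pr_comb; apply: eq_bigr => k _; rewrite mul1r. Qed.

Let pr_v f k : inW G f -> (k < n)%N -> `|pr N f (v k)| <= 1.
Proof. by move=> fW kn; apply: le_trans (Wnorm_ub (vN kn) fW) (v1 kn). Qed.

Let subA A := sorted ltn A /\ forall k, k \in A -> (k < n)%N.

Let size_A A : subA A -> (size A <= n)%N.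
Proof.
move=> [sA An]; rewrite -[n](size_iota 0); apply: uniq_leq_size.
  exact: sorted_uniq ltn_trans ltnn _ sA.
by move=> k /An kn; rewrite mem_iota.
Qed.

Let subA_filter p A : subA A -> subA [seq k <- A | p k].
Proof.
by move=> [sA An]; split; [exact: (sorted_filter ltn_trans)|
  move=> k; rewrite mem_filter => /andP[_ /An]].
Qed.

(** The induction claim. Subtracting 1 from the size pays for the overcount in [double_count]; since
    averages have size at least 2, they satisfy the claim even with [eps] in place of [2 * eps]. The
    half thus saved absorbs the tail of a Schreier sum. *)
Let P f := forall A, subA A -> `|pr N f (vs A)| <= 4 + 2 * eps * ((size A)%:R - 1).

Let eps_half : eps <= 1 / 2.
Proof.
have n1 : 1 <= n%:R :> R by rewrite ler1n.
by move: neps n1 eps0; nra.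
Qed.

Let avg_bound l f A : is_avg (fun g => inW G g /\ P g) l f -> subA A -> (0 < size A)%N ->
  `|pr N f (vs A)| <= 4 + eps * ((size A)%:R - 1).
Proof.
move=> /is_avgP[fs [l2 /andP[d0 dl] hfs hp ->]] hA A0.
have l0 : (0 < l)%N by exact: ltnW.
have uA : uniq A := sorted_uniq ltn_trans ltnn hA.1.
have AR : 1 <= (size A)%:R :> R by rewrite ler1n.
rewrite prZl normrM normfV normr_nat pr_vsum ler_pdivrMl ?ltr0n //.
apply: le_trans (ler_norm_sum _ _ _) _.
apply: (@le_trans _ _ (\sum_(f <- fs) (4 - 2 * eps + 2 * eps * \sum_(k <- A | hit f (v k)) 1))).
  rewrite big_seq [leRHS]big_seq; apply: ler_sum => g /hfs[gW gP].
  have -> : pr N g (vs A) = pr N g (vs [seq k <- A | hit g (v k)]).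
    rewrite !pr_vs big_filter [RHS]big_mkcond; apply: eq_bigr => k _.
    by case: ifPn => // /pr_nohit->.
  apply: le_trans (gP _ (subA_filter _ hA)) _.
  rewrite big_const_seq iter_addr_0 -size_filter mulrBr mulr1; lra.
rewrite big_split /= -mulr_sumr big_const_seq count_predT iter_addr_0 -mulr_natr.
have h01 (k : nat) : k \in A -> (0 : R) <= (1 : R) <= (1 : R) by rewrite ler01 lexx.
have := double_count (a := fun _ => 1) hp uA
  (fun k l _ lA kl => v_blk kl (hA.2 l lA)) ler01 h01.
rewrite big_const_seq count_predT iter_addr_0 mulr1 => dc.
have dR : (size fs).-1%:R = (size fs)%:R - 1 :> R by rewrite -subn1 natrB.
have dlR : (size fs)%:R <= l%:R :> R by rewrite ler_nat.
have l2R : 2 <= l%:R :> R by rewrite ler_nat.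
have d1R : 1 <= (size fs)%:R :> R by rewrite ler1n.
rewrite dR in dc.
set X := \sum_(f <- fs) _ in dc *.
have h1 : 2 * eps * X <= 2 * eps * ((size A)%:R + ((size fs)%:R - 1)).
  by rewrite ler_wpM2l ?mulr_ge0.
have h2 : 2 * (eps * ((size A)%:R - 1)) <= l%:R * (eps * ((size A)%:R - 1)).
  by rewrite ler_wpM2r // mulr_ge0 // subr_ge0.
by move: h1 h2 dlR; lra.
Qed.

Let subA_nil_bound : 0 <= 4 + 2 * eps * ((size (@nil nat))%:R - 1).
Proof. by move: eps_half; rewrite /=; lra. Qed.

Let pr_vs_nil f : pr N f (vs [::]) = 0.
Proof. by rewrite pr_vs big_nil. Qed.

Let bound_mono (A A' : seq nat) : (size A <= size A')%N ->
  4 + 2 * eps * ((size A)%:R - 1) <= 4 + 2 * eps * ((size A')%:R - 1) :> R.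
Proof. by move=> h; rewrite lerD2l ler_wpM2l ?mulr_ge0 // lerD2r ler_nat. Qed.

Let isum_hit T x : hit (isum T) x -> exists2 t, t \in T & hit (ivec t) x.
Proof.
move=> /asboolP[i [fi xi]]; have : has (fun t : item R => ivec t i != 0) T.
  apply: contraNT fi => /hasPn h; rewrite /isum /vsum big_map big_seq big1 // => t /h.
  by move/negbNE/eqP.
by move=> /hasP[t tT ti]; exists t => //; apply/asboolP; exists i.
Qed.

Let pr_isum T x : pr N (isum T) x = \sum_(t <- T) pr N (ivec t) x.
Proof. by rewrite /isum pr_vsum big_map. Qed.

(** Let [v k0] be the first vector met and [ts] the first average reaching [s k0.+1]. Averages
    before [ts] act on [v k0] only; those after it have size above [s k0.+1], so [small] applies to
    them. If an average before [ts] meets [v k0], then [ts] has size at least [n] and contributes at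
    most 2 on the other vectors, within a total of 4. Otherwise only [ts] acts on [v k0], and
    [avg_bound] covers [ts] on all vectors. *)
Let isum_bound T : T != [::] -> (forall t, t \in T -> good (fun g => inW G g /\ P g) t) ->
  pairwise before T -> G (map imin T) -> P (isum T).
Proof.
move=> T0 hT hp hG A0 hA0.
have hT' t : t \in T -> good (inW G) t.
  by move=> /hT; apply: good_sub => g [].
have sT : schreier_items T by [].
have TW : inW G (isum T) by exact: isum_inW.
have -> : pr N (isum T) (vs A0) = pr N (isum T) (vs [seq k <- A0 | hit (isum T) (v k)]).
  rewrite !pr_vs big_filter [RHS]big_mkcond; apply: eq_bigr => k _.
  by case: ifPn => // /pr_nohit->.
apply: le_trans; last by apply: (@bound_mono [seq k <- A0 | hit (isum T) (v k)]);
  rewrite size_filter; exact: count_size.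
have hA := subA_filter (fun k => hit (isum T) (v k)) hA0.
have Ahit k : k \in [seq k <- A0 | hit (isum T) (v k)] -> hit (isum T) (v k).
  by rewrite mem_filter => /andP[].
move: [seq k <- A0 | hit (isum T) (v k)] hA Ahit => [|k0 A2] hA Ahit.
  by rewrite pr_vs_nil normr0 subA_nil_bound.
have [sA An] := hA.
have k0n : (k0 < n)%N by apply: An; rewrite mem_head.
have A2k k : k \in A2 -> (k0 < k < n)%N.
  move=> kA; rewrite An ?inE ?kA ?orbT // andbT.
  by have /seq.allP := order_path_min ltn_trans sA; apply.
have hA2 : subA A2 by split; [exact: path_sorted sA | move=> k /A2k/andP[]].
have [t' t'T /asboolP[i0 [ti0 vi0]]] := isum_hit (Ahit k0 (mem_head _ _)).
have /andP[si0 i0M] := supp_v k0n vi0.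
(* Some average starts before [M k0], and the level of an admissible set lies below its minimum. *)
have HT : H (M k0) (map imin T).
  have /(scale_GE GH)[m [/le_minP mT hm]] := hG.
  apply: (scale_le GH) hm; apply: ltnW; apply: leq_trans (mT _ (map_f _ t'T)) _.
  by have [_ [_ h]] := hT t' t'T; apply: leq_trans (h _ ti0) (ltnW i0M).
have A2s k i : k \in A2 -> v k i != 0 -> (s k0.+1 <= i)%N.
  move=> /A2k/andP[k0k kn] /(supp_v kn)/andP[h _]; apply: leq_trans h.
  by apply: s_le; [|exact: ltnW].
have AR : 0 <= (size A2)%:R :> R by [].
have szA : 2 * eps * (size A2)%:R <= 1.
  apply: le_trans neps; rewrite -mulrA [_ * _%:R]mulrC mulrA ler_wpM2r // ler_wpM2l //.
  by rewrite ler_nat; apply: size_A.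
have goal_eq : 4 + 2 * eps * ((size (k0 :: A2))%:R - 1) = 4 + 2 * eps * (size A2)%:R :> R.
  by rewrite /= -[(size A2).+1%:R]natr1 addrK.
rewrite goal_eq pr_vs big_cons -pr_vs.
pose p (t : item R) := `[< exists i, ivec t i != 0 /\ (s k0.+1 <= i)%N >].
have far t k : t \in T -> ~~ p t -> k \in A2 -> pr N (ivec t) (v k) = 0.
  move=> tT /asboolPn nt kA2; apply: pr_nohit; apply/asboolPn => -[i [ti vi]].
  by apply: nt; exists i; split=> //; exact: A2s vi.
have [/has_split[T1 [ts [T2 [eT pts /seq.allP nT1]]]]|/hasPn nT] := boolP (has p T); last first.
  rewrite pr_vs big_seq big1 ?addr0; last first.
    by move=> k kA2; rewrite pr_isum big_seq big1 // => t tT; apply: far => //; exact: nT.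
  by apply: le_trans (pr_v TW k0n) _; move: eps0 AR; nra.
have tsT : ts \in T by rewrite eT mem_cat mem_head orbT.
have T1T t : t \in T1 -> t \in T by move=> h; rewrite eT mem_cat h.
have sT2 : subseq T2 T.
  by rewrite eT; apply: subseq_trans (suffix_subseq _ _); exact: subseq_cons.
move: pts => /asboolP[i1 [tsi1 si1]].
have : pairwise before (T1 ++ ts :: T2) by rewrite -eT.
rewrite pairwise_cat => /and3P[/allrelP hb12 _ /= /andP[/seq.allP hb2 _]].
have T2size t : t \in T2 -> (s k0.+1 <= isize t)%N.
  move=> /hb2/beforeP[_ _ h]; apply: leq_trans si1 _; exact: ltnW (h _ tsi1).
have T2small k : k \in A2 -> `|pr N (isum T2) (v k)| <= eps.
  move=> /A2k h; apply: (small h) => //.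
    exact: schreier_items_sub sT.
  exact: imin_sub (scale_H GH _) sT sT2 HT.
have T2k0 : pr N (isum T2) (v k0) = 0.
  rewrite pr_isum big_seq big1 // => t tT2; apply: pr_nohit; apply/asboolPn => -[i [ti vi]].
  have /beforeP[h _ _] := hb2 t tT2; have := h _ _ tsi1 ti.
  have /andP[_ iM] := supp_v k0n vi; have /andP[_ h2] := sM k0n.
  by move=> h3; have := leq_ltn_trans si1 h3; rewrite ltnNge (leq_trans (ltnW iM) h2).
have sum0 T' x : (forall t, t \in T' -> pr N (ivec t) x = 0) -> pr N (isum T') x = 0.
  by move=> h; rewrite pr_isum big_seq big1.
have eTx x : pr N (isum T) x = pr N (isum T1) x + (pr N (ivec ts) x + pr N (isum T2) x).
  by rewrite eT !pr_isum big_cat big_cons.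
have eT_A2 : pr N (isum T) (vs A2) = pr N (ivec ts) (vs A2) + pr N (isum T2) (vs A2).
  rewrite !pr_vs -big_split big_seq [RHS]big_seq; apply: eq_bigr => k kA2.
  rewrite eTx (sum0 T1) ?add0r // => t tT1.
  by apply: far => //; [exact: T1T | exact: nT1].
have T2A2 : `|pr N (isum T2) (vs A2)| <= eps * (size A2)%:R.
  rewrite pr_vs; apply: le_trans (ler_norm_sum _ _ _) _.
  apply: (@le_trans _ _ (\sum_(k <- A2) eps)).
    by rewrite big_seq [leRHS]big_seq; exact: ler_sum.
  by rewrite big_const_seq count_predT iter_addr_0 mulr_natr.
have [tsavg _] := hT ts tsT.
have [/hasP[t tT1 /asboolP[i [ti vi]]]|/hasPn nh] :=
    boolP (has (fun t : item R => hit (ivec t) (v k0)) T1).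
  have sts : (n <= isize ts)%N.
    have /beforeP[_ _ h] := hb12 t ts tT1 (mem_head _ _).
    apply: leq_trans ns _; apply: leq_trans (s_le (leq0n k0) (ltnW k0n)) _.
    have /andP[h' _] := supp_v k0n vi; apply: leq_trans h' _; exact: ltnW (h _ ti).
  have h1 := pr_v TW k0n.
  have h2 : `|pr N (ivec ts) (vs A2)| <= 2.
    have h01 (k : nat) : k \in A2 -> (0 : R) <= (1 : R) <= (1 : R) by rewrite ler01 lexx.
    have hf f k : inW G f /\ P f -> k \in A2 -> `|pr N f (v k)| <= 1.
      by move=> [fW _] /hA2.2; exact: pr_v.
    have := avg_pr_le (a := fun _ => 1) tsavg (sorted_uniq ltn_trans ltnn hA2.1)
      (fun k l _ lA kl => v_blk kl (hA2.2 l lA)) ler01 h01 hf.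
    rewrite big_const_seq count_predT iter_addr_0 => /le_trans; apply.
    - rewrite [leRHS](_ : 2 = 1 + 1) // lerD2r ler_pdivrMl; last first.
        by rewrite ltr0n; exact: leq_trans sts.
      by rewrite mulr1 ler_nat; apply: leq_trans sts; exact: size_A.
  rewrite eT_A2; apply: le_trans (ler_normD _ _) _.
  have := ler_normD (pr N (ivec ts) (vs A2)) (pr N (isum T2) (vs A2)).
  by move: h1 h2 T2A2 szA AR eps0; nra.
have -> : pr N (isum T) (v k0) = pr N (ivec ts) (v k0).
  by rewrite eTx T2k0 addr0 (sum0 T1) ?add0r // => t /nh/pr_nohit.
have -> : pr N (ivec ts) (v k0) + pr N (isum T) (vs A2) =
    pr N (ivec ts) (vs (k0 :: A2)) + pr N (isum T2) (vs A2).
  by rewrite eT_A2 addrA [pr N _ (vs (k0 :: A2))]pr_vs big_cons -pr_vs.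
have := avg_bound tsavg hA isT; rewrite pr_vs /= -[(size A2).+1%:R]natr1 addrK => h1.
apply: le_trans (ler_normD _ _) _.
by apply: le_trans (lerD h1 T2A2) _; move: eps0 AR; lra.
Qed.

Lemma sum_upper_estimate A : sorted ltn A -> (forall k, k \in A -> (k < n)%N) ->
  Wnorm G (comb v A (fun _ => 1)) <= 5.
Proof.
move=> sA An; have hA : subA A by [].
apply: (@Wnorm_le N); first by apply: supp_below_comb => k /An; exact: vN.
move=> f fW; apply: le_trans (ler_norm _) _.
suff fP : P f.
  apply: le_trans (fP A hA) _.
  have : (size A)%:R <= n%:R :> R by rewrite ler_nat; exact: size_A.
  by move: neps eps0; nra.
move: f fW; apply: inW_ind.
- have e1 f : inW G f -> (forall i j, f i != 0 -> f j != 0 -> i = j) -> P f.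
    move=> fW f1 B hB; case: (eqVneq B [::]) => [->|B0].
      by rewrite pr_vs_nil normr0 subA_nil_bound.
    have B1 : 1 <= (size B)%:R :> R by rewrite ler1n lt0n size_eq0.
    apply: (@le_trans _ _ 1); last by move: eps0; nra.
    rewrite pr_vs; apply: le_trans (ler_norm_sum _ _ _) _.
    apply: sum_at_most_one => //.
    + exact: sorted_uniq ltn_trans ltnn _ hB.1.
    + by move=> l /hB.2; exact: pr_v.
    + move=> l l' lB lB'; rewrite !normr_eq0 => hl hl'.
      have /asboolP[i [fi vi]] : hit f (v l) by apply: contraNT hl => /pr_nohit->.
      have /asboolP[j [fj vj]] : hit f (v l') by apply: contraNT hl' => /pr_nohit->.
      have ij := f1 _ _ fi fj; rewrite -ij in vj.
      case: (ltngtP l l') => // ll.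
        by have := v_blk ll (hB.2 _ lB') vi vj; rewrite ltnn.
      by have := v_blk ll (hB.2 _ lB) vj vi; rewrite ltnn.
  have h m i : e R m i != 0 -> i = m.
    by rewrite /e pnatr_eq0 eqb0 negbK => /eqP.
  move=> m m0; split; apply: e1 => //.
  + by exists 0%N; exists m; split=> //; left.
  + by move=> i j /h -> /h ->.
  + by exists 0%N; exists m; split=> //; right.
  + by move=> i j; rewrite !oppr_eq0 => /h -> /h ->.
- move=> l f hf B hB; case: (eqVneq B [::]) => [->|B0].
    by rewrite pr_vs_nil normr0 subA_nil_bound.
  have B1 : (0 < size B)%N by rewrite lt0n size_eq0.
  have B1R : 1 <= (size B)%:R :> R by rewrite ler1n.
  by apply: le_trans (avg_bound hf hB B1) _; move: eps0; nra.
- exact: isum_bound.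
Qed.

End UpperEstimate.
End Estimates.

(** The gliding hump: each object is chosen for a threshold beyond [phi] and beyond the bounds [bd]
    of all earlier objects. *)
Lemma chain_choice (X : Type) (P : nat -> X -> Prop) (bd : X -> nat) (phi : nat -> nat) :
  (forall N, exists x, P N x) -> exists (f : nat -> X) (n : nat -> nat),
    [/\ forall j, P (n j) (f j), forall j, (phi j <= n j)%N,
        forall i j, (i < j)%N -> (bd (f i) <= n j)%N &
        forall i j, (i <= j)%N -> (n i <= n j)%N].
Proof.
move=> /choice[F hF].
pose n := fix n j := if j is i.+1 then maxn (phi i.+1) (maxn (n i) (bd (F (n i)))) else phi 0%N.
have nS j : (n j <= n j.+1)%N by rewrite /= !leq_max leqnn orbT.
have nmono i j : (i <= j)%N -> (n i <= n j)%N by exact: (homo_leq leqnn leq_trans nS).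
exists (F \o n), n; split=> //.
- by case=> [|j] //=; exact: leq_maxl.
- by move=> i j ij; apply: leq_trans (nmono _ _ ij); rewrite /= !leq_max leqnn !orbT.
Qed.

Lemma seq_argmax (R : realType) (a : nat -> R) (s : seq nat) : s != [::] ->
  exists2 i, i \in s & forall j, j \in s -> a j <= a i.
Proof.
elim: s => // i [|k s] IH _.
  by exists i; rewrite ?mem_head // => j; rewrite inE => /eqP ->.
have [//|l ls hl] := IH; have [il|li] := leP (a i) (a l).
  by exists l; [rewrite inE ls orbT|move=> j; rewrite inE => /orP[/eqP ->|/hl]].
exists i; first exact: mem_head.
move=> j; rewrite inE => /orP[/eqP -> //|/hl/le_trans]; apply; exact: ltW.
Qed.

(** * Block sequences, and Schreier sums of large averages on special convex combinations *)

Section Blocks.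
Variables (R : realType) (G : fam) (H : nat -> fam).
Hypothesis GH : family_scale R G H.
Implicit Types (x y v : nat -> vec R) (p : nat -> nat) (T : seq (item R)).

(** [p] only bounds the supports, which may be empty, so subsequences and blocks keep the form with
    [p] read at the chosen indices. The clause [i <= p i] lets sets of indices be compared with sets
    of coordinates through spreading. *)
Record block_seq p x : Prop := BlockSeq {
  block_le : forall i j, (i <= j)%N -> (p i <= p j)%N;
  block_id : forall i, (i <= p i)%N;
  block_supp : forall i k, x i k != 0 -> (p i <= k < p i.+1)%N }.

Lemma block_below p x i : block_seq p x -> supp_below (x i) (p i.+1).
Proof.
move=> hx k pk; apply/eqP; rewrite -[_ == 0]negbK; apply/negP => /(block_supp hx)/andP[_].
by rewrite ltnNge pk.
Qed.

Lemma block_blk p x i j : block_seq p x -> (i < j)%N -> blk (x i) (x j).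
Proof.
move=> hx ij k l /(block_supp hx)/andP[_ k1] /(block_supp hx)/andP[l1 _].
by apply: leq_trans k1 (leq_trans _ l1); exact: block_le hx _ _ ij.
Qed.

Lemma block_comb_below p x A a N : block_seq p x -> (forall i, i \in A -> (p i.+1 <= N)%N) ->
  supp_below (comb x A a) N.
Proof.
move=> hx h; apply: supp_below_comb => i /h; apply: supp_below_widen.
exact: block_below.
Qed.

Lemma before_cases T t t' : pairwise before T -> t \in T -> t' \in T ->
  [\/ t = t', before t t' | before t' t].
Proof.
elim: T => // s T IH /= /andP[/seq.allP hs hp].
rewrite !in_cons => /orP[/eqP ->|tT] /orP[/eqP ->|t'T].
- by constructor 1.
- by constructor 2; exact: hs.
- by constructor 3; exact: hs.
- exact: IH.
Qed.

Lemma schreier_items_uniq T : schreier_items G T -> uniq T.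
Proof.
move=> [hT hp _]; apply: (@map_uniq _ _ imin).
apply: sorted_uniq ltn_trans ltnn _ _; rewrite (sorted_pairwise ltn_trans) pairwise_map.
exact: before_imin hT hp.
Qed.

Section SpecialSmall.
Variables (p : nat -> nat) (y : nat -> vec R) (E : seq nat) (a : nat -> R).
Variables (m s N : nat) (eps : R) (T : seq (item R)).
Hypothesis hy : block_seq p y.
Hypothesis y1 : forall i, i \in E -> Wnorm G (y i) <= 1.
Hypothesis EN : forall i, i \in E -> (p i.+1 <= N)%N.
Hypothesis sE : sorted ltn E.
Hypothesis E0 : forall i, i \in E -> (0 < i)%N.
Hypothesis sparse : forall i j, i \in E -> j \in E -> (i < j)%N -> (p i.+1 <= j)%N.
Hypothesis aE : special (H m) E a eps.
Hypothesis hT : schreier_items G T.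
Hypothesis HT : H m (map imin T).
Hypothesis s0 : (0 < s)%N.
Hypothesis sT : forall t, t \in T -> (s <= isize t)%N.

Let a0 i : 0 <= a i. Proof. by case: aE. Qed.

Let pS i := p i.+1.

Let pS_mono i j : i \in E -> j \in E -> (i < j)%N -> (pS i < pS j)%N.
Proof. by move=> iE jE /(sparse iE jE) h; apply: leq_ltn_trans h (block_id hy _). Qed.

(* The specialness of [a] refers to sets of indices; sparseness of [E] turns it
   into a statement about supports, at the cost of one extra index. *)
Let special_pS F : {subset F <= E} -> sorted ltn F -> H m (map pS F) ->
  \sum_(i <- F) a i <= 2 * eps.
Proof.
have [_ _ _ aF] := aE; have Hreg := scale_H GH m.
have a1 i : (0 < i)%N -> a i <= eps.
  by move=> /(reg_single Hreg)/aF; rewrite big_cons big_nil addr0.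
case: F => [|i0 F] FE sF HF.
  have := a1 1%N isT; have := a0 1%N; rewrite big_nil; lra.
rewrite big_cons mulrDl mul1r lerD //; first by apply/a1/E0/FE/mem_head.
apply: aF; rewrite -[F](mkseq_nth 0%N).
have sFp : pairwise ltn (i0 :: F) by rewrite -(sorted_pairwise ltn_trans).
have lt i j : (i < j)%N -> (j < (size F).+1)%N ->
    (nth 0%N (i0 :: F) i < nth 0%N (i0 :: F) j)%N.
  move=> ij js; move/(pairwiseP 0%N): sFp; apply; rewrite ?inE //.
  exact: ltn_trans js.
have iota_lt : pairwise ltn (iota 0 (size F)).
  by rewrite -(sorted_pairwise ltn_trans) iota_ltn_sorted.
have nF i : (i < (size F).+1)%N -> nth 0%N (i0 :: F) i \in E.
  by move=> iF; apply: FE; exact: mem_nth.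
apply: (reg_spread_map Hreg (mu := fun j => pS (nth 0%N (i0 :: F) j)) HF).
- move=> j; rewrite mem_iota add0n => /andP[_ jF]; split.
    by apply: map_f; apply: mem_nth; exact: ltnW.
  by apply: sparse; [apply: nF; exact: ltnW| exact: (nF j.+1) |exact: (lt j j.+1)].
- apply: (sub_in_pairwise (P := mem (iota 0 (size F)))) iota_lt; last exact/seq.allP.
  move=> i j; rewrite ?inE !mem_iota !add0n /= => iF jF ij.
  by apply: pS_mono; [apply/nF/ltnW|apply/nF/ltnW|apply: lt => //; exact: ltnW].
- apply: (sub_in_pairwise (P := mem (iota 0 (size F)))) iota_lt; last exact/seq.allP.
  move=> i j; rewrite ?inE !mem_iota !add0n /= => iF jF ij.
  exact: (lt i.+1 j.+1).
Qed.

Let start i := has (fun n => p i <= n < p i.+1)%N (map imin T).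

Let EF := [seq i <- E | start i].
Let ER := [seq i <- E | ~~ start i].

Let sum_EF : \sum_(i <- EF) a i <= 2 * eps.
Proof.
have sEF : sorted ltn EF by exact: (sorted_filter ltn_trans).
have pEF : pairwise ltn EF by rewrite -(sorted_pairwise ltn_trans).
apply: special_pS => //; first by move=> i; rewrite mem_filter => /andP[].
pose mu i := nth 0%N (map imin T) (find (fun n => p i <= n < p i.+1)%N (map imin T)).
have muP i : i \in EF -> (p i <= mu i < p i.+1)%N.
  by rewrite mem_filter => /andP[st _]; exact: (nth_find 0%N st).
apply: (reg_spread_map (scale_H GH m) (mu := mu) HT).
- move=> i iEF; have /andP[_ h] := muP i iEF; split; last exact: ltnW.
  by apply: mem_nth; rewrite -has_find; move: iEF; rewrite mem_filter => /andP[].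
- apply: (sub_in_pairwise (P := mem EF)) pEF; last exact/seq.allP.
  move=> i j /muP/andP[_ h1] /muP/andP[h2 _] ij /=.
  by apply: leq_trans h1 (leq_trans _ h2); exact: block_le hy _ _ ij.
- apply: (sub_in_pairwise (P := mem EF)) pEF; last exact/seq.allP.
  by move=> i j; rewrite ?inE !mem_filter => /andP[_ iE] /andP[_ jE]; exact: pS_mono.
Qed.

Let hitT t i := hit (ivec t) (y i).

(** If two averages meet [y i], the later one starts inside the interval of [y i], and then [i] is
    not in [ER]. *)
Let hit_before t t' i : t' \in T -> before t t' -> i \in ER ->
  hitT t i -> hitT t' i -> False.
Proof.
move=> t'T /beforeP[hb _ _]; rewrite mem_filter => /andP[/hasPn st iE].
move=> /asboolP[k [tk yk]] /asboolP[k' [tk' yk']].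
have [hgood _ _] := hT; have [_ [t'm t'min]] := hgood t' t'T.
have /negP := st _ (map_f imin t'T); apply.
have /andP[h1 _] := block_supp hy yk; have /andP[_ h2] := block_supp hy yk'.
rewrite (leq_trans h1 (ltnW (hb _ _ tk t'm))) /=.
by apply: leq_ltn_trans h2; exact: t'min.
Qed.

Let hit_unique t t' i : t \in T -> t' \in T -> i \in ER -> hitT t i -> hitT t' i -> t = t'.
Proof.
have [_ hp _] := hT; move=> tT t'T iER h h'.
have [//|b|b] := before_cases hp tT t'T; exfalso.
- exact: hit_before t'T b iER h h'.
- exact: hit_before tT b iER h' h.
Qed.

Let I t := [seq i <- ER | hitT t i].
Let T' := [seq t <- T | I t != [::]].

Let sum_I : \sum_(t <- T) \sum_(i <- I t) a i <= 1.
Proof.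
have [_ _ a1 _] := aE; rewrite -a1.
apply: (@le_trans _ _ (\sum_(i <- ER) a i)); last first.
  by rewrite big_filter big_mkcond; apply: ler_sum => i _; case: ifP.
under eq_bigr => t _ do rewrite /I big_filter big_mkcond.
rewrite exchange_big /= big_seq [leRHS]big_seq; apply: ler_sum => i iER.
apply: sum_at_most_one => //; first exact: schreier_items_uniq.
  by move=> t _; case: ifP.
move=> t t' tT t'T; case: ifPn => [h|]; last by rewrite eqxx.
by case: ifPn => [h' _ _|]; [exact: hit_unique h h'|rewrite eqxx].
Qed.

Let ERE i : i \in ER -> i \in E.
Proof. by rewrite mem_filter => /andP[]. Qed.

Let pr_T t top : t \in T -> (forall j, j \in I t -> a j <= top) -> 0 <= top ->
  `|pr N (ivec t) (comb y (I t) a)| <= s%:R^-1 * \sum_(i <- I t) a i + top.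
Proof.
move=> tT htop top0; have [hgood _ _] := hT; have [tavg _] := hgood t tT.
have uI : uniq (I t) by rewrite !filter_uniq // (sorted_uniq ltn_trans ltnn).
have IE i : i \in I t -> i \in E by rewrite mem_filter => /andP[_ /ERE].
apply: le_trans (avg_pr_le tavg uI _ top0 _ _) _ => [k l _ _|k kI|f k fW kI|].
- exact: (block_blk hy).
- by rewrite a0 htop.
- apply: le_trans (y1 (IE _ kI)); apply: Wnorm_ub => //.
  by apply: (supp_below_widen (@block_below _ _ _ hy)); exact: EN (IE _ kI).
- rewrite lerD2r ler_wpM2r ?sumr_ge0 // lef_pV2 ?posrE ?ltr0n ?ler_nat ?sT //.
  exact: leq_trans (sT tT).
Qed.

Let sum_top top : (forall t, I t != [::] -> top t \in I t) ->
  \sum_(t <- T') a (top t) <= 2 * eps.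
Proof.
move=> htop; have [hgood hp _] := hT.
have T'P t : t \in T' -> [/\ t \in T, top t \in ER & hitT t (top t)].
  by rewrite mem_filter => /andP[/htop]; rewrite mem_filter => /andP[? ?] ?.
have subT : subseq T' T by exact: filter_subseq.
have lt t t' : t \in T' -> t' \in T' -> before t t' -> (top t < top t')%N.
  move=> /T'P[tT tR th] /T'P[t'T t'R t'h] b; rewrite ltnNge leq_eqVlt.
  apply/negP => /orP[/eqP e|lt'].
    by apply: (hit_before t'T b tR th); rewrite -e.
  move/beforeP: b => [hb _ _].
  move: th t'h => /asboolP[k [tk yk]] /asboolP[k' [tk' yk']].
  by have := ltn_trans (hb _ _ tk tk') (block_blk hy lt' yk' yk); rewrite ltnn.
have pT : pairwise (relpre top ltn) T'.
  apply: (sub_in_pairwise (P := mem T')) (subseq_pairwise subT hp); last exact/seq.allP.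
  by move=> t t'; exact: lt.
have TE t : t \in T' -> top t \in E by move=> /T'P[_ /ERE].
rewrite -(big_map top predT a); apply: special_pS.
- by move=> _ /mapP[t /TE h ->].
- by rewrite (sorted_pairwise ltn_trans) pairwise_map.
- rewrite -map_comp; apply: (reg_spread_map (scale_H GH m) (mu := imin) HT).
  + move=> t tT'; have [tT _ /asboolP[k [tk yk]]] := T'P _ tT'; split; first exact: map_f.
    have [_ [_ h]] := hgood t tT; apply: leq_trans (h _ tk) _.
    by have /andP[_ h'] := block_supp hy yk; exact: ltnW.
  + exact: subseq_pairwise subT (before_imin hgood hp).
  + apply: (sub_in_pairwise (P := mem T')) pT; last exact/seq.allP.
    by move=> t t' /TE tE /TE t'E; exact: pS_mono.
Qed.

(** Vectors in whose interval some average starts have total mass at most [2 * eps], since the ends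
    of these intervals spread the set of minima. Any other vector meets at most one average, so
    averages of size at least [s] give 1/s in total, plus the largest coefficient met by each of
    them. These largest coefficients, one per average, again sit on a spread of the minima and cost
    another [2 * eps]. *)
Lemma special_small : `|pr N (isum T) (comb y E a)| <= 4 * eps + s%:R^-1.
Proof.
have yN i : i \in E -> supp_below (y i) N.
  by move=> iE; apply: (supp_below_widen (@block_below _ _ _ hy)); exact: EN iE.
rewrite pr_comb (bigID start) /= -big_filter -[X in _ + X]big_filter -/EF -/ER.
have hEF : `|\sum_(i <- EF) a i * pr N (isum T) (y i)| <= 2 * eps.
  apply: le_trans (ler_norm_sum _ _ _) _; apply: le_trans sum_EF.
  rewrite big_seq [leRHS]big_seq; apply: ler_sum => i; rewrite mem_filter => /andP[_ iE].
  rewrite normrM ger0_norm // ler_piMr //.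
  by apply: le_trans (y1 iE); apply: (isum_ub hT); exact: yN.
have -> : \sum_(i <- ER) a i * pr N (isum T) (y i) =
    \sum_(t <- T) pr N (ivec t) (comb y (I t) a).
  under [RHS]eq_bigr => t _ do rewrite pr_comb big_filter big_mkcond.
  rewrite exchange_big /=; apply: eq_bigr => i _.
  rewrite /isum pr_vsum big_map mulr_sumr; apply: eq_bigr => t _.
  by case: ifPn => // /pr_nohit->; rewrite mulr0.
have [top htop] : {top : item R -> nat & forall t, I t != [::] ->
    top t \in I t /\ forall j, j \in I t -> a j <= a (top t)}.
  apply: (choice (P := fun t i => I t != [::] -> i \in I t /\ forall j, j \in I t -> a j <= a i)).
  move=> t; case: (eqVneq (I t) [::]) => [_|/(seq_argmax a)[i h1 h2]]; first by exists 0%N.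
  by exists i.
apply: le_trans (ler_normD _ _) _.
suff : `|\sum_(t <- T) pr N (ivec t) (comb y (I t) a)| <= s%:R^-1 + 2 * eps by move: hEF; lra.
apply: le_trans (ler_norm_sum _ _ _) _.
apply: (@le_trans _ _ (\sum_(t <- T) (s%:R^-1 * \sum_(i <- I t) a i +
    (if I t != [::] then a (top t) else 0)))).
  rewrite big_seq [leRHS]big_seq; apply: ler_sum => t tT; case: ifPn => [h|/negbNE/eqP h].
    by apply: pr_T => //; case: (htop _ h).
  by apply: pr_T => // j; rewrite h.
rewrite big_split /= -mulr_sumr -big_mkcond /= lerD //.
  by rewrite ler_piMr ?invr_ge0.
by rewrite -big_filter; apply: sum_top => t /htop[].
Qed.

End SpecialSmall.
End Blocks.

(** * Lower l_1 estimates *)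

Section Reduction.
Variables (R : realType) (G : fam) (H : nat -> fam).
Hypothesis GH : family_scale R G H.
Implicit Types (x y v w : nat -> vec R) (p : nat -> nat) (D : nat -> seq nat)
  (q : vec R -> R) (c : nat -> nat -> R).

(** Admissibility of unions is recorded as a property of [D] and not through a function [phi],
    because it then survives moving [D] by an increasing map. [b] depends on [k] alone, while [N']
    allows the union to start arbitrarily late. *)
Record stacked (a : nat) D : Prop := Stacked {
  stacked_neq0 : forall j, D j != [::];
  stacked_H : forall j, H a (D j);
  stacked_lt : forall i j, (i < j)%N -> setlt (D i) (D j);
  stacked_flatten : forall k, exists b, forall N', exists N, forall E, H k E ->
    le_min N E -> H b (flatten (map D E)) /\ le_min N' (flatten (map D E)) }.

Lemma map_setlt D E : (forall i j, (i < j)%N -> setlt (D i) (D j)) -> sorted ltn E ->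
  pairwise setlt (map D E).
Proof.
move=> hD; rewrite (sorted_pairwise ltn_trans) pairwise_map => /sub_pairwise; apply.
exact: hD.
Qed.

Lemma stack_exists a : exists phi : nat -> nat, (forall j, (j <= phi j)%N) /\ forall D,
  (forall j, D j != [::]) -> (forall j, H a (D j)) ->
  (forall i j, (i < j)%N -> setlt (D i) (D j)) -> (forall j, le_min (phi j) (D j)) ->
  stacked a D.
Proof.
have [phi [hid hphi]] := scale_flatten GH a.
exists phi; split=> // D D0 DH Dlt Dphi; split=> // k.
have [b [N hN]] := hphi k; exists b => N'; exists (maxn N N') => E HE hE; split.
  apply: hN => //; first by apply: le_min_trans hE; exact: leq_maxl.
  by apply: map_setlt => //; exact: (reg_sorted (scale_H GH k)) HE.
apply/le_minP => i /flattenP[_ /mapP[j jE ->] ij].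
have /le_minP/(_ _ ij) := Dphi j; apply: leq_trans; apply: leq_trans (hid j).
by move/le_minP: hE => /(_ j jE); apply: leq_trans; exact: leq_maxr.
Qed.

Lemma stacked_G a D : stacked a D -> forall k, exists N, forall E, H k E ->
  le_min N E -> G (flatten (map D E)).
Proof.
move=> hD k; have [b /(_ b.+1)[N hN]] := stacked_flatten hD k.
by exists N => E HE /(hN E HE)[h1 h2]; apply/(scale_GE GH); exists b.
Qed.

(** [g] recovers the block from the position, so that coefficients indexed by block and position
    become one function of the position. *)
Lemma setlt_glue D : (forall i j, (i < j)%N -> setlt (D i) (D j)) ->
  exists g : nat -> nat, forall j i, i \in D j -> g i = j.
Proof.
move=> hD; suff /choice[g hg] : forall i, exists j, forall k, i \in D k -> j = k.
  by exists g => j i; exact: hg.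
move=> i; have [[j ij]|h] := pselect (exists j, i \in D j); last first.
  by exists 0%N => k ik; case: h; exists k.
exists j => k ik; case: (ltngtP j k) => // jk.
  by have /setltP/(_ _ _ ij ik) := hD _ _ jk; rewrite ltnn.
by have /setltP/(_ _ _ ik ij) := hD _ _ jk; rewrite ltnn.
Qed.

Lemma comb_flatten x w D c E b (g : nat -> nat) : (forall j i, i \in D j -> g i = j) ->
  (forall j, w j = comb x (D j) (c j)) ->
  comb w E b = comb x (flatten (map D E)) (fun i => b (g i) * c (g i) i) /\
  \sum_(i <- flatten (map D E)) `|b (g i) * c (g i) i| =
    \sum_(j <- E) `|b j| * \sum_(i <- D j) `|c j i|.
Proof.
move=> hg hw; split.
  apply/funext => n; rewrite /comb big_flatten big_map; apply: eq_bigr => j _.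
  rewrite hw /comb mulr_sumr big_seq [RHS]big_seq; apply: eq_bigr => i ij.
  by rewrite (hg j i ij) mulrA.
rewrite big_flatten big_map; apply: eq_bigr => j _.
rewrite mulr_sumr big_seq [RHS]big_seq; apply: eq_bigr => i ij.
by rewrite (hg j i ij) normrM.
Qed.

(* [x] is an l_1^(omega^xi) sequence with constant [d] for [q], up to the usual
   passage to tails. *)
Definition lower1 q x (d : R) := forall k, exists N, forall E b, H k E -> le_min N E ->
  d * \sum_(i <- E) `|b i| <= q (comb x E b).

(** A set of blocks flattens to a set of the original indices at a higher level still below
    omega^xi; the constant is kept because each block has l_1-normalized coefficients. *)
Lemma lower1_blocks q x w D c a d : lower1 q x d -> stacked a D ->
  (forall j, w j = comb x (D j) (c j)) -> (forall j, \sum_(i <- D j) `|c j i| = 1) ->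
  lower1 q w d.
Proof.
move=> hx hD hw hc k; have [b' hb] := stacked_flatten hD k.
have [N' hN'] := hx b'; have [N hN] := hb N'; exists N => E b HE hE.
have [g hg] := setlt_glue (stacked_lt hD).
have [-> h2] := comb_flatten E b hg hw.
have -> : \sum_(i <- E) `|b i| = \sum_(i <- flatten (map D E)) `|b (g i) * c (g i) i|.
  by rewrite h2; apply: eq_bigr => j _; rewrite hc mulr1.
by have [h3 h4] := hN E HE hE; exact: hN'.
Qed.

Definition homogeneous q x := forall (t : R) E b,
  q (fun i => t * comb x E b i) = `|t| * q (comb x E b).

Lemma lower1_scale q x w d (t : R) : homogeneous q x -> 0 <= t ->
  (forall j, w j = fun i => t * x j i) -> lower1 q x d -> lower1 q w (t * d).
Proof.
move=> hq t0 hw hx k; have [N hN] := hx k; exists N => E b HE hE.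
have -> : comb w E b = fun i => t * comb x E b i.
  apply/funext => n; rewrite /comb mulr_sumr; apply: eq_bigr => i _.
  by rewrite hw mulrCA.
by rewrite hq ger0_norm // -mulrA ler_wpM2l // hN.
Qed.

Lemma lower1_le q x d d' : d' <= d -> lower1 q x d -> lower1 q x d'.
Proof.
move=> dd hx k; have [N hN] := hx k; exists N => E b HE hE.
by apply: le_trans (hN E b HE hE); rewrite ler_wpM2r ?sumr_ge0.
Qed.

Lemma comb1 x i : comb x [:: i] (fun _ => 1) = x i.
Proof. by apply/funext => n; rewrite /comb big_cons big_nil mul1r addr0. Qed.

Lemma lower1_ub q x d K : (forall i, q (x i) <= K) -> lower1 q x d -> d <= K.
Proof.
move=> hK hx; have [N hN] := hx 0%N.
apply: le_trans (hK N.+1); rewrite -comb1.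
have := hN [:: N.+1] (fun _ => 1) (reg_single (scale_H GH 0%N) (ltn0Sn _)).
rewrite big_cons big_nil normr1 addr0 mulr1; apply.
by rewrite /le_min /= leqnSn.
Qed.

(* James' argument: blocks that nearly attain the best l_1 constant of [x] have
   an l_1 constant comparable to their norm. *)
Lemma james q x K d : homogeneous q x -> (forall i, q (x i) <= K) -> 0 < d ->
  lower1 q x d -> exists lam a D c,
  [/\ 0 < lam, stacked a D, forall j, \sum_(i <- D j) `|c j i| = 1,
      forall j, q (comb x (D j) (c j)) <= 2 * lam & lower1 q x lam].
Proof.
move=> hq hK d0 hd; pose A : set R := [set d' | lower1 q x d']%classic.
have supA : has_sup A.
  by split; [exists d | exists K => d' /(lower1_ub hK)].
have As0 : 0 < sup A.
  by apply: lt_le_trans d0 _; apply: ub_le_sup => //; case: supA.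
have [lam hlam slam] := sup_adherent (divr_gt0 As0 (ltr0Sn R 1)) supA.
have lam0 : 0 < lam by move: slam As0; lra.
(* As [2 * lam] exceeds the supremum, the estimate fails at one fixed level [k] beyond every
   threshold; the failing combinations, normalized in l_1, become the blocks. *)
have /existsNP[k hk] : ~ lower1 q x (2 * lam).
  move=> h; have : 2 * lam <= sup A by apply: ub_le_sup => //; case: supA.
  by move: slam; lra.
have step N : exists X : seq nat * (nat -> R), [/\ X.1 != [::], H k X.1, le_min N X.1,
    \sum_(i <- X.1) `|X.2 i| = 1 & q (comb x X.1 X.2) <= 2 * lam].
  move/forallNP: hk => /(_ N)/existsNP[E /existsNP[b /not_implyP[HE /not_implyP[hE /negP]]]].
  rewrite -ltNge => hlt.
  have s0 : 0 <= \sum_(i <- E) `|b i| by apply: sumr_ge0.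
  have sn0 : \sum_(i <- E) `|b i| != 0.
    apply: contraTneq hlt => s00; rewrite s00 mulr0.
    have -> : comb x E b = fun i => 0 * comb x E b i.
      apply/funext => n; rewrite mul0r /comb big_seq big1 // => i iE.
      have /eqP := s00; rewrite psumr_eq0 // => /seq.allP/(_ i iE).
      by rewrite normr_eq0 => /eqP ->; rewrite mul0r.
    by rewrite hq normr0 mul0r ltxx.
  have sp : 0 < \sum_(i <- E) `|b i| by rewrite lt_neqAle eq_sym sn0.
  set s := \sum_(i <- E) `|b i| in hlt s0 sn0 sp *.
  exists (E, fun i => s^-1 * b i); split=> //=.
  - by apply: contraNneq sn0 => E0; rewrite /s E0 big_nil.
  - under eq_bigr => i _ do rewrite normrM ger0_norm ?invr_ge0 //.
    by rewrite -mulr_sumr mulVf.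
  - have -> : comb x E (fun i => s^-1 * b i) = fun i => s^-1 * comb x E b i.
      apply/funext => n; rewrite /comb mulr_sumr; apply: eq_bigr => i _.
      by rewrite mulrA.
    by rewrite hq ger0_norm ?invr_ge0 // ler_pdivrMl // mulrC ltW.
have [phi [_ hphi]] := stack_exists k.
have [f [n [h1 h2 h3 _]]] := chain_choice
  (fun X : seq nat * (nat -> R) => (\max_(i <- X.1) i).+1) phi step.
exists lam, k, (fun j => (f j).1), (fun j => (f j).2); split=> //.
- apply: hphi => j; try by case: (h1 j).
    move=> j' jj; apply/setltP => i i' ij ij'.
    have [_ _ /le_minP/(_ _ ij') h4 _ _] := h1 j'.
    apply: leq_trans h4; apply: leq_trans (h3 _ _ jj); rewrite ltnS.
    exact: (leq_bigmax_seq (F := id)).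
  by have [_ _ h4 _ _] := h1 j; exact: le_min_trans h4.
- by move=> j; case: (h1 j).
- by move=> j; case: (h1 j).
Qed.

Lemma block_blocks p x D c a w : block_seq p x -> stacked a D ->
  (forall j, w j = comb x (D j) (c j)) -> block_seq (fun j => p (head 0%N (D j))) w.
Proof.
move=> hx hD hw.
have hd j : head 0%N (D j) \in D j.
  by case: (mem_head_last (stacked_neq0 hD j)).
have hlt i j : (i < j)%N -> (head 0 (D i) < head 0 (D j))%N.
  by move=> ij; have /setltP := stacked_lt hD ij; apply.
split.
- move=> i j; rewrite leq_eqVlt => /orP[/eqP -> //|/hlt/ltnW]; exact: (block_le hx).
- move=> i; apply: leq_trans (block_id hx _).
  by elim: i => // i IH; apply: leq_ltn_trans IH (hlt _ _ (ltnSn i)).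
- move=> j n; rewrite hw /comb => wn.
  have : has (fun i => x i n != 0) (D j).
    apply: contraNT wn => /hasPn h; rewrite big_seq big1 // => i /h/negbNE/eqP ->.
    by rewrite mulr0.
  move=> /hasP[i iD /(block_supp hx)/andP[h1 h2]]; apply/andP; split.
    apply: leq_trans h1; apply: (block_le hx).
    exact: sorted_ge_head (reg_sorted (scale_H GH a) (stacked_H hD j)) iD.
  apply: leq_trans h2 _; apply: (block_le hx).
  by have /setltP := stacked_lt hD (ltnSn j); apply.
Qed.

Lemma Wnorm_homogeneous p x : block_seq p x -> homogeneous (Wnorm G) x.
Proof.
move=> hx t E b; apply: (@WnormZ _ _ (\max_(i <- E) p i.+1)).
by apply: (block_comb_below _ hx) => i iE; exact: (leq_bigmax_seq (F := fun i => p i.+1)).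
Qed.

(** With signs adapted to the coefficients, the functionals [isum (T j)] join along [E] into one
    admissible very fast growing sequence, hence into an element of W. *)
Lemma lower1_of_items p x (T : nat -> seq (item R)) d :
  block_seq p x -> (forall j t, t \in T j -> good (inW G) t) ->
  (forall j, pairwise before (T j)) ->
  (forall j t i, t \in T j -> ivec t i != 0 -> (p j <= i < p j.+1)%N) ->
  (forall j k t t', (j < k)%N -> t \in T j -> t' \in T k ->
     (isize t < isize t')%N /\ forall i, ivec t i != 0 -> (i < isize t')%N) ->
  (forall k, exists N, forall E, H k E -> le_min N E ->
     G (flatten (map (fun j => map imin (T j)) E))) ->
  (forall j, d <= `|pr (p j.+1) (isum (T j)) (x j)|) ->
  lower1 (Wnorm G) x d.
Proof.
move=> hx hgood hbef hsupp hsize hG hd k; have [N hN] := hG k.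
exists N => E b HE hE.
pose P := \max_(i <- E) p i.+1.
have EP i : i \in E -> (p i.+1 <= P)%N.
  by move=> iE; exact: (leq_bigmax_seq (F := fun i => p i.+1)).
pose Tn j := if 0 <= b j * pr P (isum (T j)) (x j) then T j else map nitem (T j).
have Tn_nitem (Q : item R -> Prop) j : (forall t, Q t -> Q (nitem t)) ->
    (forall t, t \in T j -> Q t) -> forall t, t \in Tn j -> Q t.
  move=> QN hQ t; rewrite /Tn; case: ifP => _; first exact: hQ.
  by move=> /mapP[s sT ->]; apply/QN/hQ.
have hbT j l t t' : (j < l)%N -> t \in T j -> t' \in T l -> before t t'.
  move=> jl tT t'T; apply/beforeP; have [h1 h2] := hsize _ _ _ _ jl tT t'T; split=> //.
  move=> i i' /(hsupp _ _ _ tT)/andP[_ h3] /(hsupp _ _ _ t'T)/andP[h4 _].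
  by apply: leq_trans h3 (leq_trans _ h4); exact: block_le hx _ _ jl.
have sE := reg_sorted (scale_H GH k) HE.
pose TT := flatten (map Tn E).
have sT : schreier_items G TT.
  split.
  - move=> t /flattenP[_ /mapP[j jE ->]]; apply: Tn_nitem; last exact: hgood.
    by move=> s; apply: good_nitem => f; exact: inWN.
  - rewrite /TT; elim: (E) sE => //= j E' IH sE'; rewrite pairwise_cat.
    rewrite (IH (path_sorted sE')) andbT; apply/andP; split; last first.
      rewrite /Tn; case: ifP => _ //; rewrite pairwise_map.
      by apply: sub_pairwise (hbef j) => t s; rewrite /= before_nitem.
    apply/allrelP => t t' tT /flattenP[_ /mapP[l lE ->] t'T].
    have jl : (j < l)%N by have /seq.allP/(_ _ lE) := order_path_min ltn_trans sE'.
    have tb s s' : s \in T j -> s' \in T l ->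
        [&& before s s', before (nitem s) s', before s (nitem s') & before (nitem s) (nitem s')].
      move=> sT s'T; have h := hbT _ _ _ _ jl sT s'T.
      rewrite before_nitem h /=.
      have [h1 h2 h3] := elimT (beforeP _ _) h.
      apply/andP; split; [apply/beforeP; split=> //= i|rewrite andbT; apply/beforeP; split=> //].
      + by move=> i' ; rewrite oppr_eq0; exact: h1.
      + by rewrite oppr_eq0; exact: h3.
      + by move=> i i' hi; rewrite oppr_eq0; exact: h1.
    move: tT t'T; rewrite /Tn; case: ifP => _; case: ifP => _.
    + by move=> h h'; case/and4P: (tb _ _ h h').
    + by move=> h /mapP[s' h' ->]; case/and4P: (tb _ _ h h').
    + by move=> /mapP[s h ->] h'; case/and4P: (tb _ _ h h').
    + by move=> /mapP[s h ->] /mapP[s' h' ->]; case/and4P: (tb _ _ h h').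
  - have -> : map imin TT = flatten (map (fun j => map imin (T j)) E).
      rewrite /TT; elim: (E) => //= j E' IH; rewrite map_cat IH; congr (_ ++ _).
      by rewrite /Tn; case: ifP => // _; rewrite -map_comp.
    exact: hN.
have xP : supp_below (comb x E b) P by exact: block_comb_below hx EP.
apply: le_trans (isum_ub sT xP); apply: le_trans (ler_norm _).
rewrite pr_comb mulr_sumr big_seq [leRHS]big_seq; apply: ler_sum => i iE.
have vanish j : j != i -> pr P (isum (Tn j)) (x i) = 0.
  move=> ji; rewrite /isum pr_vsum big_map big_seq big1 // => t tT.
  apply: pr_nohit; apply/asboolPn => -[n [tn xn]].
  have : (p j <= n < p j.+1)%N.
    apply: (Tn_nitem (fun t => ivec t n != 0 -> (p j <= n < p j.+1)%N) j _ _ t) => //.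
      by move=> s; rewrite /ivec /= oppr_eq0.
    by move=> s sT'; exact: hsupp sT'.
  move: (block_supp hx xn) => /andP[h1 h2] /andP[h3 h4].
  case: (ltngtP j i) ji => // ji _.
    by have := leq_trans h4 (leq_trans (block_le hx ji) h1); rewrite ltnn.
  by have := leq_trans h2 (leq_trans (block_le hx ji) h3); rewrite ltnn.
have -> : pr P (isum TT) (x i) = pr P (isum (Tn i)) (x i).
  rewrite /isum !pr_vsum !big_map /TT big_flatten big_map.
  have uE := sorted_uniq ltn_trans ltnn sE.
  rewrite (bigD1_seq i) //= [X in _ + X]big1 ?addr0 // => j ji.
  by have := vanish j ji; rewrite /isum pr_vsum big_map.
have hdi : d <= `|pr P (isum (T i)) (x i)|.
  by rewrite (pr_widen _ (@block_below _ _ _ i hx) (EP i iE)).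
have -> : b i * pr P (isum (Tn i)) (x i) = `|b i| * `|pr P (isum (T i)) (x i)|.
  rewrite /Tn -normrM; case: ifPn => [h|]; first by rewrite ger0_norm.
  by rewrite -ltNge => h; rewrite isumN prNl mulrN ltr0_norm.
by rewrite mulrC ler_wpM2l.
Qed.

(** A nearly norming functional is cut down to the support of [x i]; [0 <= r] guarantees that
    something nonzero remains. *)
Lemma norming_functional p x i (r : R) : block_seq p x -> 0 <= r -> r < Wnorm G (x i) ->
  exists f, [/\ inW G f, forall k, f k != 0 -> x i k != 0 &
    r < pr (p i.+1) f (x i)].
Proof.
move=> hx r0 hr; have [f [fW hf]] := Wnorm_near (@block_below _ _ _ i hx) hr.
pose A : pred nat := fun k => x i k != 0.
have e1 : pr (p i.+1) (restr A f) (x i) = pr (p i.+1) f (x i).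
  apply: eq_bigr => k _; rewrite /restr; case: ifPn => //.
  by move/negbNE/eqP => ->; rewrite !mulr0.
exists (restr A f); split; rewrite ?e1 //.
- apply: inW_restr (scale_G GH) _ _ fW _; apply: contraTneq hf => f0.
  rewrite -e1 f0 -leNgt /pr big1 // => k _; exact: mul0r.
- by move=> k; rewrite /restr; case: ifP; rewrite ?eqxx.
Qed.

Lemma norming_sum p x n P (r : R) : block_seq p x -> (p n <= P)%N -> 0 <= r ->
  (forall k, (k < n)%N -> r < Wnorm G (x k)) ->
  exists fs : seq (nat -> R), [/\ size fs = n, forall f, f \in fs -> inW G f, pairwise blkb fs,
    forall f, f \in fs -> exists2 k, (k < n)%N & forall i, f i != 0 -> x k i != 0 &
    n%:R * r <= pr P (vsum fs) (comb x (iota 0 n) (fun _ => 1))].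
Proof.
move=> hx nP r0 hr.
pose Q k f := (k < n)%N -> [/\ inW G f,
    forall i, f i != 0 -> x k i != 0 & r < pr (p k.+1) f (x k)].
have [F hF] : {F : nat -> vec R & forall k, Q k (F k)}.
  apply: (choice (P := Q)) => k; rewrite /Q.
  have [kn|kn] := boolP (k < n)%N; last by exists (vzero R).
  by have [f hf] := norming_functional hx r0 (hr k kn); exists f.
have blkF i j : (i < j)%N -> (j < n)%N -> blk (F i) (F j).
  move=> ij jn k l; have [_ h1 _] := hF i (ltn_trans ij jn); have [_ h2 _] := hF j jn.
  by move=> /h1 k1 /h2; exact: (block_blk hx ij).
exists (mkseq F n); split.
- by rewrite size_mkseq.
- by move=> f /mapP[k]; rewrite mem_iota add0n => /andP[_ kn] ->; case: (hF k kn).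
- rewrite pairwise_map; apply/(pairwiseP 0%N) => i j; rewrite !inE size_iota => ik jk ij.
  by rewrite !nth_iota // !add0n; exact: blkF.
- move=> f /mapP[k]; rewrite mem_iota add0n => /andP[_ kn] ->; exists k => //.
  by case: (hF k kn).
- rewrite pr_vsum big_map.
  have -> : n%:R * r = \sum_(k <- iota 0 n) r.
    by rewrite big_const_seq count_predT size_iota iter_addr_0 mulr_natl.
  rewrite big_seq [leRHS]big_seq; apply: ler_sum => k.
  rewrite mem_iota add0n => /andP[_ kn]; have [_ h1 h2] := hF k kn.
  rewrite pr_comb (bigD1_seq k) ?iota_uniq ?mem_iota //= mul1r.
  rewrite (pr_widen _ (@block_below _ _ _ k hx) (leq_trans (block_le hx kn) nP)).
  rewrite [X in _ + X]big1 ?addr0 ?ltW // => l lk.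
  rewrite mul1r; apply: pr_nohit; apply/asboolPn => -[i [/h1/(block_supp hx)/andP[i1 i2] /(block_supp hx)/andP[i3 i4]]].
  case: (ltngtP l k) lk => // kl _.
    by have := leq_trans i4 (leq_trans (block_le hx kl) i1); rewrite ltnn.
  by have := leq_trans i2 (leq_trans (block_le hx kl) i3); rewrite ltnn.
Qed.

End Reduction.

(** * The dichotomy that yields blocks with a universal l_1 constant *)

Section MainReduction.
Variables (R : realType) (G : fam) (H : nat -> fam).
Hypothesis GH : family_scale R G H.
Variables (p : nat -> nat) (x : nat -> vec R).
Hypothesis hx : block_seq p x.
Hypothesis x1 : forall i, Wnorm G (x i) <= 1.
Hypothesis x_normal : forall i, (0 < i)%N -> Wnorm G (x i) = 1.

Definition tame := forall m (eps : R), 0 < eps -> exists s I : nat, forall i, (I <= i)%N ->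
  forall T, schreier_items G T -> H m (map imin T) ->
  (forall t : item R, t \in T -> (s <= isize t)%N) -> `|pr (p i.+1) (isum T) (x i)| <= eps.

(** 1/10 comes from the tame case: blocks of norm at most 5 on which an average takes a value of at
    least 1/2, divided by 5. The wild case even gives 1/2. *)
Definition good_blocks := exists a D c,
  [/\ stacked H a D, forall j, Wnorm G (comb x (D j) (c j)) <= 1 &
      lower1 H (Wnorm G) (fun j => comb x (D j) (c j)) (1 / 10)].

(* A tame sequence behaves like c_0 on finite sets chosen far out, so the sum of
   a long block has norm at most 5 but is normed by an average of large size. *)
Lemma tame_sum : tame -> forall N, exists X : seq nat * item R,
  [/\ X.1 != [::], sorted ltn X.1, le_min (maxn N (size X.1)) X.1,
      Wnorm G (comb x X.1 (fun _ => 1)) <= 5 &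
  [/\ good (inW G) X.2, (N <= isize X.2)%N,
      forall i, ivec X.2 i != 0 -> exists2 k, k \in X.1 & (p k <= i < p k.+1)%N &
      1 / 2 <= pr (p (last 0%N X.1).+1) (ivec X.2) (comb x X.1 (fun _ => 1))]].
Proof.
(* [n] is both the number of vectors summed and the size of the average that norms them; sizes of
   averages are at least 2. *)
move=> ht N; pose n := maxn N 2.
have n2 : (2 <= n)%N by exact: leq_maxr.
have n0 : (0 < n)%N by exact: ltnW.
have nR : 0 < n%:R :> R by rewrite ltr0n.
pose eps : R := (2 * n%:R)^-1.
have eps0 : 0 < eps by rewrite invr_gt0 mulr_gt0.
have [s /choice[I hI]] := choice (fun m => ht m eps eps0).
(* The levels to be controlled are [p (f k0).+1], known only once [f k0] is chosen, but at most the
   next threshold. So each index is taken beyond what tameness requires at all levels up to its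
   threshold. *)
have step N' : exists i, (N' <= i)%N /\ forall m, (m <= N')%N -> (s m <= i)%N /\ (I m <= i)%N.
  exists (N' + \sum_(m < N'.+1) (s m + I m))%N; split; first exact: leq_addr.
  move=> m; rewrite -ltnS => mN.
  rewrite (bigD1 (Ordinal mN)) //=; split; lia.
have [f [l [h1 h2 h3 h4]]] := chain_choice (fun i => p i.+1) (fun _ => n) step.
have fl k : (l k <= f k)%N by case: (h1 k).
have pf k : (p (f k).+1 <= f k.+1)%N by apply: leq_trans (h3 _ _ (ltnSn k)) (fl _).
have fn k : (n <= f k)%N by exact: leq_trans (h2 k) (fl k).
pose v k := x (f k).
have fS k : (f k < f k.+1)%N.
  by apply: leq_trans (pf k); apply: leq_trans (block_id hx _) _.
have hv : block_seq (p \o f) v.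
  split.
  - apply: (homo_leq leqnn leq_trans) => k /=; apply: (block_le hx); exact: ltnW.
  - move=> k /=; apply: leq_trans (block_id hx _).
    by elim: k => // k IH; apply: leq_ltn_trans IH (fS k).
  - move=> k i /(block_supp hx)/andP[-> h5] /=; apply: leq_trans h5 _.
    exact: (block_le hx).
pose P := p (f n.-1).+1.
have vP k : (k < n)%N -> (p (f k).+1 <= P)%N.
  move=> kn; apply: (block_le hx); rewrite ltnS.
  by apply: (homo_leq leqnn leq_trans (fun k => ltnW (fS k))); rewrite -ltnS prednK.
pose A := map f (iota 0 n).
have combA : comb x A (fun _ => 1) = comb v (iota 0 n) (fun _ => 1).
  by apply/funext => i; rewrite /comb big_map.
have sA : sorted ltn A.
  rewrite (sorted_pairwise ltn_trans) pairwise_map.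
  have : pairwise ltn (iota 0 n) by rewrite -(sorted_pairwise ltn_trans) iota_ltn_sorted.
  by apply: sub_pairwise => i j; exact: (homo_ltn ltn_trans fS).
have lastA : last 0%N A = f n.-1.
  rewrite /A -nth_last size_map size_iota (nth_map 0%N) ?size_iota ?prednK //.
  by rewrite nth_iota ?prednK.
have vn k : (k < n)%N -> 1 / 2 < Wnorm G (v k).
  move=> kn; rewrite /v x_normal; last by apply: leq_trans (fn k).
  by lra.
have r0 : 0 <= 1 / 2 :> R by lra.
have [fs [sz hW hb hsupp hge]] := norming_sum GH hv (leqnn _) r0 vn.
pose al : vec R := fun i => n%:R^-1 * vsum fs i.
have al_avg : is_avg (inW G) n al by apply/is_avgP; exists fs; rewrite sz n0 leqnn.
have xAP : supp_below (comb x A (fun _ => 1)) P.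
  apply: (block_comb_below _ hx) => i /mapP[k]; rewrite mem_iota add0n => /andP[_ kn] ->.
  exact: vP.
have alA : 1 / 2 <= pr P al (comb x A (fun _ => 1)).
  rewrite prZl ler_pdivlMl // combA; apply: le_trans hge _.
  rewrite (pr_widen (N := P)) // -?combA //=.
  by have := pf n.-1; rewrite prednK // => h; apply: leq_trans h (block_id hx _).
have al0 : exists i, al i != 0.
  apply: contrapT => /forallNP h; move: alA; rewrite /pr big1; first lra.
  by move=> i _; have /negP := h i; rewrite negbK => /eqP ->; rewrite mul0r.
exists (A, (al, n, msupp al)); split=> //=; rewrite ?lastA.
- by rewrite -size_eq0 size_map size_iota -lt0n.
- apply/le_minP => i /mapP[k _ ->]; rewrite size_map size_iota.
  by apply: leq_trans (fn k); rewrite geq_max leqnn leq_maxl.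
- rewrite combA; apply: (@sum_upper_estimate R G H GH n v (p \o f) (fun k => p (f k).+1) P eps)
    => //.
  + move=> k i _ /(block_supp hx)/andP[-> ->] //.
  + move=> k _ /=; rewrite (block_le hx (leqnSn _)) /=; apply: (block_le hx); exact: fS.
  + by move=> k kn; apply: supp_below_widen (@block_below _ _ _ (f k) hx) (vP k kn).
  + by apply: leq_trans (fn 0%N) (block_id hx _).
  + by move=> k _; exact: x1.
  + exact: ltW.
  + by rewrite divff // mulf_neq0 // gt_eqF.
  + move=> k0 k T /andP[k0k kn] hT HT sT.
    rewrite (pr_widen _ (@block_below _ _ _ (f k) hx) (vP k kn)).
    have m1 : (p (f k0).+1 <= l k0.+1)%N by exact: h3.
    have [_ /(_ _ m1)[s1 _]] := h1 k0.+1.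
    have [_ /(_ _ (leq_trans m1 (h4 _ _ k0k)))[_ I1]] := h1 k.
    apply: (hI _ _ I1) => // t /sT; apply: leq_trans; apply: leq_trans s1 _.
    exact: leq_trans (block_id hx _).
  + exact: iota_ltn_sorted.
  + by move=> k; rewrite mem_iota add0n => /andP[].
- split=> //.
  + by split=> //; exact: msuppP.
  + exact: leq_maxl.
  + move=> i; rewrite /ivec /= /al => ali.
    have : has (fun g : nat -> R => g i != 0) fs.
      apply: contraNT ali => /hasPn h; rewrite /vsum big_seq big1 ?mulr0 // => g /h.
      by move/negbNE/eqP.
    move=> /hasP[g gfs gi]; have [k kn hk] := hsupp g gfs.
    exists (f k); first by apply: map_f; rewrite mem_iota.
    exact/(block_supp hx)/hk.
Qed.

Lemma tame_good_blocks : tame -> good_blocks.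
Proof.
move=> ht; have [a [N0 hN0]] := scale_schreier GH.
have [phi [_ hphi]] := stack_exists GH a.
(* Covers the indices of the block, the size of its average and the end of its support; the next
   average then satisfies the growth condition. *)
pose bd (X : seq nat * item R) := maxn (\max_(i <- X.1) i).+1
  (maxn (isize X.2).+1 (p (\max_(i <- X.1) i).+1)).
have [f [l [h1 h2 h3 _]]] := chain_choice bd (fun j => maxn N0 (phi j)) (tame_sum ht).
pose D j := (f j).1; pose t j := (f j).2.
have DN j i : i \in D j -> (l j <= i)%N.
  have [_ _ /le_minP h _ _] := h1 j; move=> /h; apply: leq_trans; exact: leq_maxl.
have maxD j i : i \in D j -> (i <= \max_(k <- D j) k)%N.
  by move=> ij; exact: (leq_bigmax_seq (F := id)).
have hD : stacked H a D.
  apply: hphi => j; try by case: (h1 j).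
  - have [_ h4 h5 _ _] := h1 j; apply: hN0 => //; apply/le_minP => i /[dup] iD.
    move/le_minP: h5 => /[apply]; rewrite !geq_max => /andP[_ ->]; rewrite andbT.
    by apply: leq_trans (DN _ _ iD); apply: leq_trans (h2 j); exact: leq_maxl.
  - move=> j' jj; apply/setltP => i i' /maxD ij /DN ij'.
    by apply: leq_trans ij'; apply: leq_trans (h3 _ _ jj); rewrite leq_max ltnS ij.
  - apply/le_minP => i /DN; apply: leq_trans; apply: leq_trans (h2 j); exact: leq_maxr.
pose c (j i : nat) : R := 1 / 5.
have ye j : comb x (D j) (c j) = fun n => (1 / 5) * comb x (D j) (fun _ => 1) n.
  by apply/funext => n; rewrite /comb mulr_sumr; apply: eq_bigr => i _; rewrite (mul1r (x i n)).
exists a, D, c; split=> //.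
  move=> j; rewrite ye (WnormZ G _ (N := p (last 0%N (D j)).+1)).
    have [_ _ _ h _] := h1 j; rewrite ger0_norm; [move: h; lra|lra].
  apply: (block_comb_below _ hx) => i iD; apply: (block_le hx); rewrite ltnS.
  by have [_ sD _ _ _] := h1 j; exact: sorted_le_last.
have hy : block_seq (fun j => p (head 0%N (D j))) (fun j => comb x (D j) (c j)).
  exact: (block_blocks GH hx hD).
have tsupp j i : ivec (t j) i != 0 -> (p (head 0%N (D j)) <= i < p (head 0%N (D j.+1)))%N.
  have [_ _ _ _ [_ _ h _]] := h1 j; move=> /h[k kD /andP[k1 k2]].
  apply/andP; split.
    apply: leq_trans k1; apply: (block_le hx).
    by have [_ sD _ _ _] := h1 j; exact: sorted_ge_head.
  apply: leq_trans k2 _; apply: (block_le hx).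
  have /setltP := stacked_lt hD (ltnSn j); apply=> //.
  by case: (mem_head_last (stacked_neq0 hD j.+1)).
apply: (lower1_of_items GH (T := fun j => [:: t j]) hy) => //.
- by move=> j s; rewrite mem_seq1 => /eqP ->; have [_ _ _ _ []] := h1 j.
- by move=> j s i; rewrite mem_seq1 => /eqP ->; exact: tsupp.
- move=> j k s s' jk; rewrite !mem_seq1 => /eqP -> /eqP ->.
  have [_ _ _ _ [_ hs _ _]] := h1 k; have hb := leq_trans (h3 _ _ jk) hs.
  split; first by apply: leq_trans hb; rewrite !leq_max leqnn orbT.
  have [_ _ _ _ [_ _ h _]] := h1 j; move=> i /h[m mD /andP[_ m2]].
  apply: leq_trans hb; rewrite !leq_max; apply/orP; right; apply/orP; right.
  by apply: leq_trans m2 _; apply: (block_le hx); rewrite ltnS; exact: maxD.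
(* With one average per block and [j <= imin (t j)], the minima over [E] form a spread of [E] and
   remain at level [k]. *)
- move=> k; exists k.+1 => E HE hE; apply/(scale_GE GH); exists k.
  have -> : flatten (map (fun j => map imin [:: t j]) E) = map (fun j => imin (t j)) E.
    by elim: (E) => //= j E' ->.
  have mp j : (p (head 0%N (D j)) <= imin (t j) < p (head 0%N (D j.+1)))%N.
    by apply: tsupp; have [_ _ _ _ [[_ []]]] := h1 j.
  have jm j : (j <= imin (t j))%N.
    by have /andP[h _] := mp j; exact: leq_trans (block_id hy j) h.
  split; last first.
    apply: (reg_map (scale_H GH k)) => // i j ij.
    have /andP[_ h] := mp i; have /andP[h' _] := mp j.
    by apply: leq_trans h (leq_trans _ h'); exact: (block_le hy ij).
  apply/le_minP => _ /mapP[j jE ->]; apply: leq_trans (jm j).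
  by move/le_minP: hE; apply.
- move=> j; have [_ sD _ _ [_ _ _ h]] := h1 j.
  rewrite /isum /vsum /= ye prZr normrM [`|1 / 5|]ger0_norm; last by lra.
  have -> : (fun i => \sum_(g <- [:: ivec (t j)]) g i) = ivec (t j).
    by apply/funext => i; rewrite big_seq1.
  have xl : supp_below (comb x (D j) (fun _ => 1)) (p (last 0%N (D j)).+1).
    apply: (block_comb_below _ hx) => i iD; apply: (block_le hx); rewrite ltnS.
    exact: sorted_le_last.
  rewrite (pr_widen _ xl); last first.
    apply: (block_le hx); have /setltP := stacked_lt hD (ltnSn j); apply.
      by case: (mem_head_last (stacked_neq0 hD j)).
    by case: (mem_head_last (stacked_neq0 hD j.+1)).
  by move: h; rewrite -/(D j) -/(t j) => h; rewrite ger0_norm; move: h; lra.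
Qed.

(* Functionals witnessing non-tameness on a subsequence can be added up along
   Schreier sets, which makes the subsequence an l_1 sequence. *)
Lemma wild_good_blocks : ~ tame -> good_blocks.
Proof.
move=> /existsNP[m /existsNP[eps /not_implyP[eps0 /forallNP hw]]].
pose Q N (X : nat * seq (item R)) := [/\ (N <= X.1)%N,
  forall t, t \in X.2 -> [/\ good (inW G) t, (N <= isize t)%N &
    forall i, ivec t i != 0 -> (p X.1 <= i < p X.1.+1)%N],
  pairwise before X.2, H m (map imin X.2) &
  eps < `|pr (p X.1.+1) (isum X.2) (x X.1)|].
have step N : exists X, Q N X.
  (* Failure of tameness is used with both thresholds equal to [N]. Restricting the averages to the
     interval of [x i] keeps the value and gives the witnesses of different vectors successive
     supports. *)
  move/forallNP: (hw N) => /(_ N)/existsNP[i /not_implyP[Ni]].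
  move=> /existsNP[T /not_implyP[[hT hp hG] /not_implyP[HT /not_implyP[sT /negP]]]].
  rewrite -ltNge => hlt; pose A : pred nat := fun k => (p i <= k < p i.+1)%N.
  exists (i, restr_items A T); split=> //=.
  - move=> s /mapP[t]; rewrite mem_filter => /andP[t0 tT] ->.
    have [t1 _] := hT t tT; split; last 2 first.
    + exact: (sT t tT).
    + by move=> k; rewrite /ivec /= /restr; case: ifP; rewrite ?eqxx.
    + split; last exact/msuppP/nonzeroP.
      apply: (restr_avg (F := G)) t0; apply: is_avg_sub t1 => g gW; split=> //.
      exact (inW_restr (scale_G GH) gW).
  - exact: restr_before.
  - exact: restr_imin (scale_H GH m) hT hp HT.
  - rewrite -restr_isum (_ : pr _ (restr A (isum T)) (x i) = pr (p i.+1) (isum T) (x i)) //.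
    apply: eq_bigr => k _; rewrite /restr; case: ifPn => // nA.
    have [->|/(block_supp hx)] := eqVneq (x i k) 0; first by rewrite !mulr0.
    by rewrite -/(A k) (negPf nA).
have [phi [_ hphi]] := stack_exists GH m.
pose bd (X : nat * seq (item R)) := maxn (p X.1.+1) (\max_(t <- X.2) isize t).+1.
have [F [l [h1 h2 h3 _]]] := chain_choice bd phi step.
pose f j := (F j).1; pose T j := (F j).2.
have fl j : (l j <= f j)%N by case: (h1 j).
have pf j : (p (f j).+1 <= f j.+1)%N.
  by apply: leq_trans (fl _); apply: leq_trans (h3 _ _ (ltnSn j)); exact: leq_maxl.
have fS j : (f j < f j.+1)%N by apply: leq_trans (pf j); exact: (block_id hx).
have fmono i j : (i < j)%N -> (f i < f j)%N by exact: (homo_ltn ltn_trans fS).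
have fid j : (j <= f j)%N by elim: j => // j IH; apply: leq_ltn_trans IH (fS j).
pose v j := x (f j).
have hv : block_seq (p \o f) v.
  split.
  - apply: (homo_leq leqnn leq_trans) => k /=; apply: (block_le hx); exact: ltnW.
  - by move=> k /=; apply: leq_trans (block_id hx _).
  - move=> k i /(block_supp hx)/andP[-> h5] /=; apply: leq_trans h5 _.
    exact: (block_le hx).
have Tsupp j t i : t \in T j -> ivec t i != 0 -> (p (f j) <= i < p (f j).+1)%N.
  by have [_ h _ _ _] := h1 j; move=> /h[_ _]; apply.
have Tmin j t : t \in T j -> (p (f j) <= imin t < p (f j).+1)%N.
  by move=> tT; apply: (Tsupp j t) => //; have [_ /(_ _ tT)[[_ []]]] := h1 j.
have low : lower1 H (Wnorm G) v eps.
  apply: (lower1_of_items GH (T := T) hv).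
  - by move=> j t tT; have [_ /(_ _ tT)[]] := h1 j.
  - by move=> j; have [] := h1 j.
  - move=> j t i tT /(Tsupp _ _ _ tT)/andP[-> h] /=; apply: leq_trans h _.
    exact: (block_le hx).
  - move=> j k t t' jk tT t'T; have [_ /(_ _ t'T)[_ hs _] _ _ _] := h1 k.
    have hb := leq_trans (h3 _ _ jk) hs; split.
      apply: leq_trans hb; rewrite leq_max ltnS; apply/orP; right.
      exact: (leq_bigmax_seq (F := @isize R)).
    move=> i /(Tsupp _ _ _ tT)/andP[_ h]; apply: leq_trans h _.
    by apply: leq_trans hb; exact: leq_maxl.
  - move=> k; apply: (@stacked_G R G H GH m); apply: hphi.
    + move=> j; have [_ _ _ _] := h1 j; rewrite -/(T j).
      by case: (T j) => //; rewrite /isum /vsum /pr big1 ?normr0; [lra|move=> i _; rewrite big_nil mul0r].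
    + by move=> j; have [] := h1 j.
    + move=> i j ij; apply/setltP => _ _ /mapP[t /Tmin/andP[_ t1] ->] /mapP[t' /Tmin/andP[t2 _] ->].
      apply: leq_trans t1 (leq_trans _ t2); apply: (block_le hx); exact: fmono.
    + move=> j; apply/le_minP => _ /mapP[t /Tmin/andP[t1 _] ->]; apply: leq_trans t1.
      apply: leq_trans (block_id hx _); exact: leq_trans (fl j).
  - move=> j; have [_ _ _ _ hj] := h1 j; apply: ltW; apply: lt_le_trans hj _.
    by rewrite (pr_widen _ (@block_below _ _ _ (f j) hx) (block_le hx (fS j))).
have hhom := Wnorm_homogeneous G hv.
have v1 j : Wnorm G (v j) <= 1 by exact: x1.
have [lam [a [D [c [lam0 hD hc hub hlow]]]]] := james GH hhom v1 eps0 low.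
have [g hg] : exists g, forall j i, i \in [:: f j] -> g i = j.
  by apply: setlt_glue => i j ij; rewrite /setlt /= fmono.
have {}hg j : g (f j) = j by apply: hg; exact: mem_head.
have comb_f E b : comb x (map f E) (fun i => b (g i)) = comb v E b.
  by apply/funext => n; rewrite /comb big_map; apply: eq_bigr => j _; rewrite hg.
(* Dividing by [2 * lam] gives norm at most 1 and l_1 constant 1/2, whatever [eps] was. *)
pose C (j i : nat) := (2 * lam)^-1 * c j (g i).
have ye j : comb x (map f (D j)) (C j) = fun n => (2 * lam)^-1 * comb v (D j) (c j) n.
  rewrite (comb_f (D j) (fun i => (2 * lam)^-1 * c j i)).
  by apply/funext => n; rewrite /comb mulr_sumr; apply: eq_bigr => i _; rewrite mulrA.
have lam2 : 0 < 2 * lam by rewrite mulr_gt0.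
exists a, (fun j => map f (D j)), C; split.
- split.
  + by move=> j; have := stacked_neq0 hD j; case: (D j).
  + by move=> j; apply: (reg_map (scale_H GH a)) => //; exact: (stacked_H hD).
  + move=> i j ij; apply/setltP => _ _ /mapP[k kD ->] /mapP[k' kD' ->]; apply: fmono.
    by have /setltP := stacked_lt hD ij; apply.
  + move=> k; have [b hb] := stacked_flatten hD k; exists b => N'; have [N hN] := hb N'.
    exists N => E HE hE; have [e1 e2] := hN E HE hE.
    have -> : flatten (map (fun j => map f (D j)) E) = map f (flatten (map D E)).
      by elim: (E) => //= j E' ->; rewrite map_cat.
    split; first by apply: (reg_map (scale_H GH b)).
    apply/le_minP => _ /mapP[i iD ->]; apply: leq_trans (fid i).
    by move/le_minP: e2; apply.
- move=> j; rewrite ye hhom ger0_norm ?invr_ge0; last exact: ltW.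
  by rewrite ler_pdivrMl // mulr1; exact: hub.
- have h4 := lower1_blocks hlow hD (fun j => erefl) hc.
  have hbw := block_blocks GH hv hD (fun j => erefl (comb v (D j) (c j))).
  have := lower1_scale (Wnorm_homogeneous G hbw) (_ : 0 <= (2 * lam)^-1) ye h4.
  rewrite invr_ge0 ltW // => /(_ isT); apply: lower1_le.
  by rewrite invfM -mulrA mulVf ?gt_eqF // mulr1; lra.
Qed.

Lemma reduction : good_blocks.
Proof. by have [/tame_good_blocks|/wild_good_blocks] := pselect tame. Qed.

End MainReduction.

(** * Distortion *)

Section Spans.
Variable R : realType.
Implicit Types (u x v : nat -> vec R) (y z : vec R).

Lemma in_span0 u : in_span u (fun _ => 0).
Proof. by exists 0%N, (fun _ => 0); apply/funext => i; rewrite big_ord0. Qed.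

Lemma in_span_supp u z : (forall k, exists N, supp_below (u k) N) -> in_span u z ->
  exists N, supp_below z N.
Proof.
move=> /choice[N hN] [n [a ->]]; exists (\max_(k < n) N k) => i Ni; apply: big1 => k _.
by rewrite (hN k) ?mulr0 //; apply: leq_trans Ni; exact: (leq_bigmax k).
Qed.

Lemma in_spanD u y z : in_span u y -> in_span u z -> in_span u (y \+ z).
Proof.
move=> [n [a ->]] [m [b ->]].
have pad l l' (c : nat -> R) i : (l <= l')%N -> \sum_(k < l) c k * u k i =
    \sum_(k < l') (if (k < l)%N then c k else 0) * u k i.
  move=> ll; rewrite (big_ord_widen l' (fun k => c k * u k i) ll) big_mkcond.
  by apply: eq_bigr => k _; case: ifP => //; rewrite mul0r.
exists (maxn n m), (fun k => (if (k < n)%N then a k else 0) + (if (k < m)%N then b k else 0)).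
apply/funext => i /=; rewrite (pad n _ a i (leq_maxl n m)) (pad m _ b i (leq_maxr n m)).
by rewrite -big_split; apply: eq_bigr => k _; rewrite mulrDl.
Qed.

Lemma in_spanZ u c y : in_span u y -> in_span u (fun i => c * y i).
Proof.
move=> [n [a ->]]; exists n, (fun k => c * a k); apply/funext => i.
by rewrite mulr_sumr; apply: eq_bigr => k _; rewrite mulrA.
Qed.

Lemma in_span_basis u k : in_span u (u k).
Proof.
exists k.+1, (fun i => (i == k)%:R); apply/funext => i.
rewrite (bigD1 ord_max) //= eqxx mul1r big1 ?addr0 // => j jk.
by rewrite (_ : (j == k :> nat) = false) ?mul0r //; apply/negbTE; apply: contraNneq jk => jk;
  apply/eqP/val_inj.
Qed.

Lemma in_span_comb u v A a : (forall k, k \in A -> in_span u (v k)) -> in_span u (comb v A a).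
Proof.
elim: A => [|k A IH] h.
  have -> : comb v [::] a = fun _ => 0 by apply/funext => i; rewrite /comb big_nil.
  exact: in_span0.
have -> : comb v (k :: A) a = (fun i => a k * v k i) \+ comb v A a.
  by apply/funext => i; rewrite /comb big_cons.
apply: in_spanD; first by apply/in_spanZ/h/mem_head.
by apply: IH => l lA; apply: h; rewrite in_cons lA orbT.
Qed.

Lemma in_span_on_sub x E E' y : uniq E -> uniq E' -> {subset E' <= E} ->
  in_span_on x E' y -> in_span_on x E y.
Proof.
move=> uE uE' sub [c ->]; exists (fun i => if i \in E' then c i else 0).
apply/funext => j; under [RHS]eq_bigr => i _ do rewrite (fun_if (fun r => r * x i j)) mul0r.
rewrite -big_mkcond -big_filter; apply: perm_big; apply: uniq_perm => //.
  exact: filter_uniq.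
by move=> i; rewrite mem_filter andbC; case: (boolP (i \in E')) => [/sub ->|]; rewrite ?andbF.
Qed.

Lemma in_span_onZ x E c y : in_span_on x E y -> in_span_on x E (fun i => c * y i).
Proof.
move=> [a ->]; exists (fun k => c * a k); apply/funext => i.
by rewrite mulr_sumr; apply: eq_bigr => k _; rewrite mulrA.
Qed.

Lemma comb_eq x x' A a : (forall i, i \in A -> x i = x' i) -> comb x A a = comb x' A a.
Proof.
move=> h; apply/funext => n; rewrite /comb big_seq [RHS]big_seq.
by apply: eq_bigr => i /h ->.
Qed.

(* The vector indexed by 0 is not part of a normalized block sequence. *)
Definition zero_first x : nat -> vec R := fun i => if i is 0%N then vzero R else x i.

(** Intervals begin at the minima of supports. The zero vector at index 0 takes the initial
    interval, and [1 <= p 1] because coordinate 0 vanishes. *)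
Lemma block_seq_msupp x : (forall i, (0 < i)%N -> exists k, x i k != 0) ->
  (forall i, (0 < i)%N -> x i 0%N = 0) ->
  (forall i j, (0 < i)%N -> (i < j)%N -> blk (x i) (x j)) ->
  block_seq (fun i => if i is 0%N then 0%N else msupp (x i)) (zero_first x).
Proof.
move=> x0 x00 hb.
have lt i : (0 < i)%N -> (msupp (x i) < msupp (x i.+1))%N.
  move=> i0; have [h1 _] := msuppP (x0 i i0); have [h2 _] := msuppP (x0 i.+1 isT).
  exact: (hb i i.+1 i0 (ltnSn i) _ _ h1 h2).
have m1 : (0 < msupp (x 1%N))%N.
  rewrite lt0n; apply/eqP => m0; have [] := msuppP (x0 1%N isT).
  by rewrite m0 x00 ?eqxx.
split.
- apply: (homo_leq leqnn leq_trans); case=> [|i] //; exact: ltnW (lt _ _).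
- case=> // i; elim: i => // i IH; apply: leq_ltn_trans IH _; exact: lt.
- move=> [|i] k /=; first by rewrite eqxx.
  move=> xk; have [h1 h2] := msuppP (x0 i.+1 isT); rewrite h2 //=.
  have [h3 _] := msuppP (x0 i.+2 isT).
  exact: (hb i.+1 i.+2 isT (ltnSn _) _ _ xk h3).
Qed.

End Spans.

(** * The norms given by sums of at most n functionals *)

Section SumsNorm.
Variables (R : realType) (G : fam) (n : nat).
Hypothesis n0 : (0 < n)%N.

Definition short_sum (f : vec R) := exists fs : seq (nat -> R), [/\ (size fs <= n)%N,
  forall g, g \in fs -> inW G g, pairwise blkb fs & f = vsum fs].

(* The renorming that witnesses distortion. *)
Definition snorm (x : vec R) := norm_of short_sum x.

Lemma short_sum1 f : inW G f -> short_sum f.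
Proof.
move=> fW; exists [:: f]; split=> //; first by move=> g; rewrite mem_seq1 => /eqP ->.
by apply/funext => i; rewrite /vsum big_seq1.
Qed.

Let Kne : exists f, short_sum f. Proof. by exists (e R 1); exact/short_sum1/inW_e1. Qed.

Let Kbd f i : short_sum f -> `|f i| <= 1.
Proof. by move=> [fs [_ h1 h2 ->]]; apply: blk_sum_le => // g /h1; exact: inW_le1. Qed.

Let KN f : short_sum f -> short_sum (fun i => - f i).
Proof.
move=> [fs [h1 h2 h3 ->]]; exists [seq (fun i => - g i) | g : nat -> R <- fs]; split.
- by rewrite size_map.
- by move=> _ /mapP[g /h2 gW ->]; exact: inWN.
- rewrite pairwise_map; apply: sub_pairwise h3 => g h /blkbP gh; apply/blkbP => i j.
  by rewrite !oppr_eq0; exact: gh.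
- exact: vsumN.
Qed.

Lemma snorm_ub N f x : supp_below x N -> short_sum f -> pr N f x <= snorm x.
Proof. exact: (norm_ub1 Kbd). Qed.

Lemma snorm_le N x B : supp_below x N -> (forall f, short_sum f -> pr N f x <= B) ->
  snorm x <= B.
Proof. exact: (norm_le Kne). Qed.

Lemma snormZ N c x : supp_below x N -> snorm (fun i => c * x i) = `|c| * snorm x.
Proof. exact: (normZ Kne Kbd KN). Qed.

Lemma Wnorm_le_snorm N x : supp_below x N -> Wnorm G x <= snorm x.
Proof. by move=> xN; apply: (Wnorm_le xN) => f /short_sum1; exact: snorm_ub. Qed.

Lemma snorm_le_Wnorm N x : supp_below x N -> snorm x <= n%:R * Wnorm G x.
Proof.
move=> xN; apply: (snorm_le xN) => f [fs [h1 h2 _ ->]]; rewrite pr_vsum.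
apply: (@le_trans _ _ (\sum_(g <- fs) Wnorm G x)).
  rewrite big_seq [leRHS]big_seq; apply: ler_sum => g /h2 gW.
  by apply: le_trans (ler_norm _) _; exact: Wnorm_ub.
rewrite big_const_seq count_predT iter_addr_0 -[leLHS]mulr_natl ler_wpM2r ?ler_nat //.
exact: Wnorm_ge0 xN.
Qed.

Lemma snorm_equiv u : block_basis u -> equiv_norm G u snorm.
Proof.
move=> [hN _ _ _]; split.
- move=> y z hy hz; have [N yN] := in_span_supp hN hy; have [M zM] := in_span_supp hN hz.
  apply: (normD Kne Kbd (N := maxn N M)).
    by apply: supp_below_widen yN _; exact: leq_maxl.
  by apply: supp_below_widen zM _; exact: leq_maxr.
- by move=> c z /(in_span_supp hN)[N zN]; exact: snormZ zN.
- exists 1, n%:R; split=> //; first by rewrite ltr0n.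
  move=> z /(in_span_supp hN)[N zN]; rewrite mul1r.
  by split; [exact: Wnorm_le_snorm zN|exact: snorm_le_Wnorm zN].
Qed.

End SumsNorm.

Section Distortion.
Variables (R : realType) (G : fam) (H : nat -> fam).
Hypothesis GH : family_scale R G H.
Variable u : nat -> vec R.
Hypothesis hu : block_basis u.

Lemma block_basis_comb_blk A B a b : setlt A B -> blk (comb u A a) (comb u B b).
Proof.
have nz C c i : comb u C c i != 0 -> exists2 k, k \in C & u k i != 0.
  move=> h; have /hasP[k kC uk] : has (fun k => u k i != 0) C; last by exists k.
  apply: contraNT h => /hasPn h; rewrite /comb big_seq big1 // => k /h/negbNE/eqP ->.
  by rewrite mulr0.
move=> /setltP AB i j /nz[k kA uk] /nz[l lB ul].
by have [_ _ _ hb] := hu; exact: (hb _ _ (AB _ _ kA lB)).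
Qed.

Lemma norm_block_seqP x : norm_block_seq G u x -> exists p,
  [/\ block_seq p (zero_first x), forall i, Wnorm G (zero_first x i) <= 1 &
      forall i, (0 < i)%N -> Wnorm G (zero_first x i) = 1].
Proof.
have W0 : Wnorm G (vzero R) = 0.
  apply/le_anti/andP; split; last exact: (@Wnorm_ge0 _ _ 0).
  apply: (@Wnorm_le _ _ 0) => // f _; by rewrite /pr big_ord0.
have [hN h0 _ hb] := hu; move=> [Fs [a [hx x1 hF]]].
exists (fun i => if i is 0%N then 0%N else msupp (x i)); split.
- apply: block_seq_msupp.
  + move=> i i0; apply: contrapT => /forallNP h.
    have xz : x i = vzero R.
      by apply/funext => k; apply/eqP; rewrite -[_ == _]negbK; apply/negP/h.
    by have := x1 i i0; rewrite xz W0 => /esym/eqP; rewrite oner_eq0.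
  + by move=> i i0; rewrite hx // big1 // => k _; rewrite h0 mulr0.
  + move=> i j i0 ij; rewrite hx // hx ?(ltn_trans i0) //.
    exact: block_basis_comb_blk (hF _ _ i0 ij).
- by case=> [|i] /=; rewrite ?W0 ?ler01 // x1.
- by case=> // i _; exact: x1.
Qed.

End Distortion.

(** * Distorted pairs on sets of S_(omega^xi + 1) *)

Section UpperIndex.
Variables (R : realType) (G : fam) (H : nat -> fam).
Hypothesis GH : family_scale R G H.

(** Iterating [q] produces the index set from which special convex combinations are drawn, with the
    sparseness that [special_small] asks for. *)
Lemma sparse_set (q : nat -> nat) : (forall i, (i <= q i)%N) -> exists M : nat -> Prop,
  unbounded M /\ forall i j, M i -> M j -> (i < j)%N -> (q i.+1 <= j)%N.
Proof.
move=> hq; pose mu := fix mu k := if k is l.+1 then q (mu l).+1 else 0%N.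
have muS k : (mu k < mu k.+1)%N by exact: hq.
have mu_le k l : (k <= l)%N -> (mu k <= mu l)%N.
  by apply: (homo_leq leqnn leq_trans) => i; exact: ltnW.
exists (fun m => exists k, m = mu k); split.
  move=> N; exists (mu N); last by exists N.
  by elim: N => // N IH; apply: leq_ltn_trans IH (muS N).
move=> _ _ [k ->] [l ->] kl; rewrite -/(mu k.+1); apply: (mu_le); rewrite ltnNge.
by apply/negP => /mu_le; rewrite leqNgt kl.
Qed.

(* [z_0, ..., z_{n-1}] is a c_0-like sequence of special convex combinations:
   the average of norming functionals of the [z_k] sees their sum but hardly sees
   [z_0]. *)
Lemma distorted_pair p (x : nat -> vec R) n : block_seq p x -> (forall i, Wnorm G (x i) <= 1) ->
  (forall i, (0 < i)%N -> Wnorm G (x i) = 1) -> (0 < n)%N ->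
  exists (E : seq nat) (y z : vec R), [/\ succ_fam G E, in_span_on x E y /\ in_span_on x E z,
    n%:R / 20 <= snorm G n y, Wnorm G y <= 5 &
    1 / 10 <= Wnorm G z /\ snorm G n z <= 2].
Proof.
move=> hx x1 x_normal n0.
have nR : 1 <= n%:R :> R by rewrite ler1n.
have nR0 : 0 < n%:R :> R by rewrite ltr0n.
have [a [D [c [hD y1 hlow]]]] := reduction GH hx x1 x_normal.
pose y j := comb x (D j) (c j).
have ye j : y j = comb x (D j) (c j) by [].
pose q j := p (head 0%N (D j)).
have hy : block_seq q y := block_blocks GH hx hD ye.
have [M [Minf Msp]] := sparse_set (block_id hy).
(* Makes the bound [4 * eps0 + 1 / (4 * n)] of [special_small] equal to 1/(2n), the error that
   [sum_upper_estimate] allows. *)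
pose eps0 : R := (16 * n%:R)^-1.
have eps00 : 0 < eps0 by rewrite invr_gt0 mulr_gt0.
have neps0 : n%:R * eps0 = 1 / 16.
  by rewrite /eps0 invfM mulrCA divff ?gt_eqF // mulr1 mul1r.
(* Specialness is required at the level [N] of the threshold itself. As thresholds exceed the ends
   [L k0] of the earlier vectors, it covers the levels at which [small] is needed. *)
pose Q N (X : seq nat * (nat -> R)) := [/\ X.1 != [::] /\ sorted ltn X.1,
  forall i, i \in X.1 -> M i /\ (0 < i)%N, le_min N X.1, special (H N) X.1 X.2 eps0 &
  1 / 10 <= Wnorm G (comb y X.1 X.2) /\ G (flatten (map D X.1))].
have step N : exists X, Q N X.
  have [b hb] := scale_special GH N; have [N1 hN1] := hlow b.
  have [N2 hN2] := stacked_G GH hD b.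
  have [E [w [E0 EM hE HE hw]]] := hb M eps0 (maxn N (maxn N1 N2)) Minf eps00.
  have [w0 wE w1 _] := hw; exists (E, w); split=> //=.
  - by split=> //; exact: (reg_sorted (scale_H GH b)) HE.
  - by move=> i iE; split; [exact: EM|exact: (reg_gt0 (scale_H GH b)) HE _].
  - by apply: le_min_trans hE; exact: leq_maxl.
  - split; last by apply: hN2 => //; apply: le_min_trans hE; rewrite !leq_max leqnn !orbT.
    apply: le_trans (hN1 E w HE _); last by apply: le_min_trans hE; rewrite !leq_max leqnn !orbT.
    under eq_bigr => i _ do rewrite ger0_norm //.
    by rewrite w1 mulr1.
(* The threshold [4 * n] acts three times: on the sizes of averages, on the start of the first
   vector, and on the minimum of the union of the [n] index sets. *)
have [f [l [h1 h2 h3 h4]]] := chain_choice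
  (fun X : seq nat * (nat -> R) => (q (last 0%N X.1).+1).+1) (fun _ => 4 * n)%N step.
pose E k := (f k).1; pose w k := (f k).2; pose z k := comb y (E k) (w k).
have E0 k : E k != [::] by case: (h1 k) => -[].
have sE k : sorted ltn (E k) by case: (h1 k) => -[].
have hdE k : head 0%N (E k) \in E k by case: (mem_head_last (E0 k)).
have laE k : last 0%N (E k) \in E k by case: (mem_head_last (E0 k)).
have lE k i : i \in E k -> (l k <= i)%N by have [_ _ /le_minP h _ _] := h1 k; exact: h.
have posE k i : i \in E k -> (0 < i)%N by have [_ h _ _ _] := h1 k; move=> /h[].
pose s k := q (head 0%N (E k)); pose L k := q (last 0%N (E k)).+1.
have Ll k k' : (k < k')%N -> (L k < l k')%N by exact: h3.
have lhd k : (l k <= head 0%N (E k))%N by exact: lE.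
have hds k : (head 0%N (E k) <= s k)%N by exact: (block_id hy).
have nl k : (4 * n <= l k)%N by exact: h2.
have sL k : (s k <= L k)%N.
  by apply: (block_le hy); apply: leqW; apply: sorted_ge_head.
have Ls k : (L k < s k.+1)%N.
  by apply: leq_trans (Ll _ _ (ltnSn k)) _; exact: leq_trans (hds _).
have zsupp k i : z k i != 0 -> (s k <= i < L k)%N.
  move=> zk; have /hasP[j jE yj] : has (fun j => y j i != 0) (E k).
    apply: contraNT zk => /hasPn h; rewrite /z /comb big_seq big1 // => j /h/negbNE/eqP ->.
    by rewrite mulr0.
  have /andP[j1 j2] := block_supp hy yj; apply/andP; split.
    by apply: leq_trans j1; apply: (block_le hy); exact: sorted_ge_head.
  by apply: leq_trans j2 _; apply: (block_le hy); rewrite ltnS; exact: sorted_le_last.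
have ss k : (s k < s k.+1)%N by exact: leq_ltn_trans (sL k) (Ls k).
have hz : block_seq s z.
  split.
  - by apply: (homo_leq leqnn leq_trans) => k; exact: ltnW.
  - by elim=> // k IH; exact: leq_ltn_trans IH (ss k).
  - by move=> k i /zsupp/andP[-> i2]; exact: leq_trans i2 (ltnW (Ls k)).
pose P := s n.
have LP k : (k < n)%N -> (L k <= P)%N.
  by move=> kn; apply: leq_trans (ltnW (Ls k)) _; exact: (block_le hz).
have w_special k : special (H (l k)) (E k) (w k) eps0 by case: (h1 k).
have yP k i : (k < n)%N -> i \in E k -> (q i.+1 <= P)%N.
  move=> kn iE; apply: leq_trans (LP k kn); apply: (block_le hy); rewrite ltnS.
  exact: sorted_le_last.
have z1 k : Wnorm G (z k) <= 1.
  apply: le_trans (Wnorm_comb G (w k) (N := L k) _) _ => [i iE|].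
    apply: supp_below_widen (@block_below _ _ _ i hy) _; apply: (block_le hy).
    by rewrite ltnS; exact: sorted_le_last.
  have [w0 _ w1 _] := w_special k; rewrite -w1; apply: ler_sum => i _.
  by rewrite ger0_norm // ler_piMr //; exact: y1.
have z10 k : 1 / 10 <= Wnorm G (z k) by case: (h1 k) => _ _ _ _ [].
have zP k : (k < n)%N -> supp_below (z k) P.
  by move=> kn; apply: supp_below_widen (@block_below _ _ _ k hz) (block_le hz kn).
pose Y := comb z (iota 0 n) (fun _ => 1).
have YP : supp_below Y P.
  by apply: supp_below_comb => k; rewrite mem_iota add0n => /andP[_]; exact: zP.
have Y5 : Wnorm G Y <= 5.
  apply: (@sum_upper_estimate R G H GH n z s L P (2 * n%:R)^-1) => //.
  - by move=> k i _; exact: zsupp.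
  - by move=> k _; rewrite sL ltnW.
  - by apply: leq_trans (leq_trans (nl 0%N) (leq_trans (lhd 0%N) (hds 0%N))); exact: leq_pmull.
  - by rewrite invr_ge0 mulr_ge0.
  - by rewrite divff // gt_eqF // mulr_gt0.
  - move=> k0 k T /andP[k0k kn] hT HT hs.
    have -> : (2 * n%:R)^-1 = 4 * eps0 + (4 * n)%:R^-1 :> R.
      by rewrite /eps0 natrM !invfM; lra.
    have y1E i : i \in E k -> Wnorm G (y i) <= 1 by move=> _; exact: y1.
    have Esp i j : i \in E k -> j \in E k -> (i < j)%N -> (q i.+1 <= j)%N.
      move=> iE jE; apply: Msp; have [_ h _ _ _] := h1 k; first by case: (h i iE).
      by case: (h j jE).
    have := special_small GH hy y1E (fun i => @yP k i kn) (sE k) (posE k) Esp (w_special k).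
    apply=> //.
    + apply: (scale_le GH) HT; apply: leq_trans (ltnW (Ll _ _ (ltnSn k0))) _; exact: h4.
    + by rewrite muln_gt0.
    + move=> t /hs; apply: leq_trans; apply: leq_trans (nl k0.+1) _.
      exact: leq_trans (lhd _) (hds _).
  - exact: iota_ltn_sorted.
  - by move=> k; rewrite mem_iota add0n => /andP[].
have r0 : 0 <= 1 / 20 :> R by lra.
(* [norming_sum] wants a strict inequality, whence 1/20 below the available 1/10. *)
have z20 k : (k < n)%N -> 1 / 20 < Wnorm G (z k).
  by move=> _; apply: lt_le_trans (z10 k); lra.
have [fs [sfs hfs bfs _ hY]] := norming_sum GH hz (leqnn P) r0 z20.
have snY : n%:R / 20 <= snorm G n Y.
  apply: le_trans (_ : _ <= pr P (vsum fs) Y) _; first by move: hY; rewrite -/Y; lra.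
  by apply: snorm_ub => //; exists fs; rewrite sfs.
(* The at most [n] functionals together count each coefficient once, plus fewer than [n] repetitions
   of size at most [eps0]: at most 17/16 in total. *)
have snz : snorm G n (z 0%N) <= 2.
  apply: (snorm_le n0 (zP 0%N n0)) => g [gs [sgs hgs bgs ->]].
  have [w0 _ w1 wF] := w_special 0%N.
  rewrite pr_vsum; apply: le_trans (ler_norm _) _; apply: le_trans (ler_norm_sum _ _ _) _.
  have wm i : i \in E 0%N -> 0 <= w 0%N i <= eps0.
    move=> iE; rewrite w0 /=; have := wF [:: i] (reg_single (scale_H GH _) (posE _ _ iE)).
    by rewrite big_seq1.
  apply: le_trans (sum_pr_le bgs (sorted_uniq ltn_trans ltnn (sE 0%N)) _ (ltW eps00) wm _) _.
  - by move=> i j _ _; exact: (block_blk hy).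
  - move=> h i /hgs hW iE; apply: le_trans (y1 i); apply: Wnorm_ub => //.
    exact: supp_below_widen (@block_below _ _ _ i hy) (yP 0%N i n0 iE).
  - rewrite w1; have : (size gs).-1%:R * eps0 <= n%:R * eps0.
      apply: ler_wpM2r; first exact: ltW.
      by rewrite ler_nat; apply: leq_trans sgs; exact: leq_pred.
    by rewrite neps0; lra.
pose B k := flatten (map D (E k)).
have headD j : (j <= head 0%N (D j))%N.
  elim: j => // j IH; apply: leq_ltn_trans IH _.
  have /setltP := stacked_lt hD (ltnSn j); apply.
    by case: (mem_head_last (stacked_neq0 hD j)).
  by case: (mem_head_last (stacked_neq0 hD j.+1)).
have DjH j : sorted ltn (D j) := reg_sorted (scale_H GH a) (stacked_H hD j).
have Bi k i : i \in B k -> (4 * n <= i)%N.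
  move=> /flattenP[_ /mapP[j jE ->] iD]; apply: leq_trans (nl k) _.
  apply: leq_trans (lE k j jE) _; apply: leq_trans (headD j) _; exact: sorted_ge_head.
have Blt k k' : (k < k')%N -> setlt (B k) (B k').
  move=> kk; apply/setltP => i i' /flattenP[_ /mapP[j jE ->] iD] /flattenP[_ /mapP[j' jE' ->] iD'].
  have jj : (j < j')%N.
    apply: leq_trans (lE k' j' jE'); apply: leq_trans (Ll _ _ kk).
    apply: leq_ltn_trans (sorted_le_last (sE k) jE) _.
    by rewrite ltnS; apply: leq_trans (block_id hy _); exact: leqnSn.
  by have /setltP := stacked_lt hD jj; apply.
have BG k : G (B k) by case: (h1 k) => _ _ _ _ [].
pose TT := flatten (map B (iota 0 n)).
have sTT : succ_fam G TT.
  apply: (@succ_fam_succ _ _ (map B (iota 0 n)) (scale_G GH)) => //.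
  - by move=> _ /mapP[k _ ->].
  - by apply: map_setlt => //; exact: iota_ltn_sorted.
  - rewrite size_map size_iota; apply/le_minP => i /flattenP[_ /mapP[k _ ->] /Bi].
    by apply: leq_trans; exact: leq_pmull.
have uG (F : seq nat) : succ_fam G F -> uniq F.
  move=> /(reg_sorted (regular_succ (scale_G GH))); exact: sorted_uniq ltn_trans ltnn _.
have uB k : uniq (B k).
  exact: sorted_uniq ltn_trans ltnn _ (reg_sorted (scale_G GH) (BG k)).
have [g hg] := setlt_glue (stacked_lt hD).
have zx k : z k = comb x (B k) (fun i => w k (g i) * c (g i) i).
  by case: (comb_flatten (E k) (w k) hg ye).
have [g' hg'] := setlt_glue Blt.
exists TT, Y, (z 0%N); split=> //.
split.
  have [hYx _] := comb_flatten (iota 0 n) (fun _ => 1) hg' zx.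
  by rewrite /Y hYx; eexists; reflexivity.
apply: (@in_span_on_sub _ x TT (B 0%N)) => //; first exact: uG.
  move=> i iB; apply/flattenP; exists (B 0%N) => //; apply: map_f.
  by rewrite mem_iota.
by rewrite zx; eexists; reflexivity.
Qed.

End UpperIndex.

(** * The two bounds for the distortion index *)

Section Index.
Variables (R : realType) (G : fam) (H : nat -> fam).
Hypothesis GH : family_scale R G H.
Variable u : nat -> vec R.
Hypothesis hu : block_basis u.

Lemma succ_fam_arb_distortable : arb_distortable G u (succ_fam G).
Proof.
(* After normalization the renorming is at least (n/20)/5 on [y] and at most 2/(1/10) on [z], a
   ratio of n/2000. *)
move=> t t1; pose n := (Num.truncn (2000 * t)).+1.
have n0 : (0 < n)%N by [].
have nt : 2000 * t < n%:R by exact: truncnS_gt.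
exists (snorm G n); split; first exact: snorm_equiv.
move=> x hx; have [p [hp x1 x_normal]] := norm_block_seqP hu hx.
have [E [y [z [hE [yE zE] hy y5 [hz hz2]]]]] := distorted_pair GH hp x1 x_normal n0.
have supp v : in_span_on (zero_first x) E v -> exists N, supp_below v N.
  move=> [c ->]; exists (\max_(i <- E) p i.+1) => //.
  by apply: (block_comb_below _ hp) => i iE; exact: (leq_bigmax_seq (F := fun i => p i.+1)).
have pos i : i \in E -> (0 < i)%N by exact: (reg_gt0 (regular_succ (scale_G GH)) hE).
have span v : in_span_on (zero_first x) E v -> in_span_on x E v.
  by move=> [c ->]; exists c; apply: (@comb_eq _ (zero_first x)) => -[|i] // /pos.
have [Ny hNy] := supp y yE; have [Nz hNz] := supp z zE.
have nR : 0 < n%:R :> R by rewrite ltr0n.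
have y0 : 0 < Wnorm G y.
  have h := le_trans hy (snorm_le_Wnorm G n0 hNy).
  by rewrite -(pmulr_rgt0 _ nR); apply: lt_le_trans h; rewrite divr_gt0.
have z0 : 0 < Wnorm G z by move: hz; lra.
have normalize (v : vec R) N : supp_below v N -> 0 < Wnorm G v ->
    Wnorm G (fun i => (Wnorm G v)^-1 * v i) = 1 /\
    snorm G n (fun i => (Wnorm G v)^-1 * v i) = (Wnorm G v)^-1 * snorm G n v.
  move=> vN v0; rewrite (WnormZ _ _ vN) (snormZ G n0 _ vN).
  by rewrite ger0_norm ?invr_ge0 ?(ltW v0) // mulVf // gt_eqF.
have [yn1 yn2] := normalize y Ny hNy y0; have [zn1 zn2] := normalize z Nz hNz z0.
exists E, (fun i => (Wnorm G y)^-1 * y i), (fun i => (Wnorm G z)^-1 * z i); split=> //.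
  by split; apply/in_span_onZ/span.
have sz0 : 0 < snorm G n z by apply: lt_le_trans z0 (Wnorm_le_snorm G n0 hNz).
rewrite yn2 zn2 ltr_pdivlMr ?mulr_gt0 ?invr_gt0 //.
apply: (@lt_le_trans _ _ (n%:R / 100)).
  apply: (@le_lt_trans _ _ (t * 20)); last by move: nt; lra.
  rewrite ler_wpM2l //; first by move: t1; lra.
  rewrite ler_pdivrMl //; move: hz hz2; lra.
rewrite ler_pdivlMl //; apply: le_trans hy.
have : Wnorm G y * (n%:R / 100) <= 5 * (n%:R / 100) by rewrite ler_wpM2r // divr_ge0.
lra.
Qed.

Lemma Wnorm_gt0 (x : vec R) N k : supp_below x N -> (0 < k)%N -> x k != 0 -> 0 < Wnorm G x.
Proof.
move=> xN k0 xk; apply: lt_le_trans (Wnorm_ub (f := e R k) xN _).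
  have kN : (k < N)%N by rewrite ltnNge; apply: contra xk => /xN ->.
  rewrite /pr (bigD1 (Ordinal kN)) //= {1}/e eqxx mul1r big1 ?addr0 ?normr_gt0 // => i ik.
  rewrite /e (_ : (i == k :> nat) = false) ?mul0r //.
  by apply/negbTE; apply: contraNneq ik => ik; apply/eqP/val_inj.
by exists 0%N; exists k; split=> //; left.
Qed.

Lemma normalized_basis : exists p (x : nat -> vec R), [/\ block_seq p x,
  forall i, Wnorm G (x i) <= 1, forall i, (0 < i)%N -> Wnorm G (x i) = 1,
  forall i, exists r, x i = fun k => r * u i k & forall i, in_span u (x i)].
Proof.
have [hN h0 hnz hb] := hu.
have up i : 0 < Wnorm G (u i).
  have [N uN] := hN i; have [k uk] := hnz i; apply: (Wnorm_gt0 uN _ uk).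
  by rewrite lt0n; apply: contraNneq uk => ->; rewrite h0.
pose w i k := (Wnorm G (u i))^-1 * u i k.
have hw : norm_block_seq G u w.
  exists (fun i => [:: i]), (fun i => (Wnorm G (u i))^-1); split.
  - by move=> i _; apply/funext => k; rewrite big_seq1.
  - move=> i _; have [N uN] := hN i; rewrite (WnormZ _ _ uN) ger0_norm ?invr_ge0 ?ltW //.
    by rewrite mulVf // gt_eqF.
  - by move=> i i' _ ii; rewrite /setlt /= ii.
have [p [hp x1 x_normal]] := norm_block_seqP hu hw.
exists p, (zero_first w); split=> //.
  move=> [|i]; last by exists (Wnorm G (u i.+1))^-1.
  by exists 0; apply/funext => k; rewrite mul0r.
move=> [|i]; first exact: in_span0.
exact/in_spanZ/in_span_basis.
Qed.

(* For every equivalent norm James' argument yields a block sequence along which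
   the norm is 20-stabilized on the sets of [K]. *)
Lemma not_arb_distortable (K : fam) : regular K ->
  (exists N, forall E, K E -> le_min N E -> G E) -> ~ arb_distortable G u K.
Proof.
move=> Kreg [NK hNK] /(_ 20)[|nu [[nuD nuZ [c0 [C0 [c00 C00 nuW]]]] hnu]].
  by lra.
have [p [x [hx x1 x_normal xu xspan]]] := normalized_basis.
have [a [D [c [hD y1 ylow]]]] := reduction GH hx x1 x_normal.
pose y j := comb x (D j) (c j).
have ye j : y j = comb x (D j) (c j) by [].
have hy := block_blocks GH hx hD ye.
have yspan j : in_span u (y j) by apply: in_span_comb => i _; exact: xspan.
have nu_hom : homogeneous nu y.
  by move=> t E b; apply: nuZ; apply: in_span_comb => i _; exact: yspan.
have nuy j : nu (y j) <= C0.
  apply: le_trans (nuW _ (yspan j)).2 _; rewrite ler_piMr ?(ltW C00) //; exact: y1.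
have nulow : lower1 H nu y (c0 * (1 / 10)).
  move=> k; have [N hN] := ylow k; exists N => E b HE hE.
  apply: le_trans (nuW _ (in_span_comb b (fun i _ => yspan i))).1.
  by rewrite -mulrA ler_wpM2l ?(ltW c00) //; exact: hN.
have d0 : 0 < c0 * (1 / 10) by rewrite mulr_gt0 //; lra.
have [lam [a' [D' [c' [lam0 hD' c'1 w2 ylam]]]]] := james GH nu_hom nuy d0 nulow.
pose w j := comb y (D' j) (c' j).
have we j : w j = comb y (D' j) (c' j) by [].
(* Blocks chosen for [nu] keep both lower estimates: their coefficients are l_1-normalized, so the
   one for the given norm passes to them too. *)
have wlam := lower1_blocks ylam hD' we c'1.
have wlow := lower1_blocks ylow hD' we c'1.
have hw := block_blocks GH hy hD' we.
have wspan j : in_span u (w j) by apply: in_span_comb => i _; exact: yspan.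
have wsupp j := @block_below _ _ _ j hw.
have w1 j : Wnorm G (w j) <= 1.
  pose N := \max_(i <- D' j) p (head 0%N (D i.+1)).
  apply: le_trans (Wnorm_comb G (c' j) (N := N) _) _ => [i iD|].
    apply: supp_below_widen (@block_below _ _ _ i hy) _.
    exact: (leq_bigmax_seq (F := fun i => p (head 0%N (D i.+1)))).
  rewrite -(c'1 j); apply: ler_sum => i _; rewrite ler_piMr //; exact: y1.
have both k : exists N, forall E b, H k E -> le_min N E ->
    lam * \sum_(i <- E) `|b i| <= nu (comb w E b) /\
    1 / 10 * \sum_(i <- E) `|b i| <= Wnorm G (comb w E b).
  have [N1 h1] := wlam k; have [N2 h2] := wlow k; exists (maxn N1 N2) => E b HE hE.
  by split; [apply: h1 | apply: h2] => //; apply: le_min_trans hE;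
    [exact: leq_maxl | exact: leq_maxr].
have [Nl hNl] := choice both.
have step N : exists m, (N <= m)%N by exists N.
(* Diagonalization: a set of level [i] in [G] has all its elements above [i], and [f] sends those
   past [Nl i]. Along [f] the estimates thus hold on all of [G] at once. *)
have [f [l [h1 h2 h3 _]]] := chain_choice succn (fun k => \max_(i < k.+1) Nl i) step.
have fmono i j : (i < j)%N -> (f i < f j)%N by move=> /h3 h; exact: leq_trans h (h1 j).
have fid j : (j <= f j)%N.
  by elim: j => // j IH; apply: leq_ltn_trans IH (fmono _ _ (ltnSn j)).
have fNl i k : (i <= k)%N -> (Nl i <= f k)%N.
  rewrite -ltnS => ik; apply: leq_trans (h1 k); apply: leq_trans (h2 k).
  exact: (leq_bigmax (Ordinal ik)).
(* The shift by [NK] brings every set of [K] into [G], which contains such sets on a tail only. *)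
pose psi k := f (k + NK)%N.
have psi_mono i j : (i < j)%N -> (psi i < psi j)%N by move=> ij; rewrite fmono // ltn_add2r.
have [inv hinv] : exists inv, forall j i, i \in [:: psi j] -> inv i = j.
  by apply: setlt_glue => i j ij; rewrite /setlt /= psi_mono.
have {}hinv j : inv (psi j) = j by apply: hinv; exact: mem_head.
have stable E (g : nat -> R) : K E ->
    lam * \sum_(k <- E) `|g k| <= nu (comb (w \o psi) E g) /\
    1 / 10 * \sum_(k <- E) `|g k| <= Wnorm G (comb (w \o psi) E g).
  move=> KE; pose E1 := map (addn^~ NK) E.
  have [i [E1i HE1]] : exists i, le_min i.+1 E1 /\ H i E1.
    apply/(scale_GE GH); apply: hNK.
      by apply: (reg_map Kreg) => // [j|j j' jj]; [exact: leq_addr|rewrite ltn_add2r].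
    by apply/le_minP => _ /mapP[j _ ->]; exact: leq_addl.
  have HE2 : H i (map f E1) by apply: (reg_map (scale_H GH i)).
  have lE2 : le_min (Nl i) (map f E1).
    apply/le_minP => _ /mapP[j jE ->]; apply: fNl.
    by move/le_minP: E1i => /(_ j jE)/ltnW.
  have := hNl i _ (g \o inv) HE2 lE2.
  have ce : comb w (map f E1) (g \o inv) = comb (w \o psi) E g.
    apply/funext => n; rewrite /comb !big_map; apply: eq_bigr => k _ /=.
    by rewrite -/(psi k) hinv.
  rewrite ce !big_map /=; under eq_bigr => k _ do rewrite -/(psi k) hinv.
  by [].
have wpos k : (0 < k)%N -> 1 / 10 <= Wnorm G (w (psi k)).
  move=> k0; have [_] := stable [:: k] (fun _ => 1) (reg_single Kreg k0).
  by rewrite big_seq1 normr1 mulr1 comb1.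
pose r k := (Wnorm G (w (psi k)))^-1.
pose X k : vec R := fun i => r k * w (psi k) i.
pose Fs k := flatten (map D (D' (psi k))).
have Flt i j : (i < j)%N -> setlt (Fs i) (Fs j).
  move=> ij; apply/setltP => b b' /flattenP[_ /mapP[m mD ->] bm] /flattenP[_ /mapP[m' mD' ->] bm'].
  have mm : (m < m')%N by have /setltP := stacked_lt hD' (psi_mono _ _ ij); apply.
  by have /setltP := stacked_lt hD mm; apply.
have [g hg] := setlt_glue (stacked_lt hD).
have [gF hgF] := setlt_glue Flt.
have [ru hru] := choice xu.
have hX : norm_block_seq G u X.
  exists Fs, (fun i => r (gF i) * (c' (psi (gF i)) (g i) * c (g i) i) * ru i); split.
  - move=> k k0; apply/funext => n; rewrite /X we.
    have [-> _] := comb_flatten (D' (psi k)) (c' (psi k)) hg ye.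
    rewrite /comb mulr_sumr -/(Fs k) big_seq [RHS]big_seq; apply: eq_bigr => i iF.
    by rewrite (hgF k i iF) hru !mulrA.
  - move=> k k0; rewrite (WnormZ _ _ (wsupp _)) ger0_norm.
      by rewrite mulVf // gt_eqF //; apply: lt_le_trans (wpos k k0); lra.
    by rewrite invr_ge0; apply: le_trans (wpos k k0); lra.
  - by move=> i j _; exact: Flt.
have [E [Y [Z [KE [[cY eY] [cZ eZ]] Y1 Z1]]]] := hnu X hX.
have cX cc : (fun n => \sum_(i <- E) cc i * X i n) = comb (w \o psi) E (fun k => cc k * r k).
  by apply/funext => n; apply: eq_bigr => k _; rewrite /= mulrA.
have nu_sum A b : nu (comb (w \o psi) A b) <= 2 * lam * \sum_(k <- A) `|b k|.
  elim: A => [|k A IH].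
    have -> : comb (w \o psi) [::] b = fun i => 0 * vzero R i.
      by apply/funext => i; rewrite /comb big_nil mul0r.
    by rewrite nuZ ?big_nil ?normr0 ?mul0r ?mulr0 //; exact: in_span0.
  have -> : comb (w \o psi) (k :: A) b = (fun i => b k * w (psi k) i) \+ comb (w \o psi) A b.
    by apply/funext => i; rewrite /comb big_cons.
  apply: le_trans (nuD _ _ _ _) _; first exact/in_spanZ/wspan.
    by apply: in_span_comb => j _; exact: wspan.
  rewrite big_cons mulrDr lerD // nuZ; last exact: wspan.
  by rewrite mulrC ler_wpM2r //; exact: w2.
rewrite eY eZ !cX in Y1 Z1 *.
set bY := fun k => cY k * r k in Y1 *; set bZ := fun k => cZ k * r k in Z1 *.
(* The coefficient sum is at most 10 for [Y] and at least 1 for [Z]. So [nu] is at most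
   [2 * lam * 10] on the first and at least [lam] on the second; [lam], which depends on [nu],
   cancels. *)
have [_ sY] := stable E bY KE; have [sZ _] := stable E bZ KE.
have sZ1 : 1 <= \sum_(k <- E) `|bZ k|.
  rewrite -[leLHS]Z1.
  pose N := \max_(k <- E) p (head 0%N (D (head 0%N (D' (psi k).+1)))).
  apply: le_trans (Wnorm_comb G bZ (N := N) _) _ => [k kE|].
    apply: supp_below_widen (wsupp (psi k)) _.
    exact: (leq_bigmax_seq (F := fun k => p (head 0%N (D (head 0%N (D' (psi k).+1)))))).
  by apply: ler_sum => k _; rewrite ler_piMr //; exact: w1.
rewrite Y1 in sY.
have nuZ0 : lam <= nu (comb (w \o psi) E bZ).
  by apply: le_trans sZ; rewrite ler_pMr.
apply/negP; rewrite -leNgt ler_pdivrMr; last exact: lt_le_trans nuZ0.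
apply: le_trans (nu_sum E bY) _.
have h20 : 2 * lam * \sum_(k <- E) `|bY k| <= 2 * lam * 10.
  by rewrite ler_wpM2l ?mulr_ge0 ?(ltW lam0) //; move: sY; lra.
by move: h20 nuZ0; lra.
Qed.

End Index.

Theorem theorem2 (R : realType) (S : Ord -> fam) (HS : schreier_system S)
  (xi : Ord) (Hxi : ole oone xi) (u : nat -> vec R) (Hu : block_basis u) :
  AD_is S (S (oexpw xi)) u (OS (oexpw xi)).
Proof.
have [H GH] := schreier_scale R HS Hxi; split.
  move=> t t1; have [nu [hnu hx]] := succ_fam_arb_distortable GH Hu t1.
  exists nu; split=> // x /hx[E [y [z [hE h1 h2 h3 h4]]]].
  by exists E, y, z; split=> //; exact/(schreier_succ HS).
(* [b] is at most omega^xi, which puts S_b inside S_(omega^xi) on a tail. *)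
move=> b /olt_OSE hb; apply: (not_arb_distortable GH Hu); first exact: schreier_regular.
exact: schreier_le.
Qed.
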